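(* Let $U,V$ be q-tame persistence modules over $\mathbf{R}$. Then $$\mathrm{d_i}(U,V)=\mathrm{d_b}(\mathrm{dgm}(U),\mathrm{dgm}(V)),$$ where $\mathrm{d_i}$ is the interleaving distance, $\mathrm{d_b}$ is the bottleneck distance and $\mathrm{dgm}$ denotes the undecorated persistence diagram.
   Context: Fix an arbitrary field $\mathbf{k}$; all vector spaces are over $\mathbf{k}$. A persistence module $V$ over $\mathbf{R}$ consists of vector spaces $(V_t\mid t\in\mathbf{R})$ and linear maps $v_s^t:V_s\to V_t$ for $s\le t$, with $v_t^t=\mathrm{id}$ and $v_s^t v_r^s=v_r^t$ for $r\le s\le t$. $V$ is q-tame if $\mathrm{rank}(v_s^t)<\infty$ whenever $s<t$. Interleaving distance. For $\delta\ge0$, $U,V$ are $\delta$-interleaved if there are linear maps $\phi_t:U_t\to V_{t+\delta}$ and $\psi_t:V_t\to U_{t+\delta}$ for all $t\in\mathbf{R}$ with $\phi_t u_s^t=v_{s+\delta}^{t+\delta}\phi_s$ and $\psi_t v_s^t=u_{s+\delta}^{t+\delta}\psi_s$ for all $s\le t$, and $\psi_{t+\delta}\phi_t=u_t^{t+2\delta}$, $\phi_{t+\delta}\psi_t=v_t^{t+2\delta}$ for all $t$. $\mathrm{d_i}(U,V)=\inf\{\delta\mid U,V\text{ are }\delta\text{-interleaved}\}$ ($=\infty$ if there is no such $\delta$). Persistence measure. For $-\infty\le a<b\le c<d\le+\infty$, with the convention $V_{-\infty}=V_{+\infty}=0$, $\mu_V([a,b]\times[c,d])\in\{0,1,2,\dots\}\cup\{\infty\}$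 is the number of summands that are nonzero (one-dimensional, connected by isomorphisms) exactly at the positions $b,c$ in a decomposition of $V_a\to V_b\to V_c\to V_d$ into interval modules (such a decomposition exists and the multiplicities are uniquely determined). Persistence diagram. Decorated numbers are symbols $p^+,p^-$ ($p\in\mathbf{R}$) together with $-\infty^+$ and $+\infty^-$; they are ordered, jointly with the extended reals, by $p^-<p<p^+$, and $p^+<q^-$ whenever $p<q$, with $-\infty<-\infty^+$ and $+\infty^-<+\infty$ the extreme elements. A decorated point $(p^*,q^* )$ belongs to a rectangle $[a,b]\times[c,d]$ if $a<p^*<b$ and $c<q^*<d$. For q-tame $V$ one has $\mu_V([a,b]\times[c,d])<\infty$ whenever $b<c$, and there is a unique multiset $\mathrm{Dgm}(V)$ of decorated points $(p^*,q^* )$ with $-\infty\le p<q\le+\infty$ such that for all $-\infty\le a<b<c<d\le+\infty$ the number of its points (with multiplicity) belonging to $[a,b]\times[c,d]$ equals $\mu_V([a,b]\times[c,d])$. The undecorated diagram $\mathrm{dgm}(V)$ is the multiset in $\{(p,q)\mid-\infty\le p<q\le+\infty\}$ obtained by forgetting the decorations. Bottleneck distance. Set $\mathrm{d}^\infty((p,q),(r,s))=\max(|p-r|,|q-s|)$, where equal infinite coordinates contribute $0$ and the distance is $\infty$ if some coordinate is infinite in one point and not equal to the corresponding coordinate of the other; $\mathrm{d}^\infty((p,q),\Delta)=\frac12(q-p)$ (which is $\infty$ if $p$ or $q$ is infinite). Regard multisets as sets by labelling repeated copies of points. A $\delta$-matching between $A$ and $B$ is a subset $M\subset A\times B$ in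 which each element of $A$ and of $B$ occurs in at most one pair, such that $\mathrm{d}^\infty(\alpha,\beta)\le\delta$ for $(\alpha,\beta)\in M$ and $\mathrm{d}^\infty(\gamma,\Delta)\le\delta$ for every unmatched $\gamma$ in $A$ or $B$. $\mathrm{d_b}(A,B)$ is the infimum of the $\delta$ for which a $\delta$-matching exists ($\infty$ if there is none). *)

(* Defs.v *)
From HB Require Import structures.
From mathcomp Require Import all_boot all_order all_algebra.
From mathcomp Require Import all_classical all_reals all_analysis.

Set Implicit Arguments.
Unset Strict Implicit.
Unset Printing Implicit Defensive.

Import Order.TTheory GRing.Theory Num.Theory.

Local Open Scope classical_set_scope.
Local Open Scope ring_scope.

(** * Persistence modules *)

(* The index poset is arbitrary: besides the real line, the extended real line
   and the four-element chain ['I_4] are needed for the persistence measure. *)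
Record pmod (k : fieldType) (d : Order.disp_t) (T : porderType d) := Pmod {
  pm_space :> T -> lmodType k;
  pm_map : forall s t : T, (s <= t)%O -> {linear pm_space s -> pm_space t};
  pm_map_id : forall (t : T) (h : (t <= t)%O) (x : pm_space t),
    pm_map h x = x;
  pm_map_comp : forall (r s t : T) (hrs : (r <= s)%O) (hst : (s <= t)%O)
      (hrt : (r <= t)%O) (x : pm_space r),
    pm_map hst (pm_map hrs x) = pm_map hrt x }.

Arguments Pmod {k d T}.
Arguments pm_map {k d T} p {s t}.

(* The image of [f] is spanned by finitely many of its elements. *)
Definition finite_rank (k : fieldType) (X Y : lmodType k) (f : X -> Y) : Prop :=
  exists (n : nat) (e : 'I_n -> X),
    forall x : X, exists c : 'I_n -> k, f x = \sum_(i < n) c i *: f (e i).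

Definition qtame (k : fieldType) (R : realType) (V : pmod k R) : Prop :=
  forall (s t : R) (h : s < t), finite_rank (pm_map V (ltW h)).

(** * Interleaving distance *)

Section Interleaving.
Context (k : fieldType) (R : realType).

Definition shift_morphism (delta : R) (U V : pmod k R)
    (phi : forall t : R, {linear U t -> V (t + delta)}) : Prop :=
  forall (s t : R) (h : s <= t) (h' : s + delta <= t + delta) (x : U s),
    phi t (pm_map U h x) = pm_map V h' (phi s x).

(* The index [t + 2 delta] appears as [t + delta + delta], so that the
   composites below typecheck without a transport. *)
Definition interleaved (delta : R) (U V : pmod k R) : Prop :=
  exists (phi : forall t : R, {linear U t -> V (t + delta)})
         (psi : forall t : R, {linear V t -> U (t + delta)}),
  [/\ shift_morphism phi,
      shift_morphism psi,
      forall (t : R) (h : t <= t + delta + delta) (x : U t),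
        psi (t + delta) (phi t x) = pm_map U h x
    & forall (t : R) (h : t <= t + delta + delta) (x : V t),
        phi (t + delta) (psi t x) = pm_map V h x].

Definition interleaving_distance (U V : pmod k R) : \bar R :=
  ereal_inf [set delta%:E | delta in [set delta : R |
    0 <= delta /\ interleaved delta U V]].

End Interleaving.

(** * Interval decompositions *)

Section IntervalDecomposition.
Context (k : fieldType) (d : Order.disp_t) (T : porderType d) (W : pmod k T).

Definition is_submodule (M : forall t : T, set (W t)) : Prop :=
  [/\ forall t, M t 0,
      forall t (a : k) (x y : W t), M t x -> M t y -> M t (a *: x + y)
    & forall s t (h : (s <= t)%O) (x : W s), M s x -> M t (pm_map W h x)].

Definition is_interval_set (J : set T) : Prop :=
  J !=set0 /\
  forall r s t : T, (r <= s)%O -> (s <= t)%O -> J r -> J t -> J s.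

Definition is_interval_summand (J : set T) (M : forall t : T, set (W t)) :
    Prop :=
  [/\ forall t, ~ J t -> M t = [set 0],
      forall t, J t ->
        exists2 e : W t, e != 0 & M t = [set a *: e | a in [set: k]]
    & forall s t (h : (s <= t)%O), J s -> J t ->
        set_bij (M s) (M t) (pm_map W h)].

Definition is_direct_sum (I : choiceType) (M : I -> forall t : T, set (W t)) :
    Prop :=
  forall (t : T) (x : W t), exists! y : I -> W t,
    [/\ forall i, M i t (y i),
        finite_set [set i | y i != 0]
      & x = \sum_(i \in [set: I]) y i].

(* [W] is the internal direct sum of the submodules [M i], and [M i] is an
   interval module supported on [J i]. *)
Definition interval_decomposition (I : choiceType) (J : I -> set T)
    (M : I -> forall t : T, set (W t)) : Prop :=
  [/\ forall i, is_interval_set (J i),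
      forall i, is_submodule (M i),
      forall i, is_interval_summand (J i) (M i)
    & is_direct_sum M].

End IntervalDecomposition.

(** * The persistence measure *)

(* The convention [V_{-oo} = V_{+oo} = 0]. *)
Section Extension.
Context (k : fieldType) (R : realType) (V : pmod k R).

Definition ext_space (t : \bar R) : lmodType k :=
  if t is r%:E then V r else 'rV[k]_0.

Definition ext_map (s t : \bar R) :
    (s <= t)%O -> {linear ext_space s -> ext_space t} :=
  match s, t return (s <= t)%O -> {linear ext_space s -> ext_space t} with
  | p%:E, q%:E => fun h => pm_map V (h : p <= q)
  | _, _ => fun=> \0
  end.

Lemma ext_map_id (t : \bar R) (h : (t <= t)%O) (x : ext_space t) :
  ext_map h x = x.
Proof.
case: t h x => [r| |] h x /=; first exact: pm_map_id.
- by apply/rowP => -[].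
- by apply/rowP => -[].
Qed.

Lemma ext_map_comp (r s t : \bar R) (hrs : (r <= s)%O) (hst : (s <= t)%O)
    (hrt : (r <= t)%O) (x : ext_space r) :
  ext_map hst (ext_map hrs x) = ext_map hrt x.
Proof.
case: r s t hrs hst hrt x => [r| |] [s| |] [t| |] hrs hst hrt x //=;
  by [exact: pm_map_comp | exact: linear0 | apply/rowP => -[]].
Qed.

Definition ext : pmod k (\bar R) := Pmod ext_space ext_map ext_map_id ext_map_comp.

End Extension.

Definition pullback (k : fieldType) (d d' : Order.disp_t) (S : porderType d)
    (T : porderType d') (f : S -> T)
    (hf : {homo f : x y / (x <= y)%O}) (V : pmod k T) : pmod k S :=
  Pmod (fun s => V (f s)) (fun s t (h : (s <= t)%O) => pm_map V (hf s t h))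
    (fun t h => pm_map_id (p := V) (hf t t h))
    (fun r s t hrs hst hrt =>
       pm_map_comp (p := V) (hf r s hrs) (hf s t hst) (hf r t hrt)).

(* The rectangle [[a, b] x [c, d]] with [a < b <= c < d]. *)
Record rectangle (R : realType) := Rectangle {
  ra : \bar R; rb : \bar R; rc : \bar R; rd : \bar R;
  rect_ab : (ra < rb)%E;
  rect_bc : (rb <= rc)%E;
  rect_cd : (rc < rd)%E }.

Section Measure.
Context (k : fieldType) (R : realType).

Definition corner (Q : rectangle R) : 'I_4 -> \bar R :=
  tnth [tuple ra Q; rb Q; rc Q; rd Q].

Lemma corner_homo (Q : rectangle R) : {homo corner Q : i j / (i <= j)%O}.
Proof.
have hab := ltW (rect_ab Q); have hbc := rect_bc Q; have hcd := ltW (rect_cd Q).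
have hac := le_trans hab hbc; have hbd := le_trans hbc hcd.
have had := le_trans hab hbd.
by move=> [[|[|[|[|i]]]] hi] [[|[|[|[|j]]]] hj] //; rewrite leEord /corner
  !(tnth_nth 0%E) /=.
Qed.

(* [V_a -> V_b -> V_c -> V_d] *)
Definition four_term (V : pmod k R) (Q : rectangle R) : pmod k 'I_4 :=
  pullback (@corner_homo Q) (ext V).

(* The positions [b] and [c] of [a, b, c, d], numbered from 0. *)
Definition middle : set 'I_4 := [set i : 'I_4 | (i == 1 :> nat) || (i == 2 :> nat)].

Definition is_pmeasure (V : pmod k R) (Q : rectangle R) (n : \bar R) : Prop :=
  exists (I : choiceType) (J : I -> set 'I_4)
         (M : I -> forall t : 'I_4, set (four_term V Q t)),
    interval_decomposition J M /\ n = counting [set i : I | J i = middle].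

Definition pmeasure (V : pmod k R) (Q : rectangle R) : \bar R :=
  xget 0%E [set n | is_pmeasure V Q n].

End Measure.

(** * Persistence diagrams *)

(* A multiset is given by its multiplicity function; finite multiplicities
   suffice because the diagram of a q-tame module is locally finite. *)
Definition multiset (T : choiceType) := T -> nat.

(* The set obtained by labelling repeated copies of points. *)
Definition copies (T : choiceType) (m : multiset T) : set (T * nat) :=
  [set x | (x.2 < m x.1)%N].

Definition push_multiset (S T : choiceType) (f : S -> T) (m : multiset S) :
    multiset T :=
  fun y => \sum_(x \in [set x | f x = y]) m x.

Section Diagram.
Context (R : realType).

(* Decorated numbers are [itv_bound]s: [BLeft p] is [p^-], [BRight p] is [p^+],
   [-oo%O] is [-oo^+] and [+oo%O] is [+oo^-]. *)
Definition decorated := itv_bound R.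

Definition undecorate (x : decorated) : \bar R :=
  match x with
  | BSide _ p => p%:E
  | BInfty true => -oo%E
  | BInfty false => +oo%E
  end.

Definition minus_decorated (x : decorated) : bool :=
  match x with
  | BSide b _ => b
  | BInfty b => ~~ b
  end.

(* [a < p^*]: as [p^- < p < p^+] are adjacent, this means [a < p] for [p^-] and
   [a <= p] for [p^+]; symmetrically for [p^* < b]. *)
Definition lt_ereal_dec (a : \bar R) (x : decorated) : bool :=
  if minus_decorated x then (a < undecorate x)%E else (a <= undecorate x)%E.

Definition lt_dec_ereal (x : decorated) (b : \bar R) : bool :=
  if minus_decorated x then (undecorate x <= b)%E else (undecorate x < b)%E.

Definition undecorate_point (x : decorated * decorated) : \bar R * \bar R :=
  (undecorate x.1, undecorate x.2).

Definition in_rectangle (Q : rectangle R) (x : decorated * decorated) : bool :=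
  [&& lt_ereal_dec (ra Q) x.1, lt_dec_ereal x.1 (rb Q),
      lt_ereal_dec (rc Q) x.2 & lt_dec_ereal x.2 (rd Q)].

Definition is_Dgm (k : fieldType) (V : pmod k R)
    (m : multiset (decorated * decorated)%type) : Prop :=
  (forall x, (0 < m x)%N -> (undecorate x.1 < undecorate x.2)%E) /\
  (forall Q : rectangle R, (rb Q < rc Q)%E ->
     counting (copies m `&` [set x | in_rectangle Q x.1]) = pmeasure V Q).

Definition Dgm (k : fieldType) (V : pmod k R) :
    multiset (decorated * decorated)%type :=
  xget (fun=> 0%N) [set m | is_Dgm V m].

Definition dgm (k : fieldType) (V : pmod k R) :
    multiset (\bar R * \bar R)%type :=
  push_multiset undecorate_point (Dgm V).

End Diagram.

(** * Bottleneck distance *)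

Section Bottleneck.
Context (R : realType).
Local Open Scope ereal_scope.

(* In the library [+oo - +oo = -oo], so equal infinite coordinates need a
   separate case. *)
Definition coord_dist (p r : \bar R) : \bar R :=
  if p == r then 0 else `|p - r|.

Definition dinfty (x y : \bar R * \bar R) : \bar R :=
  maxe (coord_dist x.1 y.1) (coord_dist x.2 y.2).

Definition dDelta (x : \bar R * \bar R) : \bar R := (2^-1)%:E * (x.2 - x.1).

Definition is_matching (delta : R) (A B : multiset (\bar R * \bar R)%type)
    (M : set (((\bar R * \bar R) * nat) * ((\bar R * \bar R) * nat))) : Prop :=
  [/\ M `<=` copies A `*` copies B,
      (forall x y y', M (x, y) -> M (x, y') -> y = y') /\
      (forall x x' y, M (x, y) -> M (x', y) -> x = x'),
      forall x y, M (x, y) -> dinfty x.1 y.1 <= delta%:E,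
      forall x, copies A x -> (forall y, ~ M (x, y)) -> dDelta x.1 <= delta%:E
    & forall y, copies B y -> (forall x, ~ M (x, y)) -> dDelta y.1 <= delta%:E].

Definition bottleneck_distance (A B : multiset (\bar R * \bar R)%type) :
    \bar R :=
  ereal_inf [set delta%:E | delta in [set delta : R |
    (0 <= delta)%R /\ exists M, is_matching delta A B M]].

End Bottleneck.

(* Main.v *)
(** Every invariant is read off the ranks [r(s,t)] of the structure maps: the
    measure of [[a,b]x[c,d]] is [r(b,c) - r(a,c) - r(b,d) + r(a,d)], and
    Frobenius' rank inequality makes it nonnegative. A diagram exists for every
    such rank function, not only for those of modules.

    Stability. Let [phi, psi] be a [delta]-interleaving. The image of [phi] has
    rank function [rho(s,t) = rank (phi_t u_s^t)], hence a diagram. As a quotient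
    of [U] with kernel killed by [2 delta] and a submodule of the shift of [V]
    with cokernel killed by [2 delta], it is compared with both by Frobenius'
    inequality. Among points with a fixed birth, sorted by decreasing death, we
    match points of [U] and of the image that have the same position; among
    points with a fixed death, sorted by increasing birth, those of the image and
    of [V]. The composite is a [delta]-matching.

    Converse. A q-tame module need not decompose, but its restriction to a grid
    [eps Z] does: the images in each of its terms stabilise towards [-oo], and
    choosing, for each support, a basis modulo the bars of smaller support or
    older birth gives a barcode. Counting quadrants shows that bars with at least
    two grid points correspond bijectively to diagram points with the same trace
    on the grid. A matching of diagrams therefore matches bars, which defines an
    interleaving on the grid and, up to [O(eps)], on the line. *)

Require Import Defs.
From HB Require Import structures.
From mathcomp Require Import all_boot all_order all_algebra.
From mathcomp Require Import all_classical all_reals all_analysis.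
From mathcomp Require Import zify lra.

Set Implicit Arguments.
Unset Strict Implicit.
Unset Printing Implicit Defensive.

Import Order.TTheory GRing.Theory Num.Theory.

Local Open Scope classical_set_scope.
Local Open Scope ring_scope.

(** * Finite cardinals *)

(** The obstacle is that a q-tame module may have infinite-dimensional terms: the product of the
    interval modules on [[0, 1/n]] is q-tame but is not a direct sum of interval modules. Ranks are
    therefore used only for [s < t], and decompositions only over the integers, where Mittag-Leffler
    stabilisation of images replaces finiteness of the terms; the same theorem decomposes the
    four-term sequences of the persistence measure. A grid loses decorations and the bars that meet
    it in a single point. The former do not enter the bottleneck distance, the latter are killed by
    one grid step, and the remaining error disappears in the infimum.

    Passing through the image of [phi] makes each comparison one-sided. In a quotient births persist
    and deaths only move earlier; in a submodule deaths persist and births only move later. Counting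
    the points with one coordinate fixed then bounds the other coordinate of the partner, so sorted
    lists can be matched by position, without interpolating between [U] and [V]. *)

Definition hascard (T : choiceType) (A : set T) (n : nat) : Prop :=
  exists s : seq T, [/\ uniq s, size s = n & forall x, A x <-> x \in s].

Section Hascard.
Variable T : choiceType.
Implicit Types (A B P : set T) (m n : nat).

Lemma hascard_le A B m n :
  A `<=` B -> hascard A m -> hascard B n -> (m <= n)%N.
Proof.
move=> AB [s [us <- hs]] [t [ut <- ht]]; apply: uniq_leq_size => // x /hs Ax.
by apply/ht/AB.
Qed.

Lemma hascard_inj A m n : hascard A m -> hascard A n -> m = n.
Proof.
by move=> hm hn; apply/eqP; rewrite eqn_leq !(hascard_le (A:=A) (B:=A)).
Qed.

Lemma hascard_setI A P n : hascard A n ->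
  exists2 m, (m <= n)%N & hascard (A `&` P) m.
Proof.
move=> [s [us <- hs]]; exists (size [seq x <- s | `[< P x >]]).
  by rewrite size_filter count_size.
exists [seq x <- s | `[< P x >]]; split; rewrite ?filter_uniq // => x.
rewrite mem_filter; split=> [[/hs -> Px]|/andP[/asboolP Px /hs Ax]] //.
by rewrite andbT; apply/asboolP.
Qed.

Lemma hascard_sub A B n : A `<=` B -> hascard B n ->
  exists2 m, (m <= n)%N & hascard A m.
Proof.
by move=> AB /(hascard_setI A); rewrite (setIidr AB).
Qed.

Lemma hascardU A B m n : A `&` B = set0 -> hascard A m -> hascard B n ->
  hascard (A `|` B) (m + n).
Proof.
move=> AB0 [s [us <- hs]] [t [ut <- ht]]; exists (s ++ t).
split=> [||x]; rewrite ?size_cat //.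
  rewrite cat_uniq us ut andbT; apply/hasPn => x /ht Bx; apply/negP => /hs Ax.
  by rewrite -[False]/(set0 x) -AB0.
rewrite mem_cat; split=> [[/hs->|/ht->]|/orP[/hs|/ht]] //; rewrite ?orbT //.
  by left.
by right.
Qed.

Lemma hascardD A P m n : hascard A n -> hascard (A `&` P) m ->
  hascard (A `&` ~` P) (n - m).
Proof.
move=> hA hP; have [q _ hq] := hascard_setI (~` P) hA.
have := hascardU _ hP hq; rewrite setIACA setICr setI0 -setIUr setUv setIT.
by move=> /(_ erefl) /(hascard_inj hA) ->; rewrite addKn.
Qed.

Lemma hascard0 A : (forall x, ~ A x) -> hascard A 0.
Proof. by move=> A0; exists [::]; split => // x; split => [/A0|]. Qed.

Lemma hascard_counting (R : realType) A n :
  hascard A n <-> counting A = n%:R%:E :> \bar R.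
Proof.
rewrite /counting; case: asboolP => fA; last first.
  split=> [[s [_ _ hs]]|//]; case: fA.
  suff -> : A = [set` s] by apply: finite_seq.
  by apply/seteqP; split=> x /hs.
have cA : hascard A (size (finmap.enum_fset (fset_set A))).
  exists (finmap.enum_fset (fset_set A)); split => [||x]; first exact: finmap.fset_uniq.
  - by [].
  - by rewrite in_fset_set // in_setE.
split=> [/(hascard_inj cA) -> //|[h]].
by rewrite -(mulrIn (oner_neq0 R) h).
Qed.

(** A longest duplicate-free list of elements of [A] exists by the bound, and it exhausts [A]: any
    missing element would lengthen it. *)
Lemma hascard_bounded A n :
  (forall s : seq T, uniq s -> (forall x, x \in s -> A x) -> (size s <= n)%N) ->
  exists2 m, (m <= n)%N & hascard A m.
Proof.
move=> bound.
pose P m := `[< exists s : seq T, [/\ uniq s, size s = m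
   & forall x, x \in s -> A x] >].
have P0 : exists m, P m by exists 0%N; apply/asboolP; exists [::].
have Pn m : P m -> (m <= n)%N by move=> /asboolP[s [us <- sA]]; exact: bound.
case: (ex_maxnP P0 Pn) => m Pm maxm; exists m; first exact: Pn.
have [s [us sm sA]] := asboolP _ Pm.
exists s; split=> // x; split=> [Ax|/sA //].
apply/negPn/negP => xs.
suff /maxm : P m.+1 by rewrite ltnn.
apply/asboolP; exists (x :: s); rewrite /= xs us sm; split=> // y.
by rewrite inE => /orP[/eqP ->|/sA].
Qed.

End Hascard.

(** Matchings are relations rather than partial functions, so that inverses and composites require
    no choice of partners. *)
Definition partial_bij (S T : Type) (E : S -> T -> Prop) : Prop :=
  (forall x y y', E x y -> E x y' -> y = y') /\
  (forall x x' y, E x y -> E x' y -> x = x').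

Lemma partial_bij_sym (S T : Type) (E : S -> T -> Prop) :
  partial_bij E -> partial_bij (fun y x => E x y).
Proof.
by move=> [E1 E2]; split=> [y x x'|y y' x]; [exact: E2|exact: E1].
Qed.

Lemma partial_bij_comp (S T U : Type) (E : S -> T -> Prop) (F : T -> U -> Prop) :
  partial_bij E -> partial_bij F ->
  partial_bij (fun x z => exists2 y, E x y & F y z).
Proof.
move=> [E1 E2] [F1 F2].
split=> [x y y' [z xz zy] [z' xz' zy']|x x' y [z xz zy] [z' xz' zy']].
  by move: zy'; rewrite -(E1 _ _ _ xz xz'); apply: F1.
by move: xz'; rewrite -(F2 _ _ _ zy zy'); apply: E2.
Qed.

(** Over each colour in [D] both fibres are enumerated by lists of the same length, and elements
    with the same index are paired. *)
Lemma hascard_fiber_bij (S T : choiceType) (C : Type) (A : set S) (B : set T)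
    (f : S -> C) (g : T -> C) (D : set C) :
  (forall c, D c -> exists2 n, hascard (A `&` [set x | f x = c]) n
                             & hascard (B `&` [set y | g y = c]) n) ->
  exists E : S -> T -> Prop,
  [/\ partial_bij E,
      forall x y, E x y -> [/\ A x, B y & f x = g y],
      forall x, A x -> D (f x) -> exists y, E x y
    & forall y, B y -> D (g y) -> exists x, E x y].
Proof.
move=> fib.
have /choice[st hst] c : exists st : seq S * seq T, D c ->
    [/\ uniq st.1, uniq st.2, size st.1 = size st.2,
        forall x, x \in st.1 <-> A x /\ f x = c
      & forall y, y \in st.2 <-> B y /\ g y = c].
  have [Dc|nDc] := pselect (D c); last by exists ([::], [::]).
  have [n [s [us sn hs]] [t [ut tn ht]]] := fib c Dc.
  exists (s, t) => _; split=> //; first by rewrite sn tn.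
    by move=> x; rewrite -(hs x).
  by move=> y; rewrite -(ht y).
exists (fun x y => exists c, [/\ D c, x \in (st c).1, y \in (st c).2
  & index x (st c).1 = index y (st c).2]).
split; last 2 first.
- move=> x Ax Dx; have [us ut sz hs ht] := hst _ Dx.
  have xs : x \in (st (f x)).1 by apply/hs.
  case E: (st (f x)).2 sz => [|y0 t] sz.
    by case: (st (f x)).1 xs sz.
  rewrite -E in sz; exists (nth y0 (st (f x)).2 (index x (st (f x)).1)).
  have lt : (index x (st (f x)).1 < size (st (f x)).2)%N.
    by rewrite -sz index_mem.
  by exists (f x); split=> //; rewrite ?mem_nth // index_uniq.
- move=> y By Dy; have [us ut sz hs ht] := hst _ Dy.
  have yt : y \in (st (g y)).2 by apply/ht.
  case E: (st (g y)).1 sz => [|x0 t] sz.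
    by case: (st (g y)).2 yt sz.
  rewrite -E in sz; exists (nth x0 (st (g y)).1 (index y (st (g y)).2)).
  have lt : (index y (st (g y)).2 < size (st (g y)).1)%N.
    by rewrite sz index_mem.
  by exists (g y); split=> //; rewrite ?mem_nth // index_uniq.
- split=> [x y y' [c [Dc xs yt xy]] [c' [Dc' xs' yt' xy']]|
           x x' y [c [Dc xs yt xy]] [c' [Dc' xs' yt' xy']]].
    have [us ut sz hs ht] := hst _ Dc; have [_ _ _ hs' _] := hst _ Dc'.
    have cc' : c' = c by have /hs[_ <-] := xs; have /hs'[_ <-] := xs'.
    subst c'; have : index y (st c).2 = index y' (st c).2 by rewrite -xy -xy'.
    exact: index_inj.
  have [us ut sz hs ht] := hst _ Dc; have [_ _ _ _ ht'] := hst _ Dc'.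
  have cc' : c' = c by have /ht[_ <-] := yt; have /ht'[_ <-] := yt'.
  subst c'; have : index x (st c).1 = index x' (st c).1 by rewrite xy xy'.
  exact: index_inj.
- move=> x y [c [Dc xs yt _]]; have [_ _ _ hs ht] := hst _ Dc.
  by have /hs[Ax ->] := xs; have /ht[By ->] := yt.
Qed.

(** * Ranks and bases *)

Section Span.
Variables (k : fieldType) (X : lmodType k).
Implicit Types (A B C : set X) (s t : seq X) (x y : X) (a : k).

Definition linsub A : Prop :=
  A 0 /\ forall a x y, A x -> A y -> A (a *: x + y).

Lemma linsubZ A a x : linsub A -> A x -> A (a *: x).
Proof. by move=> [A0 AP] Ax; rewrite -[_ *: _]addr0; apply: AP. Qed.

Lemma linsubD A x y : linsub A -> A x -> A y -> A (x + y).
Proof. by move=> [A0 AP] Ax Ay; rewrite -[x]scale1r; apply: AP. Qed.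

Lemma linsub_sum A (I : eqType) (s : seq I) (f : I -> X) :
  linsub A -> (forall i, i \in s -> A (f i)) -> A (\sum_(i <- s) f i).
Proof.
move=> sA; elim: s => [|i s IH] h; first by rewrite big_nil; case: sA.
rewrite big_cons; apply: linsubD => //; first by apply: h; rewrite mem_head.
by apply: IH => j js; apply: h; rewrite inE js orbT.
Qed.

Fixpoint lspan s : set X :=
  if s is x :: t then [set z | exists a, exists2 y, lspan t y & z = a *: x + y]
  else [set 0].

(** Each vector has to avoid the span of those after it, so a free list is enlarged at its head by
    any vector outside its span. *)
Fixpoint lfree s : Prop := if s is x :: t then ~ lspan t x /\ lfree t else True.

Lemma lspan_linsub s : linsub (lspan s).
Proof.
elim: s => [|z s [IH0 IH]]; split=> //=.
- by move=> a x y -> ->; rewrite scaler0 addr0.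
- by exists 0, 0; rewrite // scale0r addr0.
move=> a x y [b [u us ->]] [c [v vs ->]].
exists (a * b + c), (a *: u + v); first exact: IH.
by rewrite scalerDr scalerDl scalerA addrACA.
Qed.

Lemma lspan_mem s x : x \in s -> lspan s x.
Proof.
elim: s => //= y s IH; rewrite inE => /orP[/eqP ->|/IH xs].
  by exists 1, 0; [case: (lspan_linsub s)|rewrite scale1r addr0].
by exists 0, x; rewrite // scale0r add0r.
Qed.

Lemma lspan_sub s A : linsub A -> (forall x, x \in s -> A x) ->
  lspan s `<=` A.
Proof.
move=> sA; elim: s => [|y s IH] sub x /=; first by move=> ->; case: sA.
move=> [a [z /IH zs ->]]; apply: sA.2; first by apply: sub; rewrite mem_head.
by apply: zs => u us; apply: sub; rewrite inE us orbT.
Qed.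

Lemma lspan_ordP s x :
  lspan s x <-> exists c : 'I_(size s) -> k, x = \sum_(i < size s) c i *: s`_i.
Proof.
split; last first.
  move=> [c ->]; apply: linsub_sum; first exact: lspan_linsub.
  move=> i _; apply: linsubZ; first exact: lspan_linsub.
  by apply/lspan_mem/mem_nth.
elim: s x => [|y s IH] x /=; first by move=> ->; exists (fun=> 0); rewrite big_ord0.
move=> [a [z /IH[c ->] ->]].
exists (fun i => if unlift ord0 i is Some j then c j else a).
rewrite big_ord_recl unlift_none; congr (_ + _).
by apply: eq_bigr => i _; rewrite liftK.
Qed.

Lemma lfree_ord s (c : 'I_(size s) -> k) :
  lfree s -> \sum_(i < size s) c i *: s`_i = 0 -> forall i, c i = 0.
Proof.
elim: s c => [|y s IH] c /=; first by move=> _ _ [].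
move=> [ny fs]; rewrite big_ord_recl /= => e.
have c0 : c ord0 = 0.
  apply/eqP/negPn/negP => c0; apply: ny.
  have -> : y = - (c ord0)^-1 *: \sum_(i < size s) c (lift ord0 i) *: s`_i.
    move/eqP: e; rewrite addr_eq0 => /eqP e.
    by rewrite -[X in - _ *: X]opprK -e scalerN scaleNr opprK scalerA mulVf ?scale1r.
  apply: linsubZ; first exact: lspan_linsub.
  by apply/lspan_ordP; exists (fun i => c (lift ord0 i)).
move: e; rewrite c0 scale0r add0r => /IH h i.
by case: (unliftP ord0 i) => [j ->|-> //]; exact: h.
Qed.

(** The coordinates of [s] with respect to [t] form a matrix. A row in its left kernel would be a
    linear relation on [s], so the matrix is row free and has at least as many columns as rows. *)
Lemma lfree_size s t : lfree s -> (forall x, x \in s -> lspan t x) ->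
  (size s <= size t)%N.
Proof.
move=> fs st.
have /choice[M hM] (i : 'I_(size s)) : exists c : 'I_(size t) -> k,
    s`_i = \sum_(j < size t) c j *: t`_j.
  by apply/lspan_ordP/st/mem_nth.
pose A := \matrix_(i, j) M i j.
suff /eqP <- : row_free A by exact: rank_leq_col.
rewrite -kermx_eq0; apply/eqP/row_matrixP => i.
rewrite row0; apply/rowP => j; rewrite mxE [RHS]mxE.
apply: (lfree_ord (c := fun j => kermx A i j) fs).
under eq_bigr => l _ do rewrite hM scaler_sumr.
rewrite exchange_big big1 //= => l _.
under eq_bigr => j0 _ do rewrite scalerA.
rewrite -scaler_suml.
have /matrixP/(_ i l) := mulmx_ker A; rewrite !mxE => e.
rewrite (_ : \sum_(j < _) _ = 0) ?scale0r // -[RHS]e.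
by apply: eq_bigr => j0 _; rewrite [A _ _]mxE.
Qed.

(** The ambient spaces may be infinite-dimensional, so dimension is a relation, witnessed by a
    finite basis. *)
Definition hasdim A n := exists s, [/\ lfree s, size s = n & A = lspan s].

Lemma hasdim_le A B m n : A `<=` B -> hasdim A m -> hasdim B n -> (m <= n)%N.
Proof.
move=> AB [s [fs <- eA]] [t [ft <- eB]]; apply: lfree_size => // x xs.
by rewrite -eB; apply: AB; rewrite eA; apply: lspan_mem.
Qed.

Lemma hasdim_inj A m n : hasdim A m -> hasdim A n -> m = n.
Proof.
by move=> hm hn; apply/eqP; rewrite eqn_leq !(hasdim_le (A:=A) (B:=A)).
Qed.

(** Vectors of [A] outside the current span are added one at a time; a free list inside [lspan t]
    cannot outgrow [t], so this stops. *)
Lemma lfree_extend s t A : linsub A -> A `<=` lspan t ->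
  lfree s -> (forall x, x \in s -> A x) ->
  exists u, lfree (u ++ s) /\ A = lspan (u ++ s).
Proof.
move=> sA At; have [n] := ubnP (size t - size s)%N.
elim: n s => // n IH s lt fs sub.
have [e|] := pselect (forall x, A x -> lspan s x).
  exists [::]; split=> //; apply/seteqP; split; first exact: e.
  exact: lspan_sub.
move=> /existsNP[x /not_implyP[Ax nx]].
have fxs : lfree (x :: s) by [].
have sub' : forall y, y \in x :: s -> A y.
  by move=> y; rewrite inE => /orP[/eqP ->|/sub].
have := lfree_size fxs (fun y ys => At y (sub' y ys)) => /= ltt.
have [|//|//|u] := IH (x :: s); first by rewrite /=; lia.
by exists (rcons u x); rewrite cat_rcons.
Qed.

Lemma hasdim_sub t A : linsub A -> A `<=` lspan t ->
  exists2 n, (n <= size t)%N & hasdim A n.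
Proof.
move=> sA At; have [//|u] := lfree_extend (s := [::]) sA At I.
rewrite cats0 => -[fu eA]; exists (size u); last by exists u.
by apply: lfree_size => // x xu; apply: At; rewrite eA; apply: lspan_mem.
Qed.

Lemma hasdim_linsub A n : hasdim A n -> linsub A.
Proof. by move=> [s [_ _ ->]]; exact: lspan_linsub. Qed.

(** Completing a basis of [A] to one of [B] adds no vector when the dimensions agree. *)
Lemma hasdim_eq A B n : A `<=` B -> hasdim A n -> hasdim B n -> A = B.
Proof.
move=> AB hA hB; have [s [fs sn eA]] := hA; have [t [ft tn eB]] := hB.
have [||//||u [fu e]] := @lfree_extend s t B.
- exact: hasdim_linsub hB.
- by rewrite eB.
- by move=> x xs; apply: AB; rewrite eA; apply: lspan_mem.
have hu : hasdim B (size (u ++ s)) by exists (u ++ s).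
have := hasdim_inj hB hu; rewrite size_cat sn.
case: u fu e hu => [|x u] fu e hu; last by rewrite /=; lia.
by rewrite eA e.
Qed.

End Span.

Section Rank.
Variable k : fieldType.

Lemma range_linsub (X Y : lmodType k) (f : {linear X -> Y}) :
  linsub (range f).
Proof.
split; first by exists 0; rewrite ?linear0.
by move=> a _ _ [x _ <-] [y _ <-]; exists (a *: x + y); rewrite ?linearP.
Qed.

(** The default 0 is also the value on maps of infinite rank, so the number is meaningful only
    together with [finite_rank]. *)
Definition rank (X Y : lmodType k) (f : X -> Y) : nat :=
  xget 0%N [set n | hasdim (range f) n].

Lemma lspan_map (X Y : lmodType k) (f : {linear X -> Y}) s :
  f @` lspan s = lspan (map f s).
Proof.
elim: s => [|x s IH] /=; first by rewrite image_set1 linear0.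
rewrite -IH; apply/seteqP; split=> [_ [_ [a [y ys ->]] <-]|].
  by exists a, (f y); [exists y|rewrite linearP].
move=> _ [a [_ [y ys <-] ->]]; exists (a *: x + y); last by rewrite linearP.
by exists a, y.
Qed.

Lemma finite_rankP (X Y : lmodType k) (f : {linear X -> Y}) :
  finite_rank f <-> hasdim (range f) (rank f).
Proof.
split=> [[n [e he]]|[s [fs ss rs]]].
  have [|m _ hm] := @hasdim_sub _ _ [seq f (e i) | i <- enum 'I_n] _ (range_linsub f).
    move=> _ [x _ <-]; have [c ->] := he x; apply: linsub_sum.
      exact: lspan_linsub.
    move=> i _; apply: linsubZ; first exact: lspan_linsub.
    by apply/lspan_mem/map_f; rewrite mem_enum.
  by rewrite /rank; case: xgetP => [_ _ //|/(_ m)].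
have /choice[e he] (i : 'I_(size s)) : exists x, f x = s`_i.
  have : lspan s s`_i by apply/lspan_mem/mem_nth.
  by rewrite -rs => -[x _ <-]; exists x.
exists (size s), e => x; have : range f (f x) by exists x.
rewrite rs => /lspan_ordP[c ->]; exists c.
by apply: eq_bigr => i _; rewrite he.
Qed.

Lemma hasdim_rank (X Y : lmodType k) (f : {linear X -> Y}) n :
  hasdim (range f) n -> rank f = n.
Proof.
by move=> h; rewrite /rank; case: xgetP => [m _ /hasdim_inj/(_ h)|/(_ n)].
Qed.

Lemma finite_rank_comp (X Y Z W : lmodType k) (f : {linear X -> Y})
   (g : {linear Y -> Z}) (h : {linear Z -> W}) :
  finite_rank g -> finite_rank (h \o g \o f).
Proof.
move=> /finite_rankP[s [fs ss rs]].
have [|n _ hn] := @hasdim_sub _ _ (map h s) _ (range_linsub (h \o g \o f)).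
  move=> _ [x _ <-]; rewrite -lspan_map -rs /=; exists (g (f x)) => //.
  by exists (f x).
by apply/finite_rankP; rewrite (hasdim_rank hn).
Qed.

(* Frobenius: with [A = im (g f)] inside [B = im g], the kernel of [h] on [A]
   is at most as large as on [B]. *)
Lemma rank_frobenius (X Y Z W : lmodType k) (f : {linear X -> Y})
   (g : {linear Y -> Z}) (h : {linear Z -> W}) : finite_rank g ->
  (rank (g \o f) + rank (h \o g) <= rank g + rank (h \o g \o f))%N.
Proof.
move=> fg.
have /finite_rankP[t [ft <- eB]] := fg.
have /finite_rankP[s [fs <- eA]] : finite_rank (g \o f).
  exact: (@finite_rank_comp _ _ _ _ f g idfun).
have /finite_rankP[q [fq <- eq]] : finite_rank (h \o g).
  exact: (@finite_rank_comp _ _ _ _ idfun g h).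
have /finite_rankP[p [fp <- ep]] : finite_rank (h \o g \o f).
  exact: finite_rank_comp.
have [||//||u [fu eu]] := @lfree_extend _ _ s t (range g).
- exact: range_linsub.
- by rewrite eB.
- move=> x /lspan_mem; rewrite -eA => -[y _ <-]; by exists (f y).
have -> : size t = (size u + size s)%N.
  rewrite -size_cat; apply: (@hasdim_inj _ _ (range g)); first by exists t.
  by exists (u ++ s).
(* In these bases the inequality says that [rank (h \o g)] exceeds [rank (h \o g \o f)] by at most
   [size u]. *)
suff : (size q <= size (map h u ++ p))%N.
  move=> le; rewrite [X in (_ <= X)%N]addnAC addnC leq_add2r.
  by rewrite size_cat size_map in le.
apply: lfree_size => // x /lspan_mem; rewrite -eq => -[y _ <-] /=.
have : lspan (u ++ s) (g y) by rewrite -eu; exists y.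
move: (g y) => {x y} z zus.
have : (h @` lspan (u ++ s)) (h z) by exists z.
rewrite lspan_map; apply: lspan_sub; first exact: lspan_linsub.
move=> w; rewrite map_cat mem_cat => /orP[wu|/mapP[v vs ->]].
  by apply: lspan_mem; rewrite mem_cat wu.
have : range (h \o g \o f) (h v).
  have : lspan s v by exact: lspan_mem.
  by rewrite -eA => -[y _ <-]; exists y.
rewrite ep; apply: lspan_sub; first exact: lspan_linsub.
by move=> {}w wp; apply: lspan_mem; rewrite mem_cat wp orbT.
Qed.

End Rank.

(** * Independent and spanning families *)

Section Families.
Variables (k : fieldType) (I : choiceType).
Implicit Types (P Q : set I) (l : seq (I * k)).

(** A formal combination may repeat an index, so that addition is concatenation of lists; [indices]
    and [coef] recover the reduced form. *)
Definition lcomb (X : lmodType k) (e : I -> X) l : X :=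
  \sum_(p <- l) p.2 *: e p.1.

Definition indices l : seq I := undup (map fst l).
Definition coef l (i : I) : k := \sum_(p <- l | p.1 == i) p.2.

Definition indep (X : lmodType k) P (e : I -> X) : Prop :=
  forall (s : seq I) (c : I -> k), uniq s -> (forall i, i \in s -> P i) ->
    \sum_(i <- s) c i *: e i = 0 -> forall i, i \in s -> c i = 0.

Definition spanf (X : lmodType k) P (e : I -> X) : set X :=
  [set x | exists2 l, (forall p, p \in l -> P p.1) & x = lcomb e l].

Lemma lcombE (X : lmodType k) (e : I -> X) l :
  lcomb e l = \sum_(i <- indices l) coef l i *: e i.
Proof.
rewrite /lcomb /coef; under [RHS]eq_bigr => i _ do rewrite scaler_suml.
rewrite (exchange_big_dep predT) //= [LHS]big_seq [RHS]big_seq.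
apply: eq_bigr => p pl; have pi : p.1 \in indices l by rewrite mem_undup map_f.
rewrite big_mkcond (bigD1_seq p.1) ?undup_uniq //= eqxx big1 ?addr0 //.
by move=> i /negPf ip; rewrite eq_sym ip.
Qed.

Lemma indicesP P l : (forall p, p \in l -> P p.1) ->
  forall i, i \in indices l -> P i.
Proof. by move=> h i; rewrite mem_undup => /mapP[p pl ->]; exact: h. Qed.

Lemma lcomb_cat (X : lmodType k) (e : I -> X) l l' :
  lcomb e (l ++ l') = lcomb e l + lcomb e l'.
Proof. by rewrite /lcomb big_cat. Qed.

Definition scalel (a : k) l := [seq (p.1, a * p.2) | p <- l].

Lemma lcomb_scale (X : lmodType k) (e : I -> X) a l :
  lcomb e (scalel a l) = a *: lcomb e l.
Proof.
rewrite /lcomb big_map scaler_sumr.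
by apply: eq_bigr => p _; rewrite scalerA.
Qed.

Lemma scalelP P a l : (forall p, p \in l -> P p.1) ->
  forall p, p \in scalel a l -> P p.1.
Proof. by move=> h p /mapP[q /h Pq ->]. Qed.

Lemma catlP P l l' : (forall p, p \in l -> P p.1) ->
  (forall p, p \in l' -> P p.1) -> forall p, p \in l ++ l' -> P p.1.
Proof. by move=> h h' p; rewrite mem_cat => /orP[/h|/h']. Qed.

Lemma spanf_linsub (X : lmodType k) P (e : I -> X) : linsub (spanf P e).
Proof.
split; first by exists [::]; rewrite // /lcomb big_nil.
move=> a _ _ [l lP ->] [l' lP' ->]; exists (scalel a l ++ l').
  by apply: catlP => //; apply: scalelP.
by rewrite lcomb_cat lcomb_scale.
Qed.

Lemma spanf_mem (X : lmodType k) P (e : I -> X) i : P i -> spanf P e (e i).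
Proof.
move=> Pi; exists [:: (i, 1)]; first by move=> p; rewrite inE => /eqP ->.
by rewrite /lcomb big_seq1 scale1r.
Qed.

Lemma spanf_sum (X : lmodType k) P (e : I -> X) (s : seq I) (c : I -> k) :
  (forall i, i \in s -> P i) -> spanf P e (\sum_(i <- s) c i *: e i).
Proof.
move=> sP; apply: linsub_sum; first exact: spanf_linsub.
move=> i /sP Pi; apply: linsubZ; first exact: spanf_linsub.
exact: spanf_mem.
Qed.

Lemma spanf_sub (X : lmodType k) P (e : I -> X) (A : set X) :
  linsub A -> (forall i, P i -> A (e i)) -> spanf P e `<=` A.
Proof.
move=> sA h _ [l lP ->]; apply: linsub_sum => // p pl.
by apply: linsubZ => //; apply/h/lP.
Qed.

Lemma spanf_uniq (X : lmodType k) P (e : I -> X) x : spanf P e x ->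
  exists s : seq I, exists c : I -> k, [/\ uniq s, forall i, i \in s -> P i
    & x = \sum_(i <- s) c i *: e i].
Proof.
move=> [l lP ->]; exists (indices l), (coef l).
by rewrite undup_uniq lcombE; split=> //; apply: indicesP.
Qed.

(** A relation among independent vectors has zero coefficients only, hence holds for any other
    vectors with the same indices. This makes linear extensions well defined. *)
Lemma indep_lcomb (X Y : lmodType k) P (e : I -> X) (g : I -> Y) l :
  indep P e -> (forall p, p \in l -> P p.1) -> lcomb e l = 0 -> lcomb g l = 0.
Proof.
move=> ie lP; rewrite !lcombE => /ie h.
rewrite big_seq big1 // => i il; rewrite h ?scale0r //.
  by rewrite undup_uniq.
exact: indicesP.
Qed.

Lemma linear_extension (X Y : lmodType k) P (e : I -> X) (g : I -> Y) :
  indep P e -> (forall x, spanf P e x) ->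
  exists f : {linear X -> Y}, forall i, P i -> f (e i) = g i.
Proof.
move=> ie se.
have /choice[r hr] x : exists l, (forall p, p \in l -> P p.1) /\ x = lcomb e l.
  by have [l lP ->] := se x; exists l.
pose f x := lcomb g (r x).
have fE l : (forall p, p \in l -> P p.1) -> f (lcomb e l) = lcomb g l.
  move=> lP; have [rP re] := hr (lcomb e l).
  have : lcomb g (r (lcomb e l) ++ scalel (-1) l) = 0.
    apply: (indep_lcomb _ ie).
      by apply: catlP => //; apply: scalelP.
    by rewrite lcomb_cat lcomb_scale scaleN1r -re subrr.
  by rewrite lcomb_cat lcomb_scale scaleN1r => /eqP; rewrite subr_eq0 => /eqP.
(* By [fE] the value of [f] does not depend on the representation chosen, so a sum may be evaluated
   on the concatenated representation. *)
have lin_f : linear f.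
  move=> a x y; have [xP xe] := hr x; have [yP ye] := hr y.
  rewrite {1}xe {1}ye -lcomb_scale -lcomb_cat fE ?lcomb_cat ?lcomb_scale //.
  by apply: catlP => //; apply: scalelP.
pose fm := GRing.isLinear.Build k X Y _ f lin_f.
pose F : {linear X -> Y} := HB.pack f fm.
exists F => i Pi; rewrite -[e i]scale1r.
have := fE [:: (i, 1)]; rewrite /lcomb !big_seq1 /= !scale1r; apply.
by move=> p; rewrite inE => /eqP ->.
Qed.

Lemma lspan_map_uniq (X : lmodType k) (e : I -> X) (s : seq I) x : uniq s ->
  lspan (map e s) x <-> exists c : I -> k, x = \sum_(i <- s) c i *: e i.
Proof.
move=> us; split; last first.
  move=> [c ->]; apply: linsub_sum; first exact: lspan_linsub.
  move=> i si; apply: linsubZ; first exact: lspan_linsub.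
  by apply/lspan_mem/map_f.
elim: s us x => [_ x ->|i s IH /= /andP[ns us] x [a [y /(IH us)[c ->] ->]]].
  by exists (fun=> 0); rewrite big_nil.
exists (fun j => if j == i then a else c j); rewrite big_cons eqxx.
congr (_ + _); rewrite !big_seq; apply: eq_bigr => j js.
by case: eqP js => // ->; rewrite (negPf ns).
Qed.

Lemma indep_lfree (X : lmodType k) P (e : I -> X) (s : seq I) :
  indep P e -> uniq s -> (forall i, i \in s -> P i) -> lfree (map e s).
Proof.
move=> ie; elim: s => //= i s IH /andP[ns us] sP; split; last first.
  by apply: IH => // j js; apply: sP; rewrite inE js orbT.
move=> /(lspan_map_uniq _ _ us)[c ec].
have := ie (i :: s) (fun j => if j == i then -1 else c j).
rewrite /= ns us => /(_ erefl sP); rewrite big_cons eqxx.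
have -> : \sum_(j <- s) (if j == i then -1 else c j) *: e j = e i.
  rewrite ec !big_seq; apply: eq_bigr => j js.
  by case: eqP js => // ->; rewrite (negPf ns).
rewrite scaleN1r addNr => /(_ erefl i); rewrite mem_head eqxx => /(_ isT) /eqP.
by rewrite oppr_eq0 oner_eq0.
Qed.

Lemma hascard_hasdim (X : lmodType k) P (e : I -> X) n :
  indep P e -> hascard P n -> hasdim (spanf P e) n.
Proof.
move=> ie [s [us <- hs]]; exists (map e s); split.
- by apply: indep_lfree ie us _ => i /hs.
- by rewrite size_map.
apply/seteqP; split.
  apply: spanf_sub; first exact: lspan_linsub.
  by move=> i /hs is'; apply/lspan_mem/map_f.
apply: lspan_sub; first exact: spanf_linsub.
by move=> _ /mapP[i /hs Pi ->]; apply: spanf_mem.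
Qed.

(** Finiteness of [P] is part of the conclusion: a list of distinct indices gives a free list, whose
    length is bounded by the dimension. *)
Lemma hasdim_hascard (X : lmodType k) P (e : I -> X) n :
  indep P e -> hasdim (spanf P e) n -> hascard P n.
Proof.
move=> ie hd; have [t [ft tn te]] := hd.
have [|m _ hm] := @hascard_bounded _ P n.
  move=> s us sP; rewrite -tn -(size_map e); apply: lfree_size.
    exact: indep_lfree ie us sP.
  by move=> _ /mapP[i /sP Pi ->]; rewrite -te; apply: spanf_mem.
by rewrite (hasdim_inj hd (hascard_hasdim ie hm)).
Qed.

(** If [f] kills some vectors of a basis and keeps the others independent, then its rank is the
    number of survivors. This turns ranks into counts of bars and of interval summands. *)
Lemma rank_hascard (X Y : lmodType k) P Q (e : I -> X) (f : {linear X -> Y}) :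
  (forall x, spanf P e x) -> indep (P `&` Q) (f \o e) ->
  (forall i, P i -> ~ Q i -> f (e i) = 0) ->
  finite_rank f -> hascard (P `&` Q) (rank f).
Proof.
move=> se ie f0 /finite_rankP hd; apply: (hasdim_hascard ie).
rewrite (_ : spanf _ _ = range f) //; apply/seteqP; split.
  apply: spanf_sub; first exact: range_linsub.
  by move=> i _; exists (e i).
move=> _ [x _ <-].
have sub : P `<=` [set i | spanf (P `&` Q) (f \o e) (f (e i))].
  move=> i Pi /=; have [Qi|nQi] := pselect (Q i); first exact: (@spanf_mem _ _ (f \o e)).
  by rewrite f0 //; case: (spanf_linsub (P `&` Q) (f \o e)).
have [l lP ->] := se x; rewrite /lcomb linear_sum /=.
apply: linsub_sum; first exact: spanf_linsub.
move=> p pl; rewrite linearZ; apply: linsubZ; first exact: spanf_linsub.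
by apply: sub; apply: lP.
Qed.

End Families.

(** Zorn's lemma gives a maximal subset of [C] that is independent modulo [A]. A vector of [C]
    outside [A] plus its span could still be added to it. *)
Lemma basis_modulo (k : fieldType) (X : lmodType k) (A C : set X) :
  linsub A -> linsub C -> A `<=` C ->
  exists2 B : set X, B `<=` C &
    (forall (s : seq X) (c : X -> k), uniq s -> (forall x, x \in s -> B x) ->
       A (\sum_(x <- s) c x *: x) -> forall x, x \in s -> c x = 0) /\
    (forall x, C x -> exists2 y, A y & spanf B id (x - y)).
Proof.
move=> sA sC AC.
pose P (B : set X) := B `<=` C /\
  forall (s : seq X) (c : X -> k), uniq s -> (forall x, x \in s -> B x) ->
    A (\sum_(x <- s) c x *: x) -> forall x, x \in s -> c x = 0.
have [F FP totF|B [[BC iB] maxB]] := @Zorn_bigcup X P.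
  split; first by move=> x [B /FP[BC _] /BC].
  move=> s c us sF.
  (* A finite list from the union of a chain lies in one member of it; the empty list is set apart
     because the chain may be empty. *)
  have [->//|[B FB sB]] : s = [::] \/ exists2 B, F B & forall x, x \in s -> B x.
    elim: s {us} sF => [|x s IH] sF; [by left|right].
    have [B FB Bx] := sF x (mem_head _ _).
    have [y ys|es|[B' FB' sB']] := IH.
    - by apply: sF; rewrite inE ys orbT.
    - by exists B => // y; rewrite es inE => /eqP ->.
    have [BB'|B'B] := totF _ _ FB FB'.
      by exists B' => // y; rewrite inE => /orP[/eqP ->|/sB' //]; apply: BB'.
    by exists B => // y; rewrite inE => /orP[/eqP -> //|/sB' /B'B].
  by have [_ iB] := FP _ FB; apply: iB.
exists B => //; split=> // x Cx.
apply: contrapT => nx.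
have nBx : ~ B x.
  move=> Bx; apply: nx; exists 0; first by case: sA.
  by rewrite subr0; apply: (@spanf_mem _ _ _ _ id).
apply: (maxB (B `|` [set x])).
  by split; [move=> y By; left|move=> /(_ x); apply: contra_not nBx; apply; right].
split; first by move=> y [/BC|->].
move=> s c us sB; have [xs|xs] := boolP (x \in s); last first.
  apply: iB => // y ys; have [//|/= yx] := sB y ys.
  by rewrite -yx ys in xs.
rewrite (bigD1_seq x) //=.
have sB' y : y \in rem x s -> B y.
  rewrite mem_rem_uniq // !inE => /andP[/eqP yx ys].
  by have [|] := sB y ys.
have -> : \sum_(y <- s | y != x) c y *: y = \sum_(y <- rem x s) c y *: y.
  by rewrite rem_filter // big_filter.
move=> As; have cx : c x = 0.
  apply/eqP/negPn/negP => cx; apply: nx.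
  exists ((c x)^-1 *: (c x *: x + \sum_(y <- rem x s) c y *: y)).
    exact: linsubZ.
  rewrite scalerDr scalerA mulVf // scale1r opprD addNKr -scaleNr.
  by apply: linsubZ; [exact: spanf_linsub|exact: (@spanf_sum _ _ _ _ id)].
move=> y ys; have [-> //|yx] := eqVneq y x.
move: As; rewrite cx scale0r add0r => /iB -> //; first exact: rem_uniq.
by rewrite mem_rem_uniq // !inE yx.
Qed.

(** * Barcodes of modules over the integers *)

Section Sections.
Variables (k : fieldType) (T : Type) (E : T -> lmodType k).

(** A bar is generated by a compatible choice of vectors at all times, so bases are chosen among
    sections, in the product of all the spaces. *)
Definition sections : Type := forall t, E t.
HB.instance Definition _ := gen_eqMixin sections.
HB.instance Definition _ := gen_choiceMixin sections.

Definition sec_add (x y : sections) : sections := fun t => x t + y t.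
Definition sec_opp (x : sections) : sections := fun t => - x t.
Definition sec_scale (a : k) (x : sections) : sections := fun t => a *: x t.

Fact sec_addA : associative sec_add.
Proof. by move=> x y z; apply: functional_extensionality_dep => t; apply: addrA. Qed.
Fact sec_addC : commutative sec_add.
Proof. by move=> x y; apply: functional_extensionality_dep => t; apply: addrC. Qed.
Fact sec_add0 : left_id (fun t => 0 : E t) sec_add.
Proof. by move=> x; apply: functional_extensionality_dep => t; apply: add0r. Qed.
Fact sec_addN : left_inverse (fun t => 0 : E t) sec_opp sec_add.
Proof. by move=> x; apply: functional_extensionality_dep => t; apply: addNr. Qed.
HB.instance Definition _ :=
  GRing.isZmodule.Build sections sec_addA sec_addC sec_add0 sec_addN.

Fact sec_scaleA a b x : sec_scale a (sec_scale b x) = sec_scale (a * b) x.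
Proof. by apply: functional_extensionality_dep => t; apply: scalerA. Qed.
Fact sec_scale1 : left_id 1 sec_scale.
Proof. by move=> x; apply: functional_extensionality_dep => t; apply: scale1r. Qed.
Fact sec_scaleDr : right_distributive sec_scale +%R.
Proof. by move=> a x y; apply: functional_extensionality_dep => t; apply: scalerDr. Qed.
Fact sec_scaleDl x : {morph sec_scale^~ x : a b / a + b}.
Proof. by move=> a b; apply: functional_extensionality_dep => t; apply: scalerDl. Qed.
HB.instance Definition _ := GRing.Zmodule_isLmodule.Build k sections
  sec_scaleA sec_scale1 sec_scaleDr sec_scaleDl.

Lemma sec_sumE (I : Type) (s : seq I) (P : pred I) (f : I -> sections) t :
  (\sum_(i <- s | P i) f i) t = \sum_(i <- s | P i) f i t.
Proof. by elim/big_rec2: _ => // i x y _ <-. Qed.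

End Sections.

Lemma seq_max (T : eqType) (r : rel T) (s : seq T) : total r -> transitive r ->
  s != [::] -> exists2 x, x \in s & forall y, y \in s -> r y x.
Proof.
move=> rtot rtr; elim: s => // x s IH _.
have [s0|sn] := eqVneq s [::].
  exists x; rewrite ?mem_head // => y; rewrite s0 inE => /eqP ->.
  by case/orP: (rtot x x).
have [y ys ymax] := IH sn.
case/orP: (rtot x y) => h.
  by exists y; rewrite ?inE ?ys ?orbT // => z /predU1P[->|/ymax].
exists x; rewrite ?mem_head // => z /predU1P[->|/ymax zy].
  by case/orP: (rtot x x).
exact: rtr zy h.
Qed.

Section Barcode.
Variables (k : fieldType) (W : pmod k int).

Local Notation sec := (sections W).

(** The support of the bar [s] is the set of times at which [e s] is nonzero. Naturality is demanded
    only from such times on, since [e s] jumps away from 0 at its birth. *)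
Definition barcode (I : choiceType) (S : set I) (e : I -> forall n, W n) : Prop :=
  [/\ forall s n m (h : n <= m), S s -> e s n != 0 -> pm_map W h (e s n) = e s m,
      forall s, S s -> exists n, e s n != 0,
      forall n, indep (S `&` [set s | e s n != 0]) (e^~ n)
    & forall n x, spanf (S `&` [set s | e s n != 0]) (e^~ n) x].

(** The Mittag-Leffler condition for the tower that runs towards [-oo]. *)
Definition images_stabilize : Prop :=
  forall t : int, exists2 N : int, N <= t & forall i (hi : i <= t) (hN : N <= t),
    i <= N -> range (pm_map W hN) `<=` range (pm_map W hi).

(* Births are [option int] with [None] for [-oo], deaths with [None] for [+oo]. *)
Implicit Types (i j : option int) (n m t : int) (x y : sec).

Definition born i n := if i is Some a then a <= n else true.
Definition alive j n := if j is Some b then n <= b else true.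

Definition natural_from i x :=
  forall n m (h : n <= m), born i n -> pm_map W h (x n) = x m.

(** These sections are the morphisms to [W] from the interval module with support [[[i, j]]]. *)
Definition bars i j : set sec := [set x |
  [/\ natural_from i x, forall n, ~~ born i n -> x n = 0
    & forall n, ~~ alive j n -> x n = 0]].

(** Nothing is older than a birth at [-oo], hence only the zero section in that case. *)
Definition born_before i : set sec :=
  if i is Some a then natural_from (Some (a - 1)) else [set 0].

(* Sections of [bars i j] that at some time agree with an older section: modulo
   these, a section of [bars i j] generates summands of support [[i, j]]. *)
Definition shorter_bars i j : set sec := [set x | bars i j x /\
  exists y m, [/\ born_before i y, born i m, alive j m & x m = y m]].

Lemma natural_from_linsub i : linsub (natural_from i).
Proof.
split; first by move=> n m h _; rewrite linear0.
by move=> a x y nx ny n m h b; rewrite linearP nx // ny.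
Qed.

Lemma bars_linsub i j : linsub (bars i j).
Proof.
have [n0 nP] := natural_from_linsub i.
split; first by split.
move=> a x y [nx bx dx] [ny by_ dy]; split; first exact: nP.
  by move=> n h; rewrite -[LHS]/(a *: x n + y n) bx // by_ // scaler0 addr0.
by move=> n h; rewrite -[LHS]/(a *: x n + y n) dx // dy // scaler0 addr0.
Qed.

Lemma born_before_linsub i : linsub (born_before i).
Proof.
case: i => [a|] /=; first exact: natural_from_linsub.
by split=> // a _ _ -> ->; rewrite scaler0 addr0.
Qed.

Lemma born_le i n m : n <= m -> born i n -> born i m.
Proof. by case: i => //= a nm /le_trans; apply. Qed.

Lemma natural_from_le i y : born_before i y -> natural_from i y.
Proof.
case: i => [a|] /= ny n m h b; last by rewrite ny linear0.
by apply: ny; move: b => /=; lia.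
Qed.

(** Both sections are natural from [i] on, so an agreement at one time persists. *)
Lemma shorter_barsP i j x y m M : bars i j x -> born_before i y -> born i m ->
  x m = y m -> m <= M -> x M = y M.
Proof.
move=> [nx _ _] hy bm xy mM; rewrite -(nx _ _ mM) // xy.
exact: (natural_from_le hy).
Qed.

(** Since agreement persists, the two witnessing times may be replaced by their maximum, which is
    still within the support. *)
Lemma shorter_bars_linsub i j m : born i m -> alive j m ->
  linsub (shorter_bars i j).
Proof.
move=> bm am.
have [b0 bP] := bars_linsub i j; have [p0 pP] := born_before_linsub i.
split; first by split=> //; exists 0, m.
move=> a x x' [bx [y [n [hy bn an xy]]]] [bx' [y' [n' [hy' bn' an' xy']]]].
split; first exact: bP.
exists (a *: y + y'), (Num.max n n'); split; first exact: pP.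
- by apply: born_le bn; rewrite le_max lexx.
- by case: leP.
rewrite -[LHS]/(a *: x _ + x' _) -[RHS]/(a *: y _ + y' _).
rewrite (shorter_barsP bx hy bn xy) ?(shorter_barsP bx' hy' bn' xy') //.
all: by rewrite le_max lexx ?orbT.
Qed.

Definition bar_basis i j : set sec :=
  xget set0 [set B : set sec | B `<=` bars i j /\
  ((forall (s : seq sec) (c : sec -> k), uniq s -> (forall x, x \in s -> B x) ->
       shorter_bars i j (\sum_(x <- s) c x *: x) -> forall x, x \in s -> c x = 0) /\
    (forall x, bars i j x -> exists2 y, shorter_bars i j y & spanf B id (x - y)))].

Lemma bar_basisP i j m : born i m -> alive j m ->
  [/\ bar_basis i j `<=` bars i j,
      forall (s : seq sec) (c : sec -> k), uniq s ->
        (forall x, x \in s -> bar_basis i j x) ->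
        shorter_bars i j (\sum_(x <- s) c x *: x) -> forall x, x \in s -> c x = 0
    & forall x, bars i j x ->
        exists2 y, shorter_bars i j y & spanf (bar_basis i j) id (x - y)].
Proof.
move=> bm am.
have [|B BC [iB sB]] := basis_modulo (shorter_bars_linsub bm am) (bars_linsub i j).
  by move=> x [].
by rewrite /bar_basis; case: xgetP => [C _ [? []]|/(_ B)] //; apply: contra_notP.
Qed.

Definition bar_index : Type := option int * option int * sec.
HB.instance Definition _ := Choice.on bar_index.

Definition bar_set : set bar_index := [set p |
  exists2 n, born p.1.1 n && alive p.1.2 n & bar_basis p.1.1 p.1.2 p.2].

Definition bar_sec (p : bar_index) : forall n, W n := p.2.

(** A basis section that vanished at a time inside its interval would agree there with the older
    section 0; it would be a shorter bar, against independence modulo shorter bars. *)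
Lemma bar_set_support p n : bar_set p ->
  bar_sec p n != 0 <-> born p.1.1 n /\ alive p.1.2 n.
Proof.
case: p => -[i j] x [m /andP[/= bm am] Bx]; rewrite /bar_sec /=.
have [sub ind _] := bar_basisP bm am; have [nx bx ax] := sub _ Bx.
split=> [xn|[bn an]].
  by split; [apply: contraNT xn => /bx ->|apply: contraNT xn => /ax ->].
apply/eqP => xn.
have := ind [:: x] (fun=> 1) isT _ _ x (mem_head _ _).
rewrite big_seq1 scale1r => h; have := oner_neq0 k; rewrite h ?eqxx //.
  by move=> y; rewrite inE => /eqP ->.
split; first exact: sub.
by exists 0, n; split=> //; case: (born_before_linsub i).
Qed.

Lemma bar_sec_natural p n m (h : n <= m) : bar_set p -> born p.1.1 n ->
  pm_map W h (bar_sec p n) = bar_sec p m.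
Proof.
case: p => -[i j] x [l /andP[/= bl al] Bx] bn.
by have [sub _ _] := bar_basisP bl al; have [+ _ _] := sub _ Bx; apply.
Qed.

Definition birth_le i i' : bool :=
  match i, i' with None, _ => true | Some _, None => false
  | Some a, Some a' => a <= a' end.
Definition death_le j j' : bool :=
  match j, j' with _, None => true | None, Some _ => false
  | Some b, Some b' => b <= b' end.

Lemma birth_lexx i : birth_le i i.
Proof. by case: i => /=. Qed.

(** The implication lets deaths break ties between births, so a maximal bar is a youngest one and
    lives longest among those. *)
Definition bar_le (p q : bar_index) : bool :=
  birth_le p.1.1 q.1.1 && (birth_le q.1.1 p.1.1 ==> death_le p.1.2 q.1.2).

Lemma bar_le_total : total bar_le.
Proof.
by move=> [[[i|] [j|]] x] [[[i'|] [j'|]] x']; rewrite /bar_le /=; try lia.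
Qed.

Lemma bar_le_trans : transitive bar_le.
Proof.
move=> [[[i|] [j|]] x] [[[i'|] [j'|]] x'] [[[i''|] [j''|]] x''].
all: by rewrite /bar_le /=; try lia.
Qed.

Lemma birth_le_born_before i i' x : natural_from i' x -> birth_le i' i -> i' != i ->
  born_before i x.
Proof.
case: i i' => [a|] [b|] //= nx le ne n m h bn; apply: nx => //=.
move: bn => /=; have : b != a by apply: contra_neq ne => ->.
lia.
Qed.

(** In a nontrivial relation at time [t], let [(i, j)] be the type of a maximal bar with nonzero
    coefficient. The relation is pushed to a time [M] at which bars of type [(i, j)] are alive and
    the other bars born at [i] are dead. There the part of type [(i, j)] equals a combination of
    older bars, so it is a shorter bar, against independence modulo shorter bars. *)
Lemma bar_set_indep t :
  indep (bar_set `&` [set p | bar_sec p t != 0]) (bar_sec^~ t).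
Proof.
move=> s c us sP st0 p ps; apply/eqP/negPn/negP => cp.
pose bad := [seq q <- s | c q != 0].
have [|[[i j] x]] := @seq_max _ _ bad bar_le_total bar_le_trans.
  by rewrite -has_filter; apply/hasP; exists p.
rewrite mem_filter => /andP[/eqP cx xs] xmax.
have [Sx xt] := sP _ xs; have [/= bt at_] := (bar_set_support t Sx).1 xt.
have [sub ind _] := bar_basisP bt at_.
(* A finite [j] serves as [M] itself, since the competing deaths are smaller; for [j = +oo] any time
   beyond the finitely many finite deaths will do. *)
have [M [tM aM ltM]] : exists M, [/\ t <= M, alive j M
    & forall q b, q \in bad -> q.1.1 = i -> q.1.2 != j -> q.1.2 = Some b -> b < M].
  case: j @bad cx xs xmax Sx xt at_ sub ind => [b|] bad cx xs xmax Sx xt at_ sub ind.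
    exists b; split=> [||q b'] //=; move=> /xmax; rewrite /bar_le /= => /[swap] ->.
    rewrite birth_lexx /=.
    move=> /[swap] ne /[swap] e; rewrite e /= in ne *.
    by rewrite lt_neqAle => ->; rewrite andbT; apply: contra_neq ne => ->.
  have : exists M, t <= M /\ forall q b, q \in bad -> q.1.2 = Some b -> b < M.
    elim: (bad) => [|q l [M [tM hM]]]; first by exists t; split.
    case E: q.1.2 => [b|]; last first.
      exists M; split=> // q' b' /predU1P[->|/hM]; last exact.
      by rewrite E.
    exists (Num.max M (b + 1)); split; first by rewrite le_max tM.
    move=> q' b' /predU1P[->|/hM h].
      by rewrite E => -[<-]; rewrite lt_max ltrDl ltr01 orbT.
    by move=> /h; rewrite lt_max => ->.
  by move=> [M [tM hM]]; exists M; split=> // q b qb _ _; apply: hM.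
have nat_s q : q \in s -> bar_set q /\ born q.1.1 t.
  by move=> /sP[Sq /(bar_set_support t Sq)[]].
have sM0 : \sum_(q <- s) c q *: bar_sec q M = 0.
  have : pm_map W tM (\sum_(q <- s) c q *: bar_sec q t) = 0 by rewrite st0 linear0.
  rewrite linear_sum /= => e; rewrite -[RHS]e !big_seq; apply: eq_bigr => q qs.
  by have [Sq bq] := nat_s q qs; rewrite linearZ /= bar_sec_natural.
pose top := [seq q <- s | (q.1.1 == i) && (q.1.2 == j)].
pose secs := [seq q.2 | q <- top].
have topE q : q \in top -> q = (i, j, q.2).
  by rewrite mem_filter => /andP[/andP[/eqP <- /eqP <-] _]; case: q => -[].
have topB q : q \in top -> bar_basis i j q.2.
  rewrite mem_filter => /andP[/andP[/eqP qi /eqP qj] qs].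
  by have [[n _ Bq] _] := nat_s q qs; rewrite -qi -qj.
have : forall y, y \in secs -> c (i, j, y) = 0.
  apply: ind.
  - rewrite map_inj_in_uniq ?filter_uniq // => q q' /topE {2}-> /topE {2}-> ->.
    by [].
  - by move=> _ /mapP[q qt ->]; apply: topB.
  rewrite big_map.
  have -> : \sum_(q <- top) c (i, j, q.2) *: q.2 = \sum_(q <- top) c q *: q.2 :> sec.
    by rewrite !big_seq; apply: eq_bigr => q /topE qe; rewrite [in RHS]qe.
  split.
    apply: linsub_sum; first exact: bars_linsub.
    move=> q qt; apply: linsubZ; first exact: bars_linsub.
    exact/sub/topB.
  (* The older section is minus the sum over the remaining births; by maximality they are all
     earlier than [i]. *)
  exists (- \sum_(q <- s | q.1.1 != i) c q *: q.2), M; split=> //.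
  - rewrite -scaleN1r; apply: linsubZ; first exact: born_before_linsub.
    rewrite -big_filter; apply: linsub_sum; first exact: born_before_linsub.
    move=> q; rewrite mem_filter => /andP[qi qs].
    have [cq|cq] := eqVneq (c q) 0.
      by rewrite cq scale0r; case: (born_before_linsub i).
    apply: linsubZ; first exact: born_before_linsub.
    have [Sq bq] := nat_s q qs.
    have qb : q \in bad by rewrite mem_filter cq.
    have := xmax q qb; rewrite /bar_le /= => /andP[le _].
    apply: (birth_le_born_before _ le qi).
    by move=> n m h; apply: (bar_sec_natural h Sq).
  - exact: born_le bt.
  rewrite -[RHS]/(- ((\sum_(q <- s | q.1.1 != i) c q *: q.2 : sec) M)) !sec_sumE.
  apply/eqP; rewrite -addr_eq0; apply/eqP; rewrite -[RHS]sM0.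
  rewrite [RHS](bigID (fun q : bar_index => q.1.1 == i)) /=.
  congr (_ + _); rewrite big_filter [RHS](bigID (fun q : bar_index => q.1.2 == j)) /=.
  (* Bars with birth [i] and another death contribute nothing at time [M]. *)
  rewrite [X in _ = _ + X]big_seq_cond [X in _ = _ + X]big1 ?addr0 //.
  move=> q /andP[qs /andP[/eqP qi qj]].
  have [->|cq] := eqVneq (c q) 0; first by rewrite scale0r.
  have qb : q \in bad by rewrite mem_filter cq.
  have [Sq bq] := nat_s q qs.
  case E: q.1.2 => [b|]; last first.
    have := xmax q qb; rewrite /bar_le qi /= E.
    rewrite birth_lexx /=.
    by case: (j) (qj); rewrite E.
  have [->|/(bar_set_support M Sq)[_]] := eqVneq (bar_sec q M) 0; first by rewrite scaler0.
  by rewrite E /= leNgt (ltM q b).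
move=> /(_ x) h; apply: cx; apply: h; apply/mapP; exists (i, j, x) => //.
by rewrite mem_filter !eqxx.
Qed.

(** Choose a preimage of [w] so early that the images in [W s] have already stabilised: on its way
    to [w] it passes through a point of [W s] that lies in every image. *)
Lemma stable_lift t s (h : s <= t) (w : W t) : images_stabilize ->
  (forall (r : int) (hr : r <= t), range (pm_map W hr) w) ->
  exists w' : W s, pm_map W h w' = w /\
    forall (r : int) (hr : r <= s), range (pm_map W hr) w'.
Proof.
move=> stab sw; have [N Ns hN] := stab s.
have [z _ <-] := sw N (le_trans Ns h).
exists (pm_map W Ns z); split; first exact: pm_map_comp.
move=> r hr; have [rN|/ltW Nr] := leP r N; first by apply: hN => //; exists z.
by exists (pm_map W Nr z) => //; apply: pm_map_comp.
Qed.

(* The Mittag-Leffler argument, with the images of a tower in place of its terms. *)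
Lemma section_lift t (w : W t) : images_stabilize ->
  (forall (r : int) (hr : r <= t), range (pm_map W hr) w) ->
  exists2 y : sec, natural_from None y & y t = w.
Proof.
move=> stab sw.
pose ok (s : int) (w : W s) := forall (r : int) (hr : r <= s), range (pm_map W hr) w.
have le0 : t <= t - 0%:Z by rewrite subr0.
have leS (n : nat) : t - n.+1%:Z <= t - n%:Z by lia.
have w0P : ok _ (pm_map W le0 w).
  move=> r hr; have hrt : r <= t by move: hr; rewrite subr0.
  have [z _ <-] := sw r hrt; exists z => //; exact/esym/pm_map_comp.
have next (n : nat) (p : {w : W (t - n%:Z) | ok _ w}) :
    {q : {w : W (t - n.+1%:Z) | ok _ w} | pm_map W (leS n) (sval q) = sval p}.
  apply: cid; case: p => w' w'P; have [w'' [e w''P]] := stable_lift (leS n) stab w'P.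
  by exists (exist _ w'' w''P).
(* A compatible sequence of preimages of [w], one for each step downwards from [t]. *)
pose z := nat_rect (fun n : nat => {w : W (t - n%:Z) | ok _ w}) (exist _ _ w0P)
  (fun (n : nat) p => sval (next n p)).
have zE (n m : nat) (h : t - (n + m)%N%:Z <= t - n%:Z) :
    pm_map W h (sval (z (n + m)%N)) = sval (z n).
  elim: m => [|m IH] in h *.
    by move: h; rewrite addn0 => h; apply: pm_map_id.
  move: h; rewrite addnS => h.
  have h' : t - (n + m)%N%:Z <= t - n%:Z by lia.
  rewrite -(IH h') -(pm_map_comp (leS (n + m)%N) h' h) /=.
  by rewrite (svalP (next _ _)).
have leA m : t - `|t - m|%N%:Z <= m by lia.
(* The starting index is [m] itself for [m <= t] and lies below [t] otherwise, so one formula covers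
   both sides of [t]; by [yE] any earlier start gives the same value. *)
pose y : sec := fun m => pm_map W (leA m) (sval (z `|t - m|%N)).
have yE m (n : nat) (h : t - n%:Z <= m) : (`|t - m| <= n)%N ->
    pm_map W h (sval (z n)) = y m.
  move=> /subnKC e; rewrite -e in h *.
  have h' : t - (`|t - m| + (n - `|t - m|))%N%:Z <= t - `|t - m|%N%:Z by lia.
  by rewrite /y -(zE _ _ h') pm_map_comp.
exists y; last first.
  have ge0 : t - 0%:Z <= t by rewrite subr0.
  by rewrite -(yE t 0%N ge0) ?subrr //= (pm_map_comp le0 ge0 (lexx t)) pm_map_id.
move=> m n h _.
have hK : t - (`|t - m| + `|t - n|)%N%:Z <= m by lia.
rewrite -(yE m _ hK) ?leq_addr // pm_map_comp; first exact: le_trans h.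
by move=> hK'; rewrite yE // leq_addl.
Qed.

(** At time [t] a shorter bar is the sum of an older bar and a bar of the same birth with an
    earlier, finite death. Deaths remain at or after [t], so the descent on deaths ends. Births are
    unbounded below; there stabilisation supplies the base case, replacing a sufficiently old bar by
    a section born at [-oo] with the same value at [t]. *)
Lemma bars_span t : images_stabilize -> forall i j, born i t -> alive j t ->
  forall x, bars i j x ->
    spanf (bar_set `&` [set p | bar_sec p t != 0]) (bar_sec^~ t) (x t).
Proof.
move=> stab; pose G := spanf (bar_set `&` [set p | bar_sec p t != 0]) (bar_sec^~ t).
have sG : linsub G by exact: spanf_linsub.
rewrite -/G.
pose claim i j := forall x : sec, bars i j x -> G (x t).
have red i j : born i t -> alive j t ->
    (forall x, shorter_bars i j x -> G (x t)) -> claim i j.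
  move=> bt at_ Gs x bx; have [_ _ gen] := bar_basisP bt at_.
  have [y sy /spanf_uniq[s [c [us sB e]]]] := gen x bx.
  have -> : x t = y t + \sum_(z <- s) c z *: z t.
    have -> : x = y + (x - y) by rewrite addrC subrK.
    by rewrite e -[LHS]/(y t + _ t) sec_sumE.
  apply: linsubD => //; first exact: Gs.
  apply: linsub_sum => // z zs; apply: linsubZ => //.
  have [z0|zt] := eqVneq (z t) 0; first by rewrite z0; case: sG.
  apply: (@spanf_mem _ _ _ _ (bar_sec^~ t) (i, j, z)); split=> //.
  by exists t; rewrite ?bt //; apply: sB.
(* The bar [x] agrees from some [M >= t] on with an older [y]. Cut off before [i], [y] differs from
   [x] by a bar that ends before [M]; cut off one step earlier, it is itself a bar of earlier
   birth. *)
have older i j : born i t -> alive j t ->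
    (forall a, i = Some a -> forall j, alive j t -> claim (Some (a - 1)) j) ->
    (forall b, alive j b -> Some b != j -> t <= b -> claim i (Some b)) ->
    claim i j.
  move=> bt at_ cl_i cl_j; apply: (red _ _ bt at_) => x [bx [y [m [hy bm am xy]]]].
  have [nx zx dx] := bx.
  pose M := Num.max m t.
  have mM : m <= M by rewrite le_max lexx.
  have tM : t <= M by rewrite le_max lexx orbT.
  have aM : alive j M by rewrite /M; case: leP.
  have xyM n : M <= n -> x n = y n.
    by move=> Mn; apply: (shorter_barsP bx hy bm xy); apply: le_trans Mn.
  have ny := natural_from_le hy.
  pose y' : sec := fun n => if born i n then y n else 0.
  have ny' : natural_from i y'.
    by move=> n n' h b; rewrite /y' b (born_le h b); apply: ny.
  have -> : x t = (x - y') t + y t.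
    by rewrite -[(x - y') t]/(x t - y' t) /y' bt subrK.
  apply: linsubD => //; last first.
    case: i bt hy cl_i {cl_j zx bx nx bm ny y' ny'} => [a|] bt hy cl_i; last first.
      by rewrite hy; case: sG.
    pose y' : sec := fun n => if a - 1 <= n then y n else 0.
    have -> : y t = y' t by rewrite /y' ifT //; move: bt => /=; lia.
    apply: (cl_i a erefl j at_); split.
    - by move=> n n' h /= b; rewrite /y' b (le_trans b h); apply: hy.
    - by move=> n /= /negPf b; rewrite /y' b.
    move=> n dn; rewrite /y'; case: ifP => // _; rewrite -xyM ?dx //.
    case: (j) dn aM => //= b; lia.
  have [Mt|neM] := eqVneq M t.
    rewrite -[(x - y') t]/(x t - y' t) /y' bt xyM ?Mt // subrr.
    by case: sG.
  apply: (cl_j (M - 1)).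
  - by case: (j) aM => //= b; lia.
  - by case: (j) aM => //= b; rewrite (inj_eq Some_inj); lia.
  - by lia.
  split.
  - have [_] := natural_from_linsub i => /(_ (-1) y' x ny' nx).
    by rewrite scaleN1r addrC.
  - move=> n bn; rewrite -[LHS]/(x n - y' n) zx // /y' (negPf bn) subrr //.
  move=> n /=; rewrite -ltNge => Mn; have {}Mn : M <= n by lia.
  rewrite -[LHS]/(x n - y' n) /y' (born_le _ bt) ?xyM ?subrr //.
  exact: le_trans Mn.
(* Finite deaths are treated by strong induction on their distance from [t]; an infinite death then
   reduces to finite ones. *)
have step i : born i t ->
    (forall a, i = Some a -> forall j, alive j t -> claim (Some (a - 1)) j) ->
    forall j, alive j t -> claim i j.
  move=> bt cl_i.
  have fin (n : nat) : claim i (Some (t + n%:Z)).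
    elim/ltn_ind: n => n IH; apply: older => //=; first by lia.
    move=> b bn ne tb; have -> : b = t + `|b - t|%N%:Z by lia.
    apply: IH; move: ne; rewrite (inj_eq Some_inj); lia.
  have fin' b : t <= b -> claim i (Some b).
    by move=> tb; have -> : b = t + `|b - t|%N%:Z by lia.
  case=> [b|_]; first exact: fin'.
  by apply: older => // b _ _; exact: fin'.
have cl_None j' : alive j' t -> claim None j' by apply: step.
have [N Nt hN] := stab t.
(* A bar born at or before [N] comes from time [N], so its value at [t] lies in every image and
   lifts to a section born at [-oo]. *)
have cl_N a j' : a <= N -> alive j' t -> claim (Some a) j'.
  move=> aN at_ x [nx zx dx].
  have [] := @section_lift t (x t) stab.
    move=> r hr; have [rN|/ltW Nr] := leP r N.
      apply: (hN r hr Nt rN); exists (x N) => //; exact: nx.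
    by exists (x r) => //; apply: nx => /=; lia.
  move=> y ny yx; rewrite -yx; apply: (cl_None j' at_); split=> // n dn.
  have tn : t <= n by case: (j') dn at_ => //= b; lia.
  by rewrite -(ny _ _ tn) // yx nx //=; [apply: dx|apply: le_trans Nt].
have cl_a (n : nat) : N + n%:Z <= t ->
    forall j', alive j' t -> claim (Some (N + n%:Z)) j'.
  elim: n => [|n IH] h j' at_; first by apply: cl_N => //; lia.
  apply: step => // _ [<-] j'' at''; rewrite (_ : _ - 1 = N + n%:Z); last by lia.
  by apply: IH => //; lia.
move=> [a|] j bt at_; last exact: cl_None.
have [aN|Na] := leP a N; first exact: cl_N.
move: bt => /= bt; have e : a = N + `|a - N|%N%:Z by lia.
by rewrite e; apply: cl_a => //; lia.
Qed.

Theorem barcode_exists : images_stabilize ->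
  exists (I : choiceType) (S : set I) (e : I -> forall n, W n), barcode S e.
Proof.
move=> stab; exists (bar_index : choiceType), bar_set, bar_sec; split.
- move=> p n m h Sp pn; apply: bar_sec_natural => //.
  by have [] := (bar_set_support n Sp).1 pn.
- move=> p Sp; have [n /andP[bn an] _] := Sp; exists n.
  exact/(bar_set_support n Sp).
- exact: bar_set_indep.
move=> t w.
(* Every vector at [t], pushed forward, is a bar born at [t] with no bound on its death. *)
pose x : sec := fun n => if @idP (t <= n) is ReflectT h then pm_map W h w else 0.
have xE n (h : t <= n) : x n = pm_map W h w.
  by rewrite /x; case: {-}_ / idP => [h'|//]; rewrite (bool_irrelevance h' h).
have -> : w = x t by rewrite (xE t (lexx t)) pm_map_id.
apply: (bars_span stab (i := Some t) (j := None)) => //=; split=> //=.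
  move=> n m h b; rewrite (xE n b) (xE m (le_trans b h)); exact: pm_map_comp.
by move=> n nt; rewrite /x; case: {-}_ / idP => // h; rewrite h in nt.
Qed.

End Barcode.

(** * The persistence measure in terms of ranks *)

Lemma barcode_rank (k : fieldType) (W : pmod k int) (I : choiceType) (S : set I)
    (e : I -> forall n, W n) (n m : int) (h : n <= m) :
  barcode S e -> finite_rank (pm_map W h) ->
  hascard (S `&` [set s | e s n != 0 /\ e s m != 0]) (rank (pm_map W h)).
Proof.
move=> [nat _ ind gen] fr.
have -> : S `&` [set s | e s n != 0 /\ e s m != 0] =
    S `&` [set s | e s n != 0] `&` [set s | e s m != 0].
  by apply/seteqP; split=> s /=; tauto.
apply: (@rank_hascard _ _ _ _ _ _ (e^~ n)) => //.
  move=> s c us sP e0.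
  apply: (ind m s c us); first by move=> i /sP[[Si _] im].
  rewrite -[RHS]e0 !big_seq; apply: eq_bigr => i /sP[[Si ni] _] /=.
  by rewrite (nat _ _ _ h).
by move=> i [Si ni] /negP; rewrite negbK (nat _ _ _ h) // => /eqP.
Qed.

Lemma fsbig_uniq_seq (X : nmodType) (I : choiceType) (y : I -> X) (q : seq I) :
  uniq q -> (forall i, y i != 0 -> i \in q) ->
  \sum_(i \in [set: I]) y i = \sum_(i <- q) y i.
Proof.
move=> uq yq; rewrite (@fsbigE _ _ _ _ _ q) //.
  by apply: eq_bigl => i; rewrite in_setT.
by move=> i _; apply: contraNeq => /yq.
Qed.

Lemma finite_support_sum (X : nmodType) (I : choiceType) (y : I -> X) :
  finite_set [set i | y i != 0] -> exists q : seq I,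
  [/\ uniq q, forall i, y i != 0 <-> i \in q
    & \sum_(i \in [set: I]) y i = \sum_(i <- q) y i].
Proof.
move=> /finite_seqP[q qE]; exists (undup q).
have yq i : y i != 0 <-> i \in undup q.
  by rewrite mem_undup; have := congr1 (@^~ i) qE => /= ->.
by rewrite undup_uniq; split=> //; apply: fsbig_uniq_seq (undup_uniq q) _ => i /yq.
Qed.

Lemma interval_convex d (T : porderType d) (J : set T) r s t :
  is_interval_set J -> (r <= s)%O -> (s <= t)%O -> J r -> J t -> J s.
Proof. by move=> [_ h] /h; apply. Qed.

(** Choosing a generator of each summand present at [s] gives a basis of [W s]; the map keeps
    exactly those whose interval also contains [t]. *)
Lemma interval_decomposition_rank (k : fieldType) d (T : porderType d)
    (W : pmod k T) (I : choiceType) (J : I -> set T)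
    (M : I -> forall t : T, set (W t)) (s t : T) (h : (s <= t)%O) :
  interval_decomposition J M -> finite_rank (pm_map W h) ->
  hascard [set i | J i s /\ J i t] (rank (pm_map W h)).
Proof.
move=> [Jint Msub Msum Mdir] fr.
have /choice[g hg] i : exists g : W s, J i s ->
    g != 0 /\ M i s = [set a *: g | a in [set: k]].
  have [Js|nJs] := pselect (J i s); last by exists 0.
  by have [_ /(_ s Js) [g g0 Mg] _] := Msum i; exists g.
have Mg i : J i s -> M i s (g i).
  by move=> /hg[_ ->]; exists 1; rewrite ?scale1r.
have -> : [set i | J i s /\ J i t] = [set i | J i s] `&` [set i | J i t] by [].
apply: (@rank_hascard _ _ _ _ _ _ g) => //.
- move=> x; have [y [[My fy ->] _]] := Mdir s x.
  have [r [_ yr ->]] := finite_support_sum fy.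
  apply: linsub_sum; first exact: spanf_linsub.
  move=> i /yr yi.
  have [Js|nJs] := pselect (J i s); last first.
    have [/(_ s nJs) e _ _] := Msum i; have := My i; rewrite e => y0.
    by rewrite y0 eqxx in yi.
  have := My i; have [_ ->] := hg i Js; move=> [a _ <-].
  by apply: linsubZ; [exact: spanf_linsub|exact: (@spanf_mem _ _ _ _ g)].
- move=> q c uq qP e0.
  pose v i := pm_map W h (g i).
  have Mv i : J i s -> J i t -> M i t (v i) /\ v i != 0.
    move=> Js Jt; have [_ _ /(_ s t h Js Jt) [vM vinj _]] := Msum i.
    split; first exact/vM/Mg.
    have [g0 _] := hg i Js; apply: contra_neq g0 => v0.
    apply: vinj; rewrite ?in_setE; first exact: Mg.
      by have [+ _ _] := Msub i; apply.
    by rewrite linear0.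
  have [y [_ yuniq]] := Mdir t 0.
  (* The relation makes [z] a decomposition of 0 in the direct sum; by uniqueness it is the zero
     decomposition. *)
  pose z i := if i \in q then c i *: v i else 0.
  have zE : z = y.
    apply/esym/yuniq; split.
    - move=> i; rewrite /z; have [M0 MP _] := Msub i.
      case: ifP => // /qP[Js Jt]; rewrite -[X in M i t X]addr0.
      by apply: MP => //; have [] := Mv i Js Jt.
    - apply: (@sub_finite_set _ _ [set` q]); last exact: finite_seq.
      by move=> i /=; rewrite /z; case: (i \in q) => // /eqP.
    rewrite (fsbig_uniq_seq uq); last by move=> i; rewrite /z; case: ifP; rewrite ?eqxx.
    rewrite -[LHS]e0 !big_seq; apply: eq_bigr => i iq.
    by rewrite /z iq.
  have yE : y = (fun=> 0).
    apply: yuniq; split.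
    - by move=> i; have [] := Msub i.
    - by apply: (@sub_finite_set _ _ set0) => // i /=; rewrite eqxx.
    - by rewrite fsbig1.
  move=> i iq; have [Js Jt] := qP i iq; have [_ v0] := Mv i Js Jt.
  have : z i = 0 by rewrite zE yE.
  by rewrite /z iq => /eqP; rewrite scaler_eq0 (negPf v0) orbF => /eqP.
move=> i Js nJt; have [/(_ t nJt) e _ _] := Msum i.
have [_ _ /(_ s t h (g i) (Mg i Js))] := Msub i.
by rewrite e.
Qed.

Section PersistentRank.
Variables (k : fieldType) (R : realType).
Implicit Types (V : pmod k R) (a b c d s t : \bar R).

Definition prank V s t : nat :=
  if @idP (s <= t)%O is ReflectT h then rank (pm_map (ext V) h) else 0%N.

Lemma prankE V s t (h : (s <= t)%O) : prank V s t = rank (pm_map (ext V) h).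
Proof.
rewrite /prank; case: {-}_ / idP => [h'|//].
by rewrite (bool_irrelevance h' h).
Qed.

(** The subtractions on [nat] are grouped so that none of them is truncated when [r] is a rank
    function; [boxE] states this. *)
Definition box (r : \bar R -> \bar R -> nat) a b c d : nat :=
  ((r b c - r a c) - (r b d - r a d))%N.

Lemma finite_rank0 (X Y : lmodType k) (f : X -> Y) : (forall x, f x = 0) ->
  finite_rank f.
Proof.
move=> f0; exists 0%N, (fun=> 0) => x; exists (fun=> 0).
by rewrite big_ord0.
Qed.

Lemma ext_finite_rank V s t (h : (s <= t)%O) : qtame V -> (s < t)%E ->
  finite_rank (pm_map (ext V) h).
Proof.
move=> qV; case: s t h => [p| |] [q| |] h st; try exact: finite_rank0.
rewrite /= in h st *; rewrite lte_fin in st.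
by have := qV p q st; rewrite (bool_irrelevance (ltW st) h).
Qed.

(** Inclusion-exclusion: among the intervals containing [b] and [c], those reaching [a] are
    discarded, then those reaching [d]. Convexity makes each discarded class a class counted by a
    rank. *)
Lemma box_decomposition V (Q : rectangle R) (I : choiceType) (J : I -> set 'I_4)
    (M : I -> forall t : 'I_4, set (four_term V Q t)) :
  qtame V -> (rb Q < rc Q)%E -> interval_decomposition J M ->
  hascard [set i : I | J i = middle] (box (prank V) (ra Q) (rb Q) (rc Q) (rd Q)).
Proof.
move=> qV bc dec.
have Jint : forall i, is_interval_set (J i) by case: dec.
have ab := rect_ab Q; have cd := rect_cd Q.
pose oa : 'I_4 := @Ordinal 4 0 isT; pose ob : 'I_4 := @Ordinal 4 1 isT.
pose oc : 'I_4 := @Ordinal 4 2 isT; pose od : 'I_4 := @Ordinal 4 3 isT.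
have cnt (i j : 'I_4) (s t : \bar R) : (i <= j)%O -> corner Q i = s ->
    corner Q j = t -> (s < t)%E -> hascard [set x | J x i /\ J x j] (prank V s t).
  move=> ij <- <- st; pose h := @corner_homo R Q _ _ ij.
  rewrite (prankE V h).
  have fr : finite_rank (pm_map (four_term V Q) ij) := ext_finite_rank h qV st.
  exact: (interval_decomposition_rank dec fr).
have conv x i j l : (i <= j)%O -> (j <= l)%O -> J x i -> J x l -> J x j.
  exact: interval_convex.
have cbc := cnt ob oc _ _ isT erefl erefl bc.
have cac := cnt oa oc _ _ isT erefl erefl (lt_trans ab bc).
have cbd := cnt ob od _ _ isT erefl erefl (lt_trans bc cd).
have cad := cnt oa od _ _ isT erefl erefl (lt_trans ab (lt_trans bc cd)).
have c1 : hascard ([set x | J x ob /\ J x oc] `&` ~` [set x | J x oa])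
    (prank V (rb Q) (rc Q) - prank V (ra Q) (rc Q)).
  apply: hascardD => //; suff -> : [set x | J x ob /\ J x oc] `&` [set x | J x oa] =
    [set x | J x oa /\ J x oc] by [].
  apply/seteqP; split=> x /= => [[[_ ? ?]]|[? ?]] //.
  by split=> //; split=> //; apply: (conv x oa ob oc).
have c2 : hascard ([set x | J x ob /\ J x od] `&` ~` [set x | J x oa])
    (prank V (rb Q) (rd Q) - prank V (ra Q) (rd Q)).
  apply: hascardD => //; suff -> : [set x | J x ob /\ J x od] `&` [set x | J x oa] =
    [set x | J x oa /\ J x od] by [].
  apply/seteqP; split=> x /= => [[[_ ? ?]]|[? ?]] //.
  by split=> //; split=> //; apply: (conv x oa ob od).
suff -> : [set x | J x = middle] = ([set x | J x ob /\ J x oc] `&`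
    ~` [set x | J x oa]) `&` ~` [set x | J x od].
  apply: hascardD => //; suff -> : [set x | J x ob /\ J x oc] `&` ~` [set x | J x oa]
    `&` [set x | J x od] = [set x | J x ob /\ J x od] `&` ~` [set x | J x oa] by [].
  apply/seteqP; split=> x /= => [[[[? ?] ?] ?]|[[? ?] ?]] //.
  by split=> //; split=> //; split=> //; apply: (conv x ob oc od).
apply/seteqP; split=> x /=.
  by move=> ->; split; [split; [split|]|].
move=> [[[Jb Jc] nJa] nJd]; apply/seteqP; split.
  move=> [[|[|[|[|n]]]] lt] //= Jn.
  - by case: nJa; rewrite (_ : oa = Ordinal lt) //; apply: val_inj.
  - by case: nJd; rewrite (_ : od = Ordinal lt) //; apply: val_inj.
move=> [[|[|[|[|n]]]] lt] // _.
- by rewrite (_ : Ordinal lt = ob) //; apply: val_inj.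
- by rewrite (_ : Ordinal lt = oc) //; apply: val_inj.
Qed.

(** Padding with [-oo] and [+oo], where the extended module is 0, turns the four-term sequence into
    a module over the integers. *)
Definition cornerz (Q : rectangle R) (n : int) : \bar R :=
  match n with
  | Posz 0 => ra Q | Posz 1 => rb Q | Posz 2 => rc Q | Posz 3 => rd Q
  | Posz _ => +oo%E
  | Negz _ => -oo%E
  end.

Lemma cornerz_homo (Q : rectangle R) : {homo cornerz Q : n m / n <= m >-> (n <= m)%O}.
Proof.
have hab := ltW (rect_ab Q); have hbc := rect_bc Q; have hcd := ltW (rect_cd Q).
have hac := le_trans hab hbc; have hbd := le_trans hbc hcd.
have had := le_trans hab hbd.
by case=> [[|[|[|[|n]]]]|n] [[|[|[|[|m]]]]|m] //= _; rewrite ?leey ?leNye.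
Qed.

Lemma corner_cornerz (Q : rectangle R) (i : 'I_4) : corner Q i = cornerz Q i.
Proof. by case: i => [[|[|[|[|n]]]] lt] //; rewrite /corner (tnth_nth 0%E). Qed.

(** The padded module is 0 at negative indices, so its images stabilise trivially and it has a
    barcode; each bar spans an interval summand. *)
Lemma four_term_decomposition V (Q : rectangle R) :
  exists (I : choiceType) (J : I -> set 'I_4)
         (M : I -> forall t : 'I_4, set (four_term V Q t)),
    interval_decomposition J M.
Proof.
pose W : pmod k int := pullback (@cornerz_homo Q) (ext V).
have zero_neg (n : nat) (x : W (Negz n)) : x = 0 by apply/rowP => -[].
have zero_big (n : nat) (x : W n.+4%:Z) : x = 0 by apply/rowP => -[].
have stab : images_stabilize W.
  move=> t; exists (- (`|t|%N.+1)%:Z); first by lia.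
  move=> i hi hN _ _ [x _ <-]; exists 0 => //; rewrite linear0.
  by rewrite (_ : x = 0) ?linear0 //; apply: (zero_neg `|t|%N).
have [I [S [e [nat_e ne_e ind_e gen_e]]]] := barcode_exists stab.
(* The two corner functions agree only propositionally. The structure maps of these inequalities are
   inverse to each other and serve as transports. *)
have up (t : 'I_4) : (cornerz Q t <= corner Q t)%O by rewrite corner_cornerz.
have down (t : 'I_4) : (corner Q t <= cornerz Q t)%O by rewrite corner_cornerz.
pose e4 (i : I) (t : 'I_4) : four_term V Q t := pm_map (ext V) (up t) (e i t).
pose back (t : 'I_4) := pm_map (ext V) (down t).
have upK (t : 'I_4) (x : four_term V Q t) : pm_map (ext V) (up t) (back t x) = x.
  by rewrite /back (pm_map_comp _ _ (lexx _)) pm_map_id.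
have e4K (t : 'I_4) i : back t (e4 i t) = e i t.
  by rewrite /back /e4 (pm_map_comp _ _ (lexx _)) pm_map_id.
have e40 (t : 'I_4) i : (e4 i t == 0) = (e i t == 0).
  by apply/eqP/eqP => h; [rewrite -e4K h /back linear0|rewrite /e4 h linear0].
have e4_nat (s t : 'I_4) (h : (s <= t)%O) i : S i -> e i s != 0 ->
    pm_map (four_term V Q) h (e4 i s) = e4 i t.
  move=> Si es; have st : s%:Z <= t%:Z by rewrite lez_nat; exact: h.
  rewrite /e4 -(nat_e i _ _ st Si es) /=.
  have h1 := le_trans (up s) (corner_homo Q h).
  have h2 := le_trans (cornerz_homo Q st) (up t).
  rewrite (pm_map_comp (p := ext V) (up s) (corner_homo Q h) h1).
  rewrite (pm_map_comp (p := ext V) (cornerz_homo Q st) (up t) h2).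
  by rewrite (bool_irrelevance h1 h2).
have pmZ (s t : 'I_4) (h : (s <= t)%O) (a : k) x :
    pm_map (four_term V Q) h (a *: x) = a *: pm_map (four_term V Q) h x.
  exact: linearZ.
have ind4 (t : 'I_4) : indep (S `&` [set i | e i t != 0]) (e4^~ t).
  move=> s c us sP e0; apply: (ind_e t s c us sP).
  rewrite -[RHS](linear0 (back t)) -e0 linear_sum; apply: eq_bigr => i _.
  by rewrite linearZ /= e4K.
have gen4 (t : 'I_4) x : spanf (S `&` [set i | e i t != 0]) (e4^~ t) x.
  have [l lP xE] := gen_e t (back t x); exists l => //.
  rewrite -[x]upK xE /lcomb linear_sum; apply: eq_bigr => p _.
  by rewrite linearZ.
(* The direct sum ranges over a whole type, so the indices are cut down to actual bars. *)
pose K : choiceType := {i : I | `[< S i >]}.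
have SK (i : K) : S (val i) by exact/asboolP/(valP i).
exists K, (fun i : K => [set t : 'I_4 | e (val i) t != 0]),
  (fun (i : K) (t : 'I_4) => [set a *: e4 (val i) t | a in [set: k]]).
split.
- move=> i; split.
    have [[[|[|[|[|n]]]]|n] en] := ne_e _ (SK i).
    + by exists (@Ordinal 4 0 isT).
    + by exists (@Ordinal 4 1 isT).
    + by exists (@Ordinal 4 2 isT).
    + by exists (@Ordinal 4 3 isT).
    + by rewrite (zero_big _ (e _ _)) eqxx in en.
    + by rewrite (zero_neg _ (e _ _)) eqxx in en.
  move=> r s t rs st /= er et; apply: contra_neq et => es.
  have rs' : r%:Z <= s%:Z by rewrite lez_nat; exact: rs.
  have st' : s%:Z <= t%:Z by rewrite lez_nat; exact: st.
  have rt' := le_trans rs' st'.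
  rewrite -(nat_e _ _ _ rt' (SK i) er) -(pm_map_comp rs' st' rt').
  by rewrite (nat_e _ _ _ rs' (SK i) er) es linear0.
- move=> i; split.
  + by move=> t; exists 0; rewrite ?scale0r.
  + move=> t a _ _ [b _ <-] [c _ <-]; exists (a * b + c) => //.
    by rewrite scalerDl scalerA.
  + move=> s t h _ [a _ <-]; rewrite pmZ.
    have [es|es] := eqVneq (e (val i) s) 0; last by exists a; rewrite // e4_nat.
    have -> : e4 (val i) s = 0 by apply/eqP; rewrite e40 es.
    by exists 0; rewrite // linear0 scaler0 scale0r.
- move=> i; split.
  + move=> t /negP; rewrite negbK -e40 => /eqP ->.
    apply/seteqP; split=> [_ [a _ <-]|_ ->]; first by rewrite scaler0.
    by exists 0; rewrite ?scaler0.
  + by move=> t et; exists (e4 (val i) t); rewrite ?e40.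
  + move=> s t h es et; split.
    * by move=> _ [a _ <-]; rewrite pmZ e4_nat //; exists a.
    * move=> _ _ /set_mem[a _ <-] /set_mem[b _ <-].
      rewrite !pmZ e4_nat // => /eqP; rewrite -subr_eq0 -scalerBl scaler_eq0.
      by rewrite e40 (negPf et) orbF subr_eq0 => /eqP ->.
    * by move=> _ [a _ <-]; exists (a *: e4 (val i) s); [exists a|rewrite pmZ e4_nat].
move=> t x.
have [s [c [us sP xE]]] := spanf_uniq (gen4 t x).
pose coor (j : I) := if j \in s then c j else 0.
pose y (i : K) := coor (val i) *: e4 (val i) t.
pose sK : seq K := pmap insub s.
have memK (i : K) : (i \in sK) = (val i \in s).
  by rewrite mem_pmap_sub.
have usK : uniq sK by apply: pmap_sub_uniq.
have sumK (F : I -> four_term V Q t) : \sum_(i <- sK) F (val i) = \sum_(j <- s) F j.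
  rewrite -(big_map val predT F) /sK; congr bigop.body.
  elim: (s) sP => //= j q IH jP; have [Sj _] := jP j (mem_head _ _).
  rewrite insubT; first exact/asboolP.
  move=> ? /=; rewrite IH // => j' j'q; apply: jP.
  by rewrite inE j'q orbT.
have y0 i : y i != 0 -> i \in sK.
  by rewrite /y /coor memK; case: ifP; rewrite ?scale0r ?eqxx.
exists y; split.
  split.
  - by move=> i; exists (coor (val i)).
  - by apply: (@sub_finite_set _ _ [set` sK]); [move=> i /= /y0|exact: finite_seq].
  rewrite (fsbig_uniq_seq usK y0) (sumK (fun j => coor j *: e4 j t)) xE !big_seq.
  by apply: eq_bigr => j js; rewrite /coor js.
move=> z [zM fz xz]; apply/funext => i; apply/eqP; rewrite -subr_eq0; apply/eqP.
have [q [uq zq zE]] := finite_support_sum fz.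
(* The list [w] contains the supports of both decompositions [y] and [z]; their difference is a
   vanishing combination of independent vectors. *)
pose w := undup (sK ++ q).
pose alive_w := [seq i <- w | e (val i) t != 0].
have /choice[a aE] j : exists a : k, y j - z j = a *: e4 (val j) t.
  have [a _ <-] := zM j; exists (coor (val j) - a).
  by rewrite scalerBl.
have w_sum : \sum_(j <- alive_w) a j *: e4 (val j) t = 0.
  rewrite big_filter.
  have -> : \sum_(j <- w | e (val j) t != 0) a j *: e4 (val j) t = \sum_(j <- w) (y j - z j).
    rewrite big_mkcond; apply: eq_bigr => j _; rewrite aE; case: ifP => // /negbFE.
    by rewrite -e40 => /eqP ->; rewrite scaler0.
  rewrite sumrB.
  have <- : \sum_(j \in [set: K]) y j = \sum_(j <- w) y j.
    apply: fsbig_uniq_seq; first exact: undup_uniq.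
    by move=> j /y0; rewrite mem_undup mem_cat => ->.
  have <- : \sum_(j \in [set: K]) z j = \sum_(j <- w) z j.
    apply: fsbig_uniq_seq; first exact: undup_uniq.
    by move=> j /zq; rewrite mem_undup mem_cat orbC => ->.
  rewrite -xz (fsbig_uniq_seq usK y0) (sumK (fun j => coor j *: e4 j t)) xE.
  rewrite !big_seq (eq_bigr (fun j => c j *: e4 j t)) ?subrr //.
  by move=> j js; rewrite /coor js.
have [/eqP e0|en] := eqVneq (e4 (val i) t) 0; first by rewrite aE (eqP e0) scaler0.
have [iw|iw] := boolP (i \in alive_w); last first.
  move: iw; rewrite mem_filter -e40 en /= mem_undup mem_cat negb_or => /andP[i1 i2].
  have -> : y i = 0 by apply: contraNeq i1 => /y0.
  by have -> : z i = 0 by [apply: contraNeq i2 => /zq]; rewrite subrr.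
rewrite aE; suff -> : a i = 0 by rewrite scale0r.
pose a' (j : I) := if insub j is Some j' then a j' else 0.
have a'E (j : K) : a' (val j) = a j by rewrite /a' valK.
rewrite -a'E; apply: (ind4 t (map val alive_w)).
- by rewrite map_inj_uniq ?filter_uniq ?undup_uniq //; exact: val_inj.
- by move=> _ /mapP[j + ->]; rewrite mem_filter => /andP[ej _]; split=> //; exact: SK.
- rewrite big_map -[RHS]w_sum; apply: eq_bigr => j _.
  by rewrite a'E.
- exact: map_f.
Qed.

(** Every decomposition gives the same count, and one exists, so the choice made by [xget] is
    immaterial. *)
Lemma pmeasureE V (Q : rectangle R) : qtame V -> (rb Q < rc Q)%E ->
  pmeasure V Q = (box (prank V) (ra Q) (rb Q) (rc Q) (rd Q))%:R%:E.
Proof.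
move=> qV bc; rewrite /pmeasure.
have val_eq n : is_pmeasure V Q n -> n = (box (prank V) (ra Q) (rb Q) (rc Q) (rd Q))%:R%:E.
  by move=> [I [J [M [dec ->]]]]; apply/hascard_counting/(box_decomposition qV bc dec).
case: xgetP => [n _ /val_eq //|none].
have [I [J [M dec]]] := four_term_decomposition V Q.
by case: (none (counting [set i : I | J i = middle])); exists I, J, M.
Qed.

End PersistentRank.

(** * Existence of diagrams *)

Section Decorated.
Variable R : realType.
Implicit Types (p q : decorated R) (x y : R) (a b : \bar R).

Lemma lt_ereal_decN x p : lt_ereal_dec x%:E p = ~~ lt_dec_ereal p x%:E.
Proof.
case: p => [[] z|[]]; rewrite /lt_ereal_dec /lt_dec_ereal /= ?lte_fin ?lee_fin //.
- by rewrite ltNge.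
- by rewrite leNgt.
- by rewrite leeNy_eq ltNyr.
- by rewrite ltry.
Qed.

Lemma lt_dec_erealN x p : lt_dec_ereal p x%:E = ~~ lt_ereal_dec x%:E p.
Proof. by rewrite lt_ereal_decN negbK. Qed.

Lemma lt_ereal_decNy p : lt_ereal_dec -oo%E p.
Proof. by case: p => [[] z|[]]; rewrite /lt_ereal_dec /= ?ltNyr ?leNye. Qed.

Lemma lt_dec_erealy p : lt_dec_ereal p +oo%E.
Proof. by case: p => [[] z|[]]; rewrite /lt_dec_ereal /= ?ltry ?leey. Qed.

Lemma lt_dec_ereal_le p a b : lt_dec_ereal p a -> (a <= b)%E -> lt_dec_ereal p b.
Proof.
rewrite /lt_dec_ereal; case: minus_decorated => h ab; first exact: le_trans ab.
exact: lt_le_trans ab.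
Qed.

Lemma lt_ereal_dec_le p a b : lt_ereal_dec b p -> (a <= b)%E -> lt_ereal_dec a p.
Proof.
rewrite /lt_ereal_dec; case: minus_decorated => h ab; first exact: le_lt_trans ab h.
exact: le_trans ab h.
Qed.

Lemma lt_dec_trans a p b : lt_ereal_dec a p -> lt_dec_ereal p b -> (a < b)%E.
Proof.
rewrite /lt_ereal_dec /lt_dec_ereal; case: minus_decorated => h h'.
  exact: lt_le_trans h'.
exact: le_lt_trans h'.
Qed.

Lemma lt_dec_undecorate p b : lt_dec_ereal p b -> (undecorate p <= b)%E.
Proof. by rewrite /lt_dec_ereal; case: minus_decorated => // /ltW. Qed.

Lemma lt_undecorate_dec a p : lt_ereal_dec a p -> (a <= undecorate p)%E.
Proof. by rewrite /lt_ereal_dec; case: minus_decorated => // /ltW. Qed.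

Lemma undecorate_lt_dec p b : (undecorate p < b)%E -> lt_dec_ereal p b.
Proof. by rewrite /lt_dec_ereal; case: minus_decorated => // /ltW. Qed.

Lemma undecorate_lt_ereal a p : (a < undecorate p)%E -> lt_ereal_dec a p.
Proof. by rewrite /lt_ereal_dec; case: minus_decorated => // /ltW. Qed.

Lemma lt_dec_ereal_trans p q b : (p <= q)%O -> lt_dec_ereal q b -> lt_dec_ereal p b.
Proof.
case: p q => [[] z|[]] [[] w|[]] //=; rewrite ?bnd_simp /lt_dec_ereal //= => zw.
all: try by move=> h; apply: le_trans h; rewrite lee_fin.
all: try by move=> h; apply: lt_le_trans h; rewrite lte_fin.
all: try by move=> h; apply: le_lt_trans h; rewrite lee_fin.
all: try by move=> h; apply/ltW/(le_lt_trans _ h); rewrite lee_fin.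
all: try by move=> h; apply/lt_le_trans/h; rewrite ltNyr.
all: try by move=> h; apply/(lt_trans _ h); rewrite ltNyr.
all: try by rewrite leye_eq => /eqP ->; rewrite ?leey ?ltry ?ltNyy.
Qed.

Lemma lt_ereal_dec_trans p q a : (p <= q)%O -> lt_ereal_dec a p -> lt_ereal_dec a q.
Proof.
case: p q => [[] z|[]] [[] w|[]] //=; rewrite ?bnd_simp /lt_ereal_dec //= => zw.
all: try by move=> h; apply: (lt_le_trans h); rewrite lee_fin.
all: try by move=> h; apply: (le_lt_trans h); rewrite lte_fin.
all: try by move=> h; apply: (le_trans h); rewrite lee_fin.
all: try by move=> h; apply/ltW/(lt_le_trans h); rewrite lee_fin.
all: try by move=> h; apply: (lt_trans h); rewrite ltry.
all: try by move=> h; apply: (le_lt_trans h); rewrite ltry.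
all: try by rewrite leeNy_eq => /eqP ->; rewrite ?leNye ?ltNyr ?ltNyy.
Qed.

(** Rectangles with undecorated corners thus separate decorated points; between [x^-] and [x^+] the
    separating number is [x] itself. *)
Lemma dec_separation p q : (p < q)%O ->
  exists x, lt_dec_ereal p x%:E /\ lt_ereal_dec x%:E q.
Proof.
case: p q => [[] z|[]] [[] w|[]] //=; rewrite ?bnd_simp /lt_ereal_dec /lt_dec_ereal //= => zw.
- by exists z; rewrite lexx lte_fin.
- by exists z; rewrite lexx lee_fin.
- by exists z; rewrite lexx ltry.
- by exists ((z + w) / 2); rewrite !lte_fin midf_lt // midf_lt.
- by exists w; rewrite lexx lte_fin.
- by exists (z + 1); rewrite lte_fin ltrDl ltr01 ltry.
- by exists (w - 1); rewrite ltNyr lte_fin ltrBlDr ltrDl ltr01.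
- by exists w; rewrite ltNyr lexx.
- by exists 0; rewrite ltNyr ltry.
Qed.

(** Decorated numbers are the Dedekind cuts of the line: the decoration of the infimum records
    whether it is attained. *)
Lemma dec_cut (F : R -> Prop) : (forall x y, x <= y -> F x -> F y) ->
  exists p, forall x, lt_dec_ereal p x%:E <-> F x.
Proof.
move=> up.
have [allF|/existsNP[x0 nF]] := pselect (forall x, F x).
  by exists -oo%O => x; rewrite /lt_dec_ereal /= ltNyr; split.
have [[x1 F1]|noF] := pselect (exists x, F x); last first.
  exists +oo%O => x; rewrite /lt_dec_ereal /= leye_eq; split=> // Fx.
  by case: noF; exists x.
have lb : has_inf [set x | F x].
  split; first by exists x1.
  exists x0 => x Fx /=; rewrite leNgt; apply/negP => /ltW /up /(_ Fx).
  exact: nF.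
pose z := inf [set x | F x].
have zlt x : z < x -> F x.
  by move=> zx; have [y Fy /ltW yx] := inf_lt lb.1 zx; exact: up Fy.
have zle x : F x -> z <= x by move=> Fx; apply: ge_inf => //; exact: lb.2.
have [Fz|nFz] := pselect (F z).
  exists (BLeft z) => x; rewrite /lt_dec_ereal /= lee_fin.
  by split=> [zx|/zle //]; exact: up Fz.
exists (BRight z) => x; rewrite /lt_dec_ereal /= lte_fin; split; first exact: zlt.
by move=> Fx; rewrite lt_neqAle zle // andbT; apply/eqP => e; rewrite e in nFz.
Qed.

(** The bound is raised past each of the finitely many members of [s] that lie below [p]. *)
Lemma dec_lower (s : seq (decorated R)) p a : lt_ereal_dec a p ->
  exists a', [/\ (a <= a')%E, lt_ereal_dec a' p &
    forall q, q \in s -> lt_ereal_dec a' q -> (p <= q)%O].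
Proof.
move=> ap; elim: s => [|q s [a' [aa' a'p h]]]; first by exists a.
have [pq|qp] := leP p q.
  by exists a'; split=> // z /predU1P[->//|/h].
have [x [qx xp]] := dec_separation qp.
exists (Order.max a' x%:E); split.
- by rewrite le_max aa'.
- by case: leP.
move=> z /predU1P[->|/h {}h] zlt; last first.
  by apply: h; apply: lt_ereal_dec_le zlt _; rewrite le_max lexx.
have : lt_ereal_dec x%:E q by apply: lt_ereal_dec_le zlt _; rewrite le_max lexx orbT.
by rewrite lt_ereal_decN qx.
Qed.

Lemma dec_upper (s : seq (decorated R)) p b : lt_dec_ereal p b ->
  exists b', [/\ (b' <= b)%E, lt_dec_ereal p b' &
    forall q, q \in s -> lt_dec_ereal q b' -> (q <= p)%O].
Proof.
move=> bp; elim: s => [|q s [b' [bb' b'p h]]]; first by exists b.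
have [qp|pq] := leP q p.
  by exists b'; split=> // z /predU1P[->//|/h].
have [x [px xq]] := dec_separation pq.
exists (Order.min b' x%:E); split.
- by rewrite ge_min bb'.
- by case: leP.
move=> z /predU1P[->|/h {}h] zlt; last first.
  by apply: h; apply: lt_dec_ereal_le zlt _; rewrite ge_min lexx.
have : lt_dec_ereal q x%:E by apply: lt_dec_ereal_le zlt _; rewrite ge_min lexx orbT.
by rewrite lt_dec_erealN xq.
Qed.

End Decorated.

Section Diagrams.
Variable R : realType.
Local Notation point := (decorated R * decorated R)%type.
Implicit Types (r : \bar R -> \bar R -> nat) (a b c d : \bar R) (m : multiset point).

(** The inequality is asked for [b < c] only, because [r b b] would be the rank of an identity map,
    which may be infinite. *)
Definition rank_function r : Prop :=
  [/\ forall t, r -oo%E t = 0%N, forall s, r s +oo%E = 0%N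
    & forall a b c d, (a <= b)%E -> (b < c)%E -> (c <= d)%E ->
        (r a c + r b d <= r b c + r a d)%N].

Definition in_box a b c d (x : point) : bool :=
  [&& lt_ereal_dec a x.1, lt_dec_ereal x.1 b, lt_ereal_dec c x.2
    & lt_dec_ereal x.2 d].

Definition is_diagram r m : Prop :=
  (forall x, (0 < m x)%N -> (undecorate x.1 < undecorate x.2)%E) /\
  (forall a b c d, (a < b)%E -> (b < c)%E -> (c < d)%E ->
     hascard (copies m `&` [set x | in_box a b c d x.1]) (box r a b c d)).

Section Box.
Variable r : \bar R -> \bar R -> nat.
Hypothesis rP : rank_function r.

(** No subtraction truncates: the rank inequality with [d = +oo] or [a = -oo] says that [r]
    increases in its first and decreases in its second argument. *)
Lemma boxE a b c d : (a <= b)%E -> (b < c)%E -> (c <= d)%E ->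
  (box r a b c d + (r a c + r b d) = r b c + r a d)%N.
Proof.
case: rP => r0 ry rb ab bc cd; rewrite /box.
have := rb a b c d ab bc cd; have := rb a b c +oo%E ab bc (leey c).
have := rb a b d +oo%E ab (lt_le_trans bc cd) (leey d).
have := rb -oo%E b c d (leNye b) bc cd.
rewrite !r0 !ry; lia.
Qed.

Lemma box_splitl a x b c d : (a <= x)%E -> (x <= b)%E -> (b < c)%E -> (c <= d)%E ->
  box r a b c d = (box r a x c d + box r x b c d)%N.
Proof.
move=> ax xb bc cd; have := boxE (le_trans ax xb) bc cd.
have := boxE ax (le_lt_trans xb bc) cd; have := boxE xb bc cd; lia.
Qed.

Lemma box_splitr a b c y d : (a <= b)%E -> (b < c)%E -> (c <= y)%E -> (y <= d)%E ->
  box r a b c d = (box r a b c y + box r a b y d)%N.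
Proof.
move=> ab bc cy yd; have := boxE ab bc (le_trans cy yd).
have := boxE ab bc cy; have := boxE ab (lt_le_trans bc cy) yd; lia.
Qed.

Lemma box_mono a b c d a' b' c' d' : (a <= a')%E -> (a' <= b')%E -> (b' <= b)%E ->
  (b < c)%E -> (c <= c')%E -> (c' <= d')%E -> (d' <= d)%E ->
  (box r a' b' c' d' <= box r a b c d)%N.
Proof.
move=> aa ab bb bc cc cd dd.
have cd' : (c <= d')%E := le_trans cc cd.
rewrite (box_splitl aa (le_trans ab bb) bc (le_trans cd' dd)).
rewrite (box_splitl ab bb bc (le_trans cd' dd)).
rewrite (box_splitr ab (le_lt_trans bb bc) cd' dd).
rewrite (box_splitr ab (le_lt_trans bb bc) cc cd); lia.
Qed.

(** The limit of the measures of boxes shrinking to [x]; it is attained because they are natural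
    numbers. *)
Definition multiplicity (x : point) : nat :=
  if (undecorate x.1 < undecorate x.2)%E then
    xget 0%N [set n |
      (exists a b c d, [/\ (a < b)%E, (b < c)%E, (c < d)%E, in_box a b c d x
         & n = box r a b c d]) /\
      forall a b c d, (a < b)%E -> (b < c)%E -> (c < d)%E -> in_box a b c d x ->
        (n <= box r a b c d)%N]
  else 0%N.

Lemma box_around (x : point) : (undecorate x.1 < undecorate x.2)%E ->
  exists b c : R, [/\ b < c, lt_dec_ereal x.1 b%:E & lt_ereal_dec c%:E x.2].
Proof.
move=> lt.
have [b [xb bx]] : exists b : R, (undecorate x.1 < b%:E)%E /\ (b%:E < undecorate x.2)%E.
  case: (undecorate x.1) (undecorate x.2) lt => [p| |] [q| |] //= lt.
  - rewrite lte_fin in lt; exists ((p + q) / 2).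
    by rewrite !lte_fin midf_lt // midf_lt.
  - by exists (p + 1); rewrite lte_fin ltrDl ltr01 ltry.
  - by exists (q - 1); rewrite ltNyr lte_fin ltrBlDr ltrDl ltr01.
  - by exists 0; rewrite ltNyr ltry.
have [c [bc cx]] : exists c : R, (b%:E < c%:E)%E /\ (c%:E < undecorate x.2)%E.
  case: (undecorate x.2) bx => [q| |] //= bx.
  - rewrite lte_fin in bx; exists ((b + q) / 2).
    by rewrite !lte_fin midf_lt // midf_lt.
  - by exists (b + 1); rewrite lte_fin ltrDl ltr01 ltry.
exists b, c; split=> //; first exact: undecorate_lt_dec.
exact: undecorate_lt_ereal.
Qed.

Lemma in_box_lt a b c d x : in_box a b c d x -> (b < c)%E ->
  (undecorate x.1 < undecorate x.2)%E.
Proof.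
move=> /and4P[_ /lt_dec_undecorate xb /lt_undecorate_dec cx _] bc.
exact: le_lt_trans xb (lt_le_trans bc cx).
Qed.

Lemma multiplicityP x : (undecorate x.1 < undecorate x.2)%E ->
  (exists a b c d, [/\ (a < b)%E, (b < c)%E, (c < d)%E, in_box a b c d x
         & multiplicity x = box r a b c d]) /\
  forall a b c d, (a < b)%E -> (b < c)%E -> (c < d)%E -> in_box a b c d x ->
    (multiplicity x <= box r a b c d)%N.
Proof.
move=> lt; rewrite /multiplicity lt.
set P := [set n | _].
suff [n Pn] : exists n, P n by case: xgetP => [m _ //|/(_ n)].
pose Q n := `[< exists a b c d, [/\ (a < b)%E, (b < c)%E, (c < d)%E,
   in_box a b c d x & n = box r a b c d] >].
have exQ : exists n, Q n.
  have [b [c [bc xb cx]]] := box_around lt.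
  exists (box r -oo b%:E c%:E +oo); apply/asboolP.
  exists -oo%E, b%:E, c%:E, +oo%E.
  by rewrite /in_box lt_ereal_decNy xb cx lt_dec_erealy ltNyr ltry lte_fin.
case: (ex_minnP exQ) => n /asboolP Qn minQ; exists n; split=> //.
by move=> a b c d ab bc cd xQ; apply: minQ; apply/asboolP; exists a, b, c, d.
Qed.

(** Induction on the measure of the box. A line that cuts off a nonzero proper part of the measure
    leaves two boxes of smaller measure, whose counts add up. *)
Lemma multiplicity_diagram : is_diagram r multiplicity.
Proof.
split.
  by move=> x; rewrite /multiplicity; case: ifP.
move=> a b c d ab bc cd; move En: (box r a b c d) => n.
elim/ltn_ind: n a b c d ab bc cd En => n IH a b c d ab bc cd En.
have le_m x : in_box a b c d x -> (multiplicity x <= n)%N.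
  by move=> xQ; rewrite -En; apply: (multiplicityP (in_box_lt xQ bc)).2.
have [n0|n_gt0] := posnP n.
  subst n; rewrite n0; apply: hascard0 => -[x i] [/= ix /le_m].
  by rewrite n0 leqn0 => /eqP mx; rewrite /copies /= mx in ix.
have splitx (x : R) : (a < x%:E)%E -> (x%:E < b)%E ->
    n = (box r a x%:E c d + box r x%:E b c d)%N.
  by move=> ax xb; rewrite -En; apply: box_splitl; rewrite ?ltW.
have splity (y : R) : (c < y%:E)%E -> (y%:E < d)%E ->
    n = (box r a b c y%:E + box r a b y%:E d)%N.
  by move=> cy yd; rewrite -En; apply: box_splitr; rewrite ?ltW.
have [[x [ax xb x0 xn]]|nox] := pselect (exists x : R, [/\ (a < x%:E)%E, (x%:E < b)%E,
    (0 < box r a x%:E c d)%N & (box r a x%:E c d < n)%N]).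
  have e := splitx x ax xb; rewrite e.
  have h1 := IH _ xn _ _ _ _ ax (lt_trans xb bc) cd erefl.
  have lt2 : (box r x%:E b c d < n)%N by lia.
  have h2 := IH _ lt2 _ _ _ _ xb bc cd erefl.
  have -> : copies multiplicity `&` [set p | in_box a b c d p.1] =
     (copies multiplicity `&` [set p | in_box a x%:E c d p.1]) `|`
     (copies multiplicity `&` [set p | in_box x%:E b c d p.1]).
    rewrite -setIUr; congr (_ `&` _).
    apply/seteqP; split=> -[[p q] i] /=; rewrite /in_box /=.
      move=> /and4P[-> -> -> ->]; rewrite lt_ereal_decN.
      by case: (lt_dec_ereal p x%:E); [left|right].
    move=> [|] /and4P[h h' -> ->]; rewrite andbT.
      by rewrite h (lt_dec_ereal_le h' (ltW xb)).
    by rewrite (lt_ereal_dec_le h (ltW ax)) h'.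
  apply: (hascardU _ h1 h2).
  apply/seteqP; split=> // -[[p q] i] [[_ /and4P[_ + _ _]] [_ /and4P[+ _ _ _]]] /=.
  by rewrite lt_ereal_decN => ->.
have [[y [cy yd y0 yn]]|noy] := pselect (exists y : R, [/\ (c < y%:E)%E, (y%:E < d)%E,
    (0 < box r a b c y%:E)%N & (box r a b c y%:E < n)%N]).
  have e := splity y cy yd; rewrite e.
  have h1 := IH _ yn _ _ _ _ ab bc cy erefl.
  have lt2 : (box r a b y%:E d < n)%N by lia.
  have h2 := IH _ lt2 _ _ _ _ ab (lt_trans bc cy) yd erefl.
  have -> : copies multiplicity `&` [set p | in_box a b c d p.1] =
     (copies multiplicity `&` [set p | in_box a b c y%:E p.1]) `|`
     (copies multiplicity `&` [set p | in_box a b y%:E d p.1]).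
    rewrite -setIUr; congr (_ `&` _).
    apply/seteqP; split=> -[[p q] i] /=; rewrite /in_box /=.
      move=> /and4P[-> -> -> ->]; rewrite lt_ereal_decN.
      by case: (lt_dec_ereal q y%:E); [left|right].
    move=> [|] /and4P[-> -> h h'] /=.
      by rewrite h (lt_dec_ereal_le h' (ltW yd)).
    by rewrite (lt_ereal_dec_le h (ltW cy)) h'.
  apply: (hascardU _ h1 h2).
  apply/seteqP; split=> // -[[p q] i] [[_ /and4P[_ _ _ +]] [_ /and4P[_ _ + _]]] /=.
  by rewrite lt_ereal_decN => ->.
(* No vertical or horizontal line splits the box: its whole measure sits at the
   point where the two Dedekind cuts meet. *)
have zx (x : R) : (a < x%:E)%E -> (x%:E < b)%E -> (0 < box r a x%:E c d)%N ->
    box r a x%:E c d = n.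
  move=> ax xb x0; have e := splitx x ax xb.
  apply/eqP; rewrite eqn_leq; apply/andP; split; first by lia.
  by rewrite leqNgt; apply/negP => lt; case: nox; exists x.
have zy (y : R) : (c < y%:E)%E -> (y%:E < d)%E -> (0 < box r a b c y%:E)%N ->
    box r a b c y%:E = n.
  move=> cy yd y0; have e := splity y cy yd.
  apply/eqP; rewrite eqn_leq; apply/andP; split; first by lia.
  by rewrite leqNgt; apply/negP => lt; case: noy; exists y.
(* The function is controlled only between [l] and [u]; declaring everything from [u] on positive
   keeps the cut within these bounds. *)
have cut (l u : \bar R) (f : R -> nat) : (l < u)%E ->
    (forall x y : R, (l < x%:E)%E -> x <= y -> (y%:E < u)%E -> (f x <= f y)%N) ->
    exists p : decorated R, [/\ lt_ereal_dec l p, lt_dec_ereal p u &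
      forall x : R, (l < x%:E)%E -> (x%:E < u)%E -> lt_dec_ereal p x%:E = (0 < f x)%N].
  move=> lu fmono.
  have [x y xy|p hp] := @dec_cut R (fun x => (l < x%:E)%E /\ ((u <= x%:E)%E \/ (0 < f x)%N)).
    move=> [lx h]; split; first by apply: lt_le_trans lx _; rewrite lee_fin.
    have [ux|xu] := leP u y%:E; first by left.
    case: h => [ux|f0]; last by right; apply: leq_trans f0 _; apply: fmono.
    have : (y%:E < y%:E)%E by apply: lt_le_trans xu (le_trans ux _); rewrite lee_fin.
    by rewrite ltxx.
  exists p; split.
  - case: l lu fmono hp => [l| |] lu fmono hp; last 2 first.
    + by rewrite ltNge leey in lu.
    + exact: lt_ereal_decNy.
    by rewrite lt_ereal_decN; apply/negP => /hp[]; rewrite ltxx.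
  - case: u lu fmono hp => [u| |] lu fmono hp; last 2 first.
    + exact: lt_dec_erealy.
    + by rewrite ltNge leNye in lu.
    by apply/hp; split=> //; left.
  move=> x lx xu; apply/idP/idP => [/hp[_ [|//]]|f0]; first by rewrite leNgt xu.
  by apply/hp; split=> //; right.
have [|p [ap pb hp]] := cut a b (fun x => box r a x%:E c d) ab.
  move=> x y ax; rewrite -lee_fin => xy yb.
  exact: (box_mono (lexx a) (ltW ax) xy (lt_trans yb bc) (lexx c) (ltW cd) (lexx d)).
have [|q [cq qd hq]] := cut c d (fun y => box r a b c y%:E) cd.
  move=> x y cx; rewrite -lee_fin => xy yd.
  exact: (box_mono (lexx a) (ltW ab) (lexx b) bc (lexx c) (ltW cx) xy).
have pqQ : in_box a b c d (p, q) by apply/and4P.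
have lex (x : R) : (a < x%:E)%E -> (x%:E < b)%E ->
    box r a x%:E c d = if lt_dec_ereal p x%:E then n else 0%N.
  move=> ax xb; rewrite hp //; case: posnP => // x0; exact: zx.
have ley (y : R) : (c < y%:E)%E -> (y%:E < d)%E ->
    box r a b c y%:E = if lt_dec_ereal q y%:E then n else 0%N.
  move=> cy yd; rewrite hq //; case: posnP => // y0; exact: zy.
have lex' (z : \bar R) : (a <= z)%E -> (z <= b)%E ->
    box r a z c d = if lt_dec_ereal p z then n else 0%N.
  rewrite !le_eqVlt => /predU1P[<- _|az /predU1P[->|zb]].
  - rewrite /box !subnn; case: ifP => // pa.
    by have := lt_dec_trans ap pa; rewrite ltxx.
  - by rewrite pb En.
  case: z az zb => [z| |] az zb; [exact: lex|by rewrite ltNge leey in zb|].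
  by rewrite ltNge leNye in az.
have ley' (z : \bar R) : (c <= z)%E -> (z <= d)%E ->
    box r a b c z = if lt_dec_ereal q z then n else 0%N.
  rewrite !le_eqVlt => /predU1P[<- _|cz /predU1P[->|zd]].
  - have := boxE (ltW ab) bc (lexx c).
    case: ifP => [qc|_]; first by have := lt_dec_trans cq qc; rewrite ltxx.
    lia.
  - by rewrite qd En.
  case: z cz zd => [z| |] cz zd; [exact: ley|by rewrite ltNge leey in zd|].
  by rewrite ltNge leNye in cz.
(* A box realising the multiplicity is intersected with the given box. The intersection still
   contains [(p, q)], so the cuts force its measure to be [n]. *)
have mpq : multiplicity (p, q) = n.
  apply/eqP; rewrite eqn_leq le_m //=.
  have [[a' [b' [c' [d' [ab' bc' cd' Q' ->]]]]] _] :=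
    multiplicityP (in_box_lt pqQ bc).
  have [/= a'p pb' c'q qd'] := and4P Q'.
  pose a2 := Order.max a a'; pose b2 := Order.min b b'.
  pose c2 := Order.max c c'; pose d2 := Order.min d d'.
  have aa2 : (a <= a2)%E by rewrite le_max lexx.
  have bb2 : (b2 <= b)%E by rewrite ge_min lexx.
  have cc2 : (c <= c2)%E by rewrite le_max lexx.
  have dd2 : (d2 <= d)%E by rewrite ge_min lexx.
  have a2p : lt_ereal_dec a2 p by rewrite /a2; case: leP.
  have pb2 : lt_dec_ereal p b2 by rewrite /b2; case: leP.
  have c2q : lt_ereal_dec c2 q by rewrite /c2; case: leP.
  have qd2 : lt_dec_ereal q d2 by rewrite /d2; case: leP.
  have ab2 := ltW (lt_dec_trans a2p pb2); have cd2 := ltW (lt_dec_trans c2q qd2).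
  have np : lt_dec_ereal p a2 = false.
    by apply/negP => /(lt_dec_trans a2p); rewrite ltxx.
  have nq : lt_dec_ereal q c2 = false.
    by apply/negP => /(lt_dec_trans c2q); rewrite ltxx.
  have sub : (box r a2 b2 c2 d2 <= box r a' b' c' d')%N.
    apply: box_mono => //; first by rewrite le_max lexx orbT.
    - by rewrite ge_min lexx orbT.
    - by rewrite le_max lexx orbT.
    - by rewrite ge_min lexx orbT.
  apply: leq_trans sub; rewrite -/n.
  have e1 := lex' b2 (le_trans aa2 ab2) bb2; rewrite pb2 in e1.
  have e2 := lex' a2 aa2 (le_trans ab2 bb2); rewrite np in e2.
  have e3 := box_splitl aa2 ab2 (le_lt_trans bb2 bc) (ltW cd).
  have e4 := ley' d2 (le_trans cc2 cd2) dd2; rewrite qd2 in e4.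
  have e5 := ley' c2 cc2 (le_trans cd2 dd2); rewrite nq in e5.
  have e6 := box_splitr ab2 (le_lt_trans bb2 bc) (le_trans cc2 cd2) dd2.
  have e7 := box_splitr ab2 (le_lt_trans bb2 bc) cc2 cd2.
  have e8 := box_splitr (ltW ab) bc (le_trans cc2 cd2) dd2.
  have m1 := box_mono aa2 ab2 bb2 bc (lexx c) cc2 (lexx c2).
  have bd2 := lt_le_trans bc (le_trans cc2 cd2).
  have m2 := box_mono aa2 ab2 bb2 bd2 (lexx d2) dd2 (lexx d).
  clear - En e1 e2 e3 e4 e5 e6 e7 e8 m1 m2; clearbody a2 b2 c2 d2; lia.
exists [seq ((p, q), i) | i <- iota 0 n]; split.
- by rewrite map_inj_uniq ?iota_uniq // => i j [].
- by rewrite size_map size_iota.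
(* A line separating [x] from [(p, q)] leaves [x] in a box of measure 0. *)
have others x : in_box a b c d x -> x <> (p, q) -> multiplicity x = 0%N.
  move=> xQ ne; apply/eqP; rewrite -leqn0.
  have mle := (multiplicityP (in_box_lt xQ bc)).2.
  have [ax xb cx xd] := and4P xQ.
  have [x1|x1|x1] := ltgtP x.1 p; last first.
  - case: x ne xQ mle ax xb cx xd x1 => x1 x2 /= ne xQ mle ax xb cx xd e.
    have [x2q|x2q|e2] := ltgtP x2 q; last by rewrite e e2 in ne.
    + have [y [xy yq]] := dec_separation x2q.
      have cy := lt_dec_trans cx xy; have yd := lt_dec_trans yq qd.
      apply: leq_trans (mle a b c y%:E ab bc cy _) _; first by rewrite /in_box ax xb cx xy.
      by rewrite ley // lt_dec_erealN yq.
    + have [y [qy yx]] := dec_separation x2q.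
      have cy := lt_dec_trans cq qy; have yd := lt_dec_trans yx xd.
      apply: leq_trans (mle a b y%:E d ab (lt_trans bc cy) yd _) _.
        by rewrite /in_box ax xb yx xd.
      have := splity y cy yd; rewrite ley // qy => /eqP.
      by rewrite -[X in X == _]addn0 eqn_add2l eq_sym leqn0.
  - have [y [py yx]] := dec_separation x1.
    have ay := lt_dec_trans ap py; have yb := lt_dec_trans yx xb.
    apply: leq_trans (mle y%:E b c d yb bc cd _) _; first by rewrite /in_box yx xb cx xd.
    have := splitx y ay yb; rewrite lex // py => /eqP.
    by rewrite -[X in X == _]addn0 eqn_add2l eq_sym leqn0.
  have [y [xy yp]] := dec_separation x1.
  have ay := lt_dec_trans ax xy; have yb := lt_dec_trans yp pb.
  apply: leq_trans (mle a y%:E c d ay (lt_trans yb bc) cd _) _.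
    by rewrite /in_box ax xy cx xd.
  by rewrite lex // lt_dec_erealN yp.
move=> [x i]; split=> [[/= ix xQ]|/mapP[j + [-> ->]]].
  have [e|ne] := pselect (x = (p, q)); last first.
    by move: ix; rewrite /copies /= others.
  move: ix; rewrite /copies /= e mpq => ix; apply/mapP; exists i => //.
  by rewrite mem_iota.
by rewrite mem_iota /= => jn; split=> //; rewrite /copies /= mpq.
Qed.

End Box.

Lemma diagram_exists r : rank_function r -> exists m, is_diagram r m.
Proof. by move=> rP; exists (multiplicity r); apply: multiplicity_diagram. Qed.

End Diagrams.

(** * Rank functions of modules and of interleaving morphisms *)

Section RankFunctions.
Variable k : fieldType.

Lemma rank_ext (X Y : lmodType k) (f g : X -> Y) : f =1 g -> rank f = rank g.
Proof. by move=> /funext ->. Qed.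

Lemma rank0 (X Y : lmodType k) (f : {linear X -> Y}) : (forall x, f x = 0) ->
  rank f = 0%N.
Proof.
move=> f0; apply: hasdim_rank; exists [::]; split=> //.
apply/seteqP; split=> [_ [x _ <-]|_ ->]; first exact: f0.
by exists 0.
Qed.

Lemma frobenius (X Y Z W : lmodType k) (f : {linear X -> Y}) (g : {linear Y -> Z})
    (h : {linear Z -> W}) (p : X -> Z) (q : Y -> W) (s : X -> W) :
  finite_rank g -> (forall x, p x = g (f x)) -> (forall y, q y = h (g y)) ->
  (forall x, s x = h (g (f x))) -> (rank p + rank q <= rank g + rank s)%N.
Proof.
move=> fg pE qE sE.
rewrite (rank_ext (f := p) (g := g \o f)) // (rank_ext (f := q) (g := h \o g)) //.
rewrite (rank_ext (f := s) (g := h \o g \o f)) //; exact: rank_frobenius.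
Qed.

Variable R : realType.
Implicit Types (U V : pmod k R) (a b c d s t : \bar R) (delta : R).

Lemma prank_function V : qtame V -> rank_function (prank V).
Proof.
move=> qV; split.
- move=> t; rewrite (prankE V (leNye t)); apply: rank0 => x.
  by rewrite (_ : x = 0) ?linear0 //; apply/rowP => -[].
- by move=> s; rewrite (prankE V (leey s)); apply: rank0 => x; apply/rowP => -[].
move=> a b c d ab bc cd.
have hbc := ltW bc; have hac := le_trans ab hbc; have hbd := le_trans hbc cd.
have had := le_trans hac cd.
rewrite (prankE V hac) (prankE V hbd) (prankE V hbc) (prankE V had).
apply: (frobenius (f := pm_map (ext V) ab) (h := pm_map (ext V) cd)).
- exact: ext_finite_rank.
- by move=> x; rewrite (pm_map_comp _ _ hac).
- by move=> x; rewrite (pm_map_comp _ _ hbd).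
by move=> x; rewrite (pm_map_comp _ _ hac) (pm_map_comp _ _ had).
Qed.

Lemma Dgm_diagram V : qtame V -> is_diagram (prank V) (Dgm V).
Proof.
move=> qV.
have eqv m : is_Dgm V m <-> is_diagram (prank V) m.
  split=> -[h1 h2]; split=> //.
    move=> a b c d ab bc cd.
    have := h2 (Rectangle ab (ltW bc) cd) bc; rewrite pmeasureE //= => h.
    exact/(hascard_counting R).
  move=> Q bc; rewrite pmeasureE //; apply/hascard_counting.
  exact: (h2 _ _ _ _ (rect_ab Q) bc (rect_cd Q)).
apply/eqv; rewrite /Dgm; case: xgetP => [m _ //|none].
have [m hm] := diagram_exists (prank_function qV).
by case: (none m); apply/eqv.
Qed.

Section Interleaved.
Variables (delta : R) (U V : pmod k R).
Variables (phi : forall t : R, {linear U t -> V (t + delta)}).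
Variables (psi : forall t : R, {linear V t -> U (t + delta)}).
Hypotheses (delta_ge0 : 0 <= delta) (qU : qtame U).
Hypotheses (phi_nat : shift_morphism phi) (psi_nat : shift_morphism psi).
Hypothesis phiK : forall (t : R) (h : t <= t + delta + delta) (x : U t),
  psi (t + delta) (phi t x) = pm_map U h x.
Hypothesis psiK : forall (t : R) (h : t <= t + delta + delta) (x : V t),
  phi (t + delta) (psi t x) = pm_map V h x.

Definition ext_shift (X Y : pmod k R) (f : forall t : R, {linear X t -> Y (t + delta)})
    (t : \bar R) : {linear ext X t -> ext Y (t + delta%:E)%E} :=
  match t return {linear ext X t -> ext Y (t + delta%:E)%E} with
  | p%:E => f p | +oo%E => \0 | -oo%E => \0
  end.

Lemma ext_shift_nat (X Y : pmod k R) (f : forall t : R, {linear X t -> Y (t + delta)})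
    s t (h : (s <= t)%O) (h' : (s + delta%:E <= t + delta%:E)%O) (x : ext X s) :
  shift_morphism f ->
  ext_shift f t (pm_map (ext X) h x) = pm_map (ext Y) h' (ext_shift f s x).
Proof.
move=> f_nat; case: s t h h' x => [p| |] [q| |] h h' x //=.
- exact: f_nat.
- by rewrite linear0.
Qed.

Lemma ext_shiftK (X Y : pmod k R) (f : forall t : R, {linear X t -> Y (t + delta)})
    (g : forall t : R, {linear Y t -> X (t + delta)}) t
    (h : (t <= t + delta%:E + delta%:E)%O) (x : ext X t) :
  (forall (t : R) (h : t <= t + delta + delta) (x : X t),
      g (t + delta) (f t x) = pm_map X h x) ->
  ext_shift g (t + delta%:E)%E (ext_shift f t x) = pm_map (ext X) h x.
Proof.
by move=> fK; case: t h x => [p| |] h x //=; apply: fK.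
Qed.

Local Arguments pm_map : simpl never.

Definition shift_rank s t : nat :=
  if @idP (s <= t)%O is ReflectT h
  then rank (ext_shift phi t \o pm_map (ext U) h) else 0%N.

Lemma shift_rankE s t (h : (s <= t)%O) :
  shift_rank s t = rank (ext_shift phi t \o pm_map (ext U) h).
Proof.
rewrite /shift_rank; case: {-}_ / idP => [h'|//].
by rewrite (bool_irrelevance h' h).
Qed.

Lemma shift_rank_finite s t (h : (s <= t)%O) : (s < t)%E ->
  finite_rank (ext_shift phi t \o pm_map (ext U) h).
Proof.
move=> st; have := ext_finite_rank h qU st.
exact: (@finite_rank_comp _ _ _ _ _ idfun _ (ext_shift phi t)).
Qed.

Lemma le_shift a b : (a <= b)%O -> (a + delta%:E <= b + delta%:E)%O.
Proof. by move=> ab; apply: leeD2r. Qed.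

Lemma shift_rank_function : rank_function shift_rank.
Proof.
split.
- move=> t; rewrite (shift_rankE (leNye t)); apply: rank0 => x.
  by rewrite (_ : x = 0) ?linear0 //; apply/rowP => -[].
- by move=> s; rewrite (shift_rankE (leey s)); apply: rank0 => x; apply/rowP => -[].
move=> a b c d ab bc cd.
have hbc := ltW bc; have hac := le_trans ab hbc; have hbd := le_trans hbc cd.
have had := le_trans hac cd.
rewrite (shift_rankE hac) (shift_rankE hbd) (shift_rankE hbc) (shift_rankE had).
apply: (frobenius (f := pm_map (ext U) ab) (h := pm_map (ext V) (le_shift cd))).
- exact: shift_rank_finite.
- by move=> x /=; rewrite (pm_map_comp _ _ hac).
- move=> x /=; rewrite -(ext_shift_nat cd) //.
  by rewrite (pm_map_comp _ _ hbd).
move=> x /=; rewrite -(ext_shift_nat cd) // (pm_map_comp _ _ hac).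
by rewrite (pm_map_comp _ _ had).
Qed.

Lemma le_shift2 a : (a <= a + delta%:E)%O.
Proof. by rewrite leeDl // lee_fin. Qed.

(* The image of [phi] has rank function [shift_rank]. The next four lemmas express
   that it is a quotient of [U]... *)
Lemma shift_rank_birth a b c : (a <= b)%E -> (b < c)%E ->
  (shift_rank b c - shift_rank a c <= prank U b c - prank U a c)%N.
Proof.
move=> ab bc; have hbc := ltW bc; have hac := le_trans ab hbc.
suff : (prank U a c + shift_rank b c <= prank U b c + shift_rank a c)%N by lia.
rewrite (prankE U hac) (shift_rankE hbc) (prankE U hbc) (shift_rankE hac).
apply: (frobenius (f := pm_map (ext U) ab) (h := ext_shift phi c)) => //.
- exact: ext_finite_rank.
- by move=> x; rewrite (pm_map_comp _ _ hac).
by move=> x /=; rewrite (pm_map_comp _ _ hac).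
Qed.

(* ... whose kernel dies after [2 delta]... *)
Lemma shift_rank_birth_inv a b c : (a <= b)%E -> (b < c)%E ->
  (prank U b (c + delta%:E + delta%:E) - prank U a (c + delta%:E + delta%:E)
   <= shift_rank b c - shift_rank a c)%N.
Proof.
move=> ab bc; have hbc := ltW bc; have hac := le_trans ab hbc.
have cc := le_trans (le_shift2 c) (le_shift2 _).
have hbc' := le_trans hbc cc; have hac' := le_trans hac cc.
suff : (shift_rank a c + prank U b (c + delta%:E + delta%:E) <=
    shift_rank b c + prank U a (c + delta%:E + delta%:E))%N by lia.
rewrite (prankE U hac') (shift_rankE hbc) (prankE U hbc') (shift_rankE hac).
apply: (frobenius (f := pm_map (ext U) ab) (h := ext_shift psi (c + delta%:E)%E)) => /=.
- exact: shift_rank_finite.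
- by move=> x; rewrite (pm_map_comp _ _ hac).
- by move=> x; rewrite (ext_shiftK cc) // (pm_map_comp _ _ hbc').
by move=> x; rewrite (ext_shiftK cc) // (pm_map_comp _ _ hbc') (pm_map_comp _ _ hac').
Qed.

(* ... and a submodule of the shift of [V]... *)
Lemma shift_rank_death b c d : qtame V -> (b < c)%E -> (c <= d)%E ->
  (shift_rank b c - shift_rank b d <=
   prank V (b + delta%:E) (c + delta%:E) - prank V (b + delta%:E) (d + delta%:E))%N.
Proof.
move=> qV bc cd; have hbc := ltW bc; have hbd := le_trans hbc cd.
suff : (shift_rank b c + prank V (b + delta%:E) (d + delta%:E) <=
  prank V (b + delta%:E) (c + delta%:E) + shift_rank b d)%N by lia.
rewrite (prankE V (le_shift hbd)) (shift_rankE hbc).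
rewrite (prankE V (le_shift hbc)) (shift_rankE hbd).
apply: (frobenius (f := ext_shift phi b) (h := pm_map (ext V) (le_shift cd))) => /=.
- by apply: ext_finite_rank => //; rewrite lteD2rE.
- by move=> x; apply: ext_shift_nat.
- by move=> x; rewrite (pm_map_comp _ _ (le_shift hbd)).
by move=> x; rewrite (pm_map_comp _ _ (le_shift hbd)); apply: ext_shift_nat.
Qed.

(* ... whose cokernel is killed by [2 delta]. *)
Lemma shift_rank_death_inv b c d : (b + delta%:E < c)%E -> (c <= d)%E ->
  (prank V b (c + delta%:E) - prank V b (d + delta%:E) <=
   shift_rank (b + delta%:E) c - shift_rank (b + delta%:E) d)%N.
Proof.
move=> bc cd; have hbc := ltW bc; have hbd := le_trans hbc cd.
have bb := le_trans (le_shift2 b) (le_shift2 _).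
have h1 := le_trans bb (le_shift hbc); have h2 := le_trans bb (le_shift hbd).
suff : (prank V b (c + delta%:E) + shift_rank (b + delta%:E) d <=
  shift_rank (b + delta%:E) c + prank V b (d + delta%:E))%N by lia.
rewrite (prankE V h1) (shift_rankE hbc) (prankE V h2) (shift_rankE hbd).
apply: (frobenius (f := ext_shift psi b) (h := pm_map (ext V) (le_shift cd))) => /=.
- exact: shift_rank_finite.
- move=> x; rewrite (ext_shift_nat hbc (le_shift hbc)) // (ext_shiftK bb) //.
  by rewrite (pm_map_comp _ _ h1).
- by move=> x; rewrite -(ext_shift_nat cd) // (pm_map_comp _ _ hbd).
move=> x; rewrite (ext_shift_nat hbc (le_shift hbc)) // (ext_shiftK bb) //.
by rewrite (pm_map_comp _ _ h1) (pm_map_comp _ _ h2).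
Qed.

End Interleaved.
End RankFunctions.

(** * Stability *)

Section SortedMatching.
Variables (P : choiceType) (C H : Type) (cls : P -> C) (hgt : P -> H) (le : rel H).
Hypotheses (le_tot : total le) (le_tr : transitive le).
Hypothesis le_anti : antisymmetric le.
Hypothesis cls_hgt : forall x y, cls x = cls y -> hgt x = hgt y -> x = y.
Implicit Types (m : multiset P) (c : C) (h : H) (x y : P * nat).

(** One coordinate of a point, [cls], is held fixed and the other, [hgt], is sorted. The roles are
    abstract because births and deaths exchange them. *)
Definition above m c h : set (P * nat) :=
  copies m `&` [set x | cls x.1 = c /\ le h (hgt x.1)].

Definition strictly_above m c h : set (P * nat) :=
  copies m `&` [set x | cls x.1 = c /\ ~~ le (hgt x.1) h].

Definition card (A : set (P * nat)) : nat := xget 0%N [set n | hascard A n].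

Lemma cardP A n : hascard A n -> card A = n.
Proof.
by move=> h; rewrite /card; case: xgetP => [m _ /hascard_inj/(_ h)|/(_ n)].
Qed.

(** The index of [x] when its class is listed from the top, copies of one point being ordered by
    their labels. *)
Definition position m x : nat :=
  (card (strictly_above m (cls x.1) (hgt x.1)) + x.2)%N.

Definition locally_finite m :=
  forall x, copies m x -> exists n, hascard (above m (cls x.1) (hgt x.1)) n.

Lemma le_refl h : le h h.
Proof. by case/orP: (le_tot h h). Qed.

(** The points strictly above [x] and the copies of [x.1] together make up [above]. *)
Lemma position_lt m x n : copies m x -> hascard (above m (cls x.1) (hgt x.1)) n ->
  (position m x < n)%N.
Proof.
move=> mx hn.
have sub : strictly_above m (cls x.1) (hgt x.1) `<=` above m (cls x.1) (hgt x.1).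
  move=> y [my [yc yh]]; split=> //; split=> //.
  by case/orP: (le_tot (hgt x.1) (hgt y.1)) => // e; rewrite e in yh.
have [i _ hi] := hascard_sub sub hn.
have hx : hascard [set y | y.1 = x.1 /\ (y.2 < m x.1)%N] (m x.1).
  exists [seq (x.1, i) | i <- iota 0 (m x.1)]; split.
  - by rewrite map_inj_uniq ?iota_uniq // => ? ? [].
  - by rewrite size_map size_iota.
  move=> [p j]; split=> [[/= -> lt]|/mapP[j' + [-> ->]]].
    by apply: map_f; rewrite mem_iota.
  by rewrite mem_iota.
have := hascardU _ hi hx; rewrite /position (cardP hi).
have -> : strictly_above m (cls x.1) (hgt x.1) `|` [set y | y.1 = x.1 /\ (y.2 < m x.1)%N]
    = above m (cls x.1) (hgt x.1).
  apply/seteqP; split=> [y [/sub //|[e lt]]|y [my [yc yh]]].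
    by split; rewrite /copies /= e //; split=> //; rewrite le_refl.
  have [yx|nyx] := boolP (le (hgt y.1) (hgt x.1)); last by left.
  right; have e : y.1 = x.1 by apply: cls_hgt => //; apply: le_anti; rewrite yx.
  by split=> //; rewrite -e.
move=> /(_ _) h; rewrite (hascard_inj hn (h _)); first by rewrite ltn_add2l.
apply/seteqP; split=> // y [[_ [_ +]] [e _]].
by rewrite e le_refl.
Qed.

Lemma position_inj m x y : locally_finite m -> copies m x -> copies m y ->
  cls x.1 = cls y.1 -> position m x = position m y -> x = y.
Proof.
move=> lf; have key x' y' : copies m x' -> copies m y' -> cls x'.1 = cls y'.1 ->
    position m x' = position m y' -> le (hgt x'.1) (hgt y'.1).
  move=> mx my e pe; apply: contraT => nle.
  have [n hn] := lf x' mx; have [n' hn'] := lf y' my.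
  have sub : strictly_above m (cls y'.1) (hgt y'.1) `<=` above m (cls y'.1) (hgt y'.1).
    move=> z [mz [zc zh]]; split=> //; split=> //.
    by case/orP: (le_tot (hgt y'.1) (hgt z.1)) => // e'; rewrite e' in zh.
  have [i _ hi] := hascard_sub sub hn'.
  have ni : (n <= i)%N.
    apply: hascard_le hn hi => z [mz [zc zh]]; split=> //; split; first by rewrite zc.
    by apply: contra nle => h; apply: le_tr h.
  have := position_lt mx hn; rewrite pe /position (cardP hi).
  by move=> lt; have := leq_trans lt ni; rewrite ltnNge leq_addr.
move=> mx my e pe.
have xy : x.1 = y.1.
  by apply: cls_hgt => //; apply: le_anti; rewrite !key.
move: pe; rewrite /position xy => /addnI.
by case: x xy {mx my e} => ? ? /= ->; case: y => ? ? /= ->.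
Qed.

(** Pigeonhole: positions embed the [n] points above [h] into the first [n] numbers. *)
Lemma position_surj m c h n i : locally_finite m -> hascard (above m c h) n ->
  (i < n)%N -> exists2 x, above m c h x & position m x = i.
Proof.
move=> lf [s [us sn hs]] lt.
have us' : uniq (map (position m) s).
  rewrite map_inj_in_uniq // => x y /hs[mx [xc _]] /hs[my [yc _]].
  by apply: position_inj => //; rewrite xc.
have sub : {subset map (position m) s <= iota 0 n}.
  move=> _ /mapP[x /hs xA ->]; rewrite mem_iota /= add0n.
  have [mx [xc xh]] := xA; have [n' hn'] := lf x mx.
  apply: leq_trans (position_lt mx hn') _.
  apply: (hascard_le _ hn'); last by exists s; split; [exact: us|exact: sn|exact: hs].
  move=> y [my [yc yh]]; split=> //; split; first by rewrite yc.
  exact: le_tr yh.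
have [|_ e] := uniq_min_size us' sub; first by rewrite size_iota size_map sn.
have : i \in map (position m) s by rewrite e mem_iota.
by move=> /mapP[x /hs xA ->]; exists x.
Qed.

(** An inequality between counts becomes a location: the partner of [x] in the same position exists
    and lies above [h]. *)
Lemma position_match m1 m2 x c h n1 n2 : locally_finite m2 -> copies m1 x ->
  hascard (above m1 (cls x.1) (hgt x.1)) n1 -> hascard (above m2 c h) n2 ->
  (n1 <= n2)%N -> exists2 y, above m2 c h y & position m2 y = position m1 x.
Proof.
move=> lf mx h1 h2 le12; apply: (position_surj lf h2).
exact: leq_trans (position_lt mx h1) le12.
Qed.

End SortedMatching.

Section DecoratedShift.
Variable R : realType.
Implicit Types (p q : decorated R) (e : R) (a b : \bar R).

Definition dec_shift e p : decorated R :=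
  match p with BSide b x => BSide b (x + e) | BInfty b => BInfty R b end.

Lemma dec_shiftK e p : dec_shift (- e) (dec_shift e p) = p.
Proof. by case: p => //= b x; rewrite addrK. Qed.

Lemma dec_shiftNK e p : dec_shift e (dec_shift (- e) p) = p.
Proof. by case: p => //= b x; rewrite subrK. Qed.

Lemma dec_shift_inj e : injective (dec_shift e).
Proof. exact: can_inj (dec_shiftK e). Qed.

Lemma undecorate_shift e p : undecorate (dec_shift e p) = (undecorate p + e%:E)%E.
Proof. by case: p => [b x|[]]. Qed.

Lemma lt_dec_ereal_shift e p a :
  lt_dec_ereal (dec_shift e p) (a + e%:E)%E = lt_dec_ereal p a.
Proof.
case: p a => [[] x|[]] [a| |] //; rewrite /lt_dec_ereal /=.
all: by rewrite -?EFinD ?addye ?addNye ?lee_fin ?lte_fin ?lerD2r ?ltrD2r ?leey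
  ?leNye ?ltry ?ltNyr ?leye_eq ?leeNy_eq.
Qed.

Lemma lt_ereal_dec_shift e p a :
  lt_ereal_dec (a + e%:E)%E (dec_shift e p) = lt_ereal_dec a p.
Proof.
case: p a => [[] x|[]] [a| |] //; rewrite /lt_ereal_dec /=.
all: by rewrite -?EFinD ?addye ?addNye ?lee_fin ?lte_fin ?lerD2r ?ltrD2r ?leey
  ?leNye ?ltry ?ltNyr ?leye_eq ?leeNy_eq.
Qed.

Lemma undecorate_le p q : (p <= q)%O -> (undecorate p <= undecorate q)%E.
Proof.
case: p q => [[] x|[]] [[] y|[]] //=; rewrite ?bnd_simp ?lee_fin ?leey ?leNye //.
exact: ltW.
Qed.

End DecoratedShift.

(** * Diagram points with a fixed birth or a fixed death *)

Section Compare.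
Variable R : realType.
Local Notation point := (decorated R * decorated R)%type.
Implicit Types (r : \bar R -> \bar R -> nat) (a b c d : \bar R) (m : multiset point).
Implicit Types (p q t : decorated R) (delta e : R).

(** With births fixed, higher means a later death; with deaths fixed the order is reversed and
    higher means an earlier birth. Either way longer bars come first. *)
Definition birth_above := @above point (decorated R) (decorated R) fst snd <=%O.
Definition death_above := @above point (decorated R) (decorated R) snd fst >=%O.

Lemma box_right r a b c : rank_function r -> box r a b c +oo%E = (r b c - r a c)%N.
Proof. by move=> [_ ry _]; rewrite /box !ry subnn subn0. Qed.

Lemma box_left r b c d : rank_function r -> box r -oo%E b c d = (r b c - r b d)%N.
Proof. by move=> [r0 _ _]; rewrite /box !r0 !subn0. Qed.

(** A box away from the diagonal holds finitely many points, so it can be shrunk until the only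
    births left are equal to [p] and the only deaths left are at least [t]. *)
Lemma birth_limit r m p t : is_diagram r m -> (undecorate p < undecorate t)%E ->
  exists a b c, [/\ lt_ereal_dec a p, lt_dec_ereal p b, lt_ereal_dec c t, (b < c)%E
    & hascard (birth_above m p t) (box r a b c +oo%E)].
Proof.
move=> [_ mP] pt; have [b0 [c0 [bc /= pb ct]]] := @box_around R (p, t) pt.
have [||s [us _ hs]] := mP -oo%E b0%:E c0%:E +oo%E _ bc _; rewrite ?ltNyr ?ltry //.
have [a [_ ap ha]] := dec_lower [seq x.1.1 | x <- s] (lt_ereal_decNy p).
have [b [bb0 pb' hb]] := dec_upper [seq x.1.1 | x <- s] pb.
have [c [cc0 ct' hc]] := dec_lower [seq x.1.2 | x <- s] ct.
have bc' : (b < c)%E by apply: (le_lt_trans bb0); apply: (lt_le_trans _ cc0).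
exists a, b, c; split=> //.
have := mP a b c +oo%E (lt_dec_trans ap pb') bc' (lt_dec_trans ct' (lt_dec_erealy t)).
rewrite (_ : copies m `&` _ = birth_above m p t) //; apply/seteqP; split.
  move=> x [mx /and4P[ax xb cx _]]; split=> //.
  have xs : x \in s.
    apply/hs; split=> //; apply/and4P; split; rewrite ?lt_ereal_decNy ?lt_dec_erealy //.
      exact: lt_dec_ereal_le xb bb0.
    exact: lt_ereal_dec_le cx cc0.
  split; last by apply: hc => //; apply: map_f.
  by apply: le_anti; rewrite ha ?hb //; apply: (map_f (fun x : point * nat => x.1.1)).
move=> x [mx [xp tx]]; split=> //; apply/and4P; rewrite lt_dec_erealy xp.
by split=> //; apply: lt_ereal_dec_trans ct'.
Qed.

Lemma death_limit r m q t : is_diagram r m -> (undecorate t < undecorate q)%E ->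
  exists b c d, [/\ lt_dec_ereal t b, lt_ereal_dec c q, lt_dec_ereal q d, (b < c)%E
    & hascard (death_above m q t) (box r -oo%E b c d)].
Proof.
move=> [_ mP] tq; have [b0 [c0 [bc /= tb cq]]] := @box_around R (t, q) tq.
have [||s [us _ hs]] := mP -oo%E b0%:E c0%:E +oo%E _ bc _; rewrite ?ltNyr ?ltry //.
have [c [cc0 cq' hc]] := dec_lower [seq x.1.2 | x <- s] cq.
have [d [_ qd hd]] := dec_upper [seq x.1.2 | x <- s] (lt_dec_erealy q).
have [b [bb0 tb' hb]] := dec_upper [seq x.1.1 | x <- s] tb.
have bc' : (b < c)%E by apply: (le_lt_trans bb0); apply: (lt_le_trans _ cc0).
exists b, c, d; split=> //.
have := mP -oo%E b c d (lt_dec_trans (lt_ereal_decNy t) tb') bc' (lt_dec_trans cq' qd).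
rewrite (_ : copies m `&` _ = death_above m q t) //; apply/seteqP; split.
  move=> x [mx /and4P[_ xb cx xd]]; split=> //.
  have xs : x \in s.
    apply/hs; split=> //; apply/and4P; split; rewrite ?lt_ereal_decNy ?lt_dec_erealy //.
      exact: lt_dec_ereal_le xb bb0.
    exact: lt_ereal_dec_le cx cc0.
  split; last by apply: hb => //; apply: map_f.
  by apply: le_anti; rewrite hc ?hd //; apply: (map_f (fun x : point * nat => x.1.2)).
move=> x [mx [xq tx]]; split=> //; apply/and4P; rewrite lt_ereal_decNy xq.
by split=> //; apply: lt_dec_ereal_trans tb'.
Qed.

(** The strip is shrunk to fit [m2] exactly; for [m1] it is enough that the shifted strip contains
    the points counted. *)
Lemma birth_compare r1 r2 m1 m2 e p t n1 n2 :
  is_diagram r1 m1 -> is_diagram r2 m2 -> 0 <= e ->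
  (forall a b c, (a < b)%E -> (b < c)%E ->
    (box r1 a b (c + e%:E) +oo <= box r2 a b c +oo)%N) ->
  (undecorate p < undecorate t)%E ->
  hascard (birth_above m1 p (dec_shift e t)) n1 ->
  hascard (birth_above m2 p t) n2 -> (n1 <= n2)%N.
Proof.
move=> [_ d1] d2 e0 le12 pt h1 h2.
have [a [b [c [ap pb ct bc h]]]] := birth_limit d2 pt.
rewrite (hascard_inj h2 h); apply: leq_trans (le12 _ _ _ (lt_dec_trans ap pb) bc).
have ct' : lt_ereal_dec (c + e%:E)%E (dec_shift e t) by rewrite lt_ereal_dec_shift.
have bc' : (b < c + e%:E)%E by apply: lt_le_trans bc _; rewrite leeDl // lee_fin.
apply: hascard_le h1 (d1 _ _ _ _ (lt_dec_trans ap pb) bc'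
  (lt_dec_trans ct' (lt_dec_erealy _))).
move=> x [mx [xp tx]]; split=> //; apply/and4P; rewrite lt_dec_erealy xp.
by split=> //; apply: lt_ereal_dec_trans ct'.
Qed.

(** Births move by [delta] and deaths by [e]: [e = delta] leads from the image to [V], and
    [e = - delta] back. *)
Lemma death_compare r1 r2 m1 m2 delta e q t n1 n2 :
  is_diagram r1 m1 -> is_diagram r2 m2 -> e <= delta ->
  (forall b c d, (b + delta%:E < c + e%:E)%E -> (b < c)%E -> (c < d)%E ->
    (box r1 -oo b c d <= box r2 -oo (b + delta%:E) (c + e%:E) (d + e%:E))%N) ->
  (undecorate (dec_shift delta t) < undecorate (dec_shift e q))%E ->
  hascard (death_above m1 q t) n1 ->
  hascard (death_above m2 (dec_shift e q) (dec_shift delta t)) n2 -> (n1 <= n2)%N.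
Proof.
move=> [_ d1] d2 ed le12 tq h1 h2.
have [b [c [d [tb cq qd bc h]]]] := death_limit d2 tq.
have shK (x : R) (z : \bar R) : (z - x%:E + x%:E = z)%E by rewrite subeK.
rewrite (hascard_inj h2 h).
have tb' : lt_dec_ereal t (b - delta%:E) by rewrite -(lt_dec_ereal_shift delta) shK.
have cq' : lt_ereal_dec (c - e%:E) q by rewrite -(lt_ereal_dec_shift e) shK.
have qd' : lt_dec_ereal q (d - e%:E) by rewrite -(lt_dec_ereal_shift e) shK.
have bc' : (b - delta%:E < c - e%:E)%E.
  apply: lt_le_trans (_ : (c - delta%:E <= _)%E); first by rewrite lteD2rE.
  by apply: leeD2l; rewrite lee_fin lerN2.
have := le12 (b - delta%:E)%E (c - e%:E)%E (d - e%:E)%E.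
rewrite !shK => /(_ bc bc' (lt_dec_trans cq' qd')); apply: leq_trans.
apply: hascard_le h1 (d1 _ _ _ _ (lt_dec_trans (lt_ereal_decNy t) tb') bc'
  (lt_dec_trans cq' qd')).
move=> x [mx [xq tx]]; split=> //; apply/and4P; rewrite lt_ereal_decNy xq.
by split=> //; apply: lt_dec_ereal_trans tb'.
Qed.

Lemma birth_locally_finite r m : is_diagram r m ->
  @locally_finite point (decorated R) (decorated R) fst snd <=%O m.
Proof.
move=> dm x mx; have lt : (undecorate x.1.1 < undecorate x.1.2)%E.
  by apply: dm.1; apply: leq_ltn_trans mx.
by have [a [b [c [_ _ _ _ h]]]] := birth_limit dm lt; exists (box r a b c +oo%E).
Qed.

Lemma death_locally_finite r m : is_diagram r m ->
  @locally_finite point (decorated R) (decorated R) snd fst >=%O m.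
Proof.
move=> dm x mx; have lt : (undecorate x.1.1 < undecorate x.1.2)%E.
  by apply: dm.1; apply: leq_ltn_trans mx.
by have [b [c [d [_ _ _ _ h]]]] := death_limit dm lt; exists (box r -oo%E b c d).
Qed.

(** The absence of subtraction makes infinite coordinates behave without a separate case. *)
Definition near_by delta a b : Prop := (a <= b + delta%:E)%E /\ (b <= a + delta%:E)%E.

Definition short delta (x : point) : Prop :=
  (undecorate x.2 <= undecorate x.1 + delta%:E + delta%:E)%E.

Definition dec_matching delta m1 m2 (N : point * nat -> point * nat -> Prop) : Prop :=
  [/\ partial_bij N,
      forall x z, N x z -> copies m1 x /\ copies m2 z,
      forall x z, N x z -> near_by delta (undecorate x.1.1) (undecorate z.1.1) /\
                           near_by delta (undecorate x.1.2) (undecorate z.1.2),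
      forall x, copies m1 x -> (forall z, ~ N x z) -> short delta x.1
    & forall z, copies m2 z -> (forall x, ~ N x z) -> short delta z.1].

End Compare.

Section Stability.
Variables (k : fieldType) (R : realType) (U V : pmod k R) (delta : R).
Hypotheses (qU : qtame U) (qV : qtame V) (delta_ge0 : 0 <= delta).

(** Every point of the image has a partner on both sides. A point of [U] or [V] is sure to have one
    when it persists longer than [2 delta]: then its displaced copy in the diagram of the image is
    still above the diagonal. *)
Lemma interleaved_matching : interleaved delta U V ->
  exists N, dec_matching delta (Dgm U) (Dgm V) N.
Proof.
move=> [phi [psi [phi_nat psi_nat phiK psiK]]].
set rho := shift_rank phi.
have rhoP : rank_function rho := shift_rank_function qU phi_nat.
have rU := prank_function qU; have rV := prank_function qV.
have [mI dI] := diagram_exists rhoP.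
have dU := Dgm_diagram qU; have dV := Dgm_diagram qV.
set mU := Dgm U in dU *; set mV := Dgm V in dV *.
pose posb := @position (decorated R * decorated R)%type _ _ fst snd <=%O.
pose posd := @position (decorated R * decorated R)%type _ _ snd fst >=%O.
have lefU := birth_locally_finite dU; have lefI := birth_locally_finite dI.
have ledV := death_locally_finite dV; have ledI := death_locally_finite dI.
have inj12 (x y : decorated R * decorated R) : x.1 = y.1 -> x.2 = y.2 -> x = y.
  by case: x y => ? ? [? ?] /= -> ->.
have inj21 (x y : decorated R * decorated R) : x.2 = y.2 -> x.1 = y.1 -> x = y.
  by move=> ? ?; apply: inj12.

have posbI := position_inj (@le_total _ (decorated R)) le_trans le_anti inj12.
have posdI := position_inj (@ge_total _ (decorated R)) ge_trans ge_anti inj21.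
have ltP (m : multiset (decorated R * decorated R)%type) r x : is_diagram r m -> copies m x ->
    (undecorate x.1.1 < undecorate x.1.2)%E.
  by move=> dm mx; apply: dm.1; apply: leq_ltn_trans mx.
have stepIU y : copies mI y -> exists2 x, birth_above mU y.1.1 y.1.2 x & posb mU x = posb mI y.
  move=> my; have lt := ltP _ _ _ dI my.
  have [a [b [c [_ _ _ _ h]]]] := birth_limit dU lt.
  have [n hn] := lefI y my.
  apply: (position_match (@le_total _ (decorated R)) le_trans le_anti inj12 lefU my hn h).
  apply: (birth_compare (e := 0) dI dU _ _ lt _ h) => //.
    move=> a' b' c' ab bc; rewrite adde0 !box_right //.
    by apply: shift_rank_birth => //; apply: ltW.
  by case: (y.1.2) hn => [s x|s]; rewrite /= ?addr0.
have longP x : ~ short delta x -> (undecorate x.1 + delta%:E + delta%:E < undecorate x.2)%E.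
  by move=> /negP; rewrite -ltNge.
have stepUI x : copies mU x -> ~ short delta x.1 -> exists2 y,
    birth_above mI x.1.1 (dec_shift (- (delta + delta)) x.1.2) y & posb mI y = posb mU x.
  move=> mx /longP long.
  have lt : (undecorate x.1.1 < undecorate (dec_shift (- (delta + delta)) x.1.2))%E.
    by rewrite undecorate_shift EFinN lteBrDr // EFinD addeA.
  have [a [b [c [_ _ _ _ h]]]] := birth_limit dI lt.
  have [n hn] := lefU x mx.
  apply: (position_match (@le_total _ (decorated R)) le_trans le_anti inj12 lefI mx hn h).
  apply: (birth_compare (e := delta + delta) dU dI _ _ lt _ h) => //.
  - by rewrite addr_ge0.
  - move=> a' b' c' ab bc; rewrite !box_right // EFinD addeA.
    by apply: shift_rank_birth_inv => //; apply: ltW.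
  by rewrite dec_shiftNK.
have stepIV y : copies mI y -> exists2 z,
    death_above mV (dec_shift delta y.1.2) (dec_shift delta y.1.1) z & posd mV z = posd mI y.
  move=> my; have lt0 := ltP _ _ _ dI my.
  have lt : (undecorate (dec_shift delta y.1.1) < undecorate (dec_shift delta y.1.2))%E.
    by rewrite !undecorate_shift lteD2rE.
  have [b [c [d [_ _ _ _ h]]]] := death_limit dV lt.
  have [n hn] := ledI y my.
  apply: (position_match (@ge_total _ (decorated R)) ge_trans ge_anti inj21 ledV my hn h).
  apply: (death_compare (delta := delta) (e := delta) dI dV _ _ lt hn h) => //.
  move=> b' c' d' _ bc cd; rewrite !box_left //.
  by apply: shift_rank_death => //; apply: ltW.
have stepVI z : copies mV z -> ~ short delta z.1 -> exists2 y,
    death_above mI (dec_shift (- delta) z.1.2) (dec_shift delta z.1.1) y & posd mI y = posd mV z.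
  move=> mz /longP long.
  have lt : (undecorate (dec_shift delta z.1.1) < undecorate (dec_shift (- delta) z.1.2))%E.
    by rewrite !undecorate_shift EFinN lteBrDr.
  have [b [c [d [_ _ _ _ h]]]] := death_limit dI lt.
  have [n hn] := ledV z mz.
  apply: (position_match (@ge_total _ (decorated R)) ge_trans ge_anti inj21 ledI mz hn h).
  apply: (death_compare (delta := delta) (e := - delta) dV dI _ _ lt hn h) => //.
    by rewrite ge0_cp.
  move=> b' c' d' bc _ cd; rewrite !box_left //.
  have := shift_rank_death_inv delta_ge0 qU phi_nat psiK bc.
  have shK (t : \bar R) : (t + (- delta)%:E + delta%:E = t)%E by rewrite EFinN subeK.
  move=> /(_ (d' + (- delta)%:E)%E); rewrite !shK; apply.
  by rewrite leeD2rE // ltW.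
pose linked_b (x y : decorated R * decorated R * nat) :=
  [/\ copies mU x, copies mI y, x.1.1 = y.1.1 & posb mU x = posb mI y].
pose linked_d (y z : decorated R * decorated R * nat) :=
  [/\ copies mI y, copies mV z, z.1.2 = dec_shift delta y.1.2 & posd mI y = posd mV z].
have bij_b : partial_bij linked_b.
  split=> [x y y' [mx my e pe] [_ my' e' pe']|x x' y [mx my e pe] [mx' _ e' pe']].
    by apply: (posbI mI) => //; [rewrite -e|rewrite -[LHS]pe].
  by apply: (posbI mU) => //; [rewrite e|rewrite [LHS]pe].
have bij_d : partial_bij linked_d.
  split=> [x y y' [mx my e pe] [_ my' e' pe']|x x' y [mx my e pe] [mx' _ e' pe']].
    by apply: (posdI mV) => //; [rewrite e|rewrite -[LHS]pe].
  apply: (posdI mI) => //; last by rewrite [LHS]pe.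
  by apply: (@dec_shift_inj _ delta); rewrite -e.
have link_b y : copies mI y -> exists2 x, linked_b x y & (y.1.2 <= x.1.2)%O.
  by move=> my; have [x [mx [xy yx]] pxy] := stepIU y my; exists x.
have link_d y : copies mI y -> exists2 z, linked_d y z & (z.1.1 <= dec_shift delta y.1.1)%O.
  by move=> my; have [z [mz [zy yz]] pzy] := stepIV y my; exists z.
have link_b_long x : copies mU x -> ~ short delta x.1 ->
    exists2 y, linked_b x y & (dec_shift (- (delta + delta)) x.1.2 <= y.1.2)%O.
  by move=> mx lx; have [y [my [xy yx]] pxy] := stepUI x mx lx; exists y.
have link_d_long z : copies mV z -> ~ short delta z.1 ->
    exists2 y, linked_d y z & (y.1.1 <= dec_shift delta z.1.1)%O.
  move=> mz lz; have [y [my [yz zy]] pyz] := stepVI z mz lz; exists y => //.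
  by split=> //; rewrite yz dec_shiftNK.
exists (fun x z => exists2 y, linked_b x y & linked_d y z); split.
- exact: partial_bij_comp.
- by move=> x z [y [? _ _ _] [_ ? _ _]].
- move=> x z [y lb ld]; have [mx my exy _] := lb; have [_ mz ezy _] := ld.
  have [x' lb' yx] := link_b y my; have e := bij_b.2 _ _ _ lb lb'; subst x'.
  have [z' ld' zy] := link_d y my; have e := bij_d.1 _ _ _ ld ld'; subst z'.
  have := undecorate_le yx; have := undecorate_le zy; rewrite exy ezy !undecorate_shift.
  have := ltP _ _ _ dI my.
  (* For a short [x] the bound on the right follows as well, because [x] and [y] have the same birth
     and [y] dies after it; similarly for [z]. The final case analysis uses this. *)
  have : short delta x.1 \/ (undecorate x.1.2 <= undecorate y.1.2 + delta%:E + delta%:E)%E.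
    have [?|lx] := pselect (short delta x.1); [by left|right].
    have [y' lb2 h] := link_b_long x mx lx; have e := bij_b.1 _ _ _ lb lb2; subst y'.
    by move: (undecorate_le h); rewrite undecorate_shift EFinN leeBlDr // EFinD addeA.
  have : short delta z.1 \/ (undecorate y.1.1 <= undecorate z.1.1 + delta%:E)%E.
    have [?|lz] := pselect (short delta z.1); [by left|right].
    have [y' ld2 h] := link_d_long z mz lz; have e := bij_d.2 _ _ _ ld ld2; subst y'.
    by move: (undecorate_le h); rewrite undecorate_shift.
  rewrite /short /near_by exy ezy undecorate_shift.
  move: (undecorate y.1.1) (undecorate y.1.2) (undecorate x.1.2) (undecorate z.1.1).
  clear - delta_ge0.
  move=> [p| |] [q| |] [xq| |] [zp| |]; rewrite -?EFinD ?addye ?addNye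
    ?lee_fin ?lte_fin ?leey ?leNye ?leye_eq ?leeNy_eq //= =>
    -[h1|h1] [h2|h2] h3 h4 h5 //; split; split; lra.
- move=> x mx nx; apply: contrapT => lx.
  have [y lb _] := link_b_long x mx lx; have [_ my _ _] := lb.
  by have [z ld _] := link_d y my; case: (nx z); exists y.
move=> z mz nz; apply: contrapT => lz.
have [y ld _] := link_d_long z mz lz; have [my _ _ _] := ld.
by have [x lb _] := link_b y my; case: (nz x); exists y.
Qed.

End Stability.

(** * Decorated and undecorated matchings *)

Section Undecorate.
Variable R : realType.
Local Notation point := (decorated R * decorated R)%type.
Implicit Types (m : multiset point) (delta : R).

Lemma coord_dist_near delta (a b : \bar R) : 0 <= delta ->
  (coord_dist a b <= delta%:E)%E <-> near_by delta a b.
Proof.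
move=> d0; rewrite /coord_dist /near_by; case: eqP => [->|ne].
  by split=> _; [rewrite leeDl ?lee_fin|rewrite lee_fin].
case: a b ne => [a| |] [b| |] ne //=;
  rewrite ?addye ?addNye ?leey ?leNye ?leye_eq ?leeNy_eq //.
- rewrite -!EFinD !lee_fin ler_norml; split=> [/andP[]|[]].
    by move=> *; split; lra.
  by move=> *; apply/andP; split; lra.
all: try by split=> // -[].
Qed.

Lemma dDelta_short delta (x : point) : (undecorate x.1 < undecorate x.2)%E ->
  (dDelta (undecorate_point x) <= delta%:E)%E <-> short delta x.
Proof.
rewrite /dDelta /short /undecorate_point /=.
case: (undecorate x.1) (undecorate x.2) => [p| |] [q| |] //= _.
- by rewrite -!EFinD -EFinM !lee_fin; split=> h; lra.
- by rewrite gt0_muley ?lte_fin ?invr_gt0 // -!EFinD !leye_eq.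
- by rewrite addeC /= gt0_muley ?lte_fin ?invr_gt0 // leye_eq leeNy_eq.
- by rewrite /= gt0_muley ?lte_fin ?invr_gt0 // leye_eq.
Qed.

Definition fiber (z : \bar R) : seq (decorated R) :=
  match z with
  | p%:E => [:: BLeft p; BRight p] | +oo%E => [:: +oo%O] | -oo%E => [:: -oo%O]
  end.

Lemma fiberP z p : (p \in fiber z) = (undecorate p == z).
Proof.
case: z p => [z| |] [[] y|[]] //=; rewrite !inE ?eqe //=.
by apply/orP/eqP => [[/eqP[]|/eqP]|->] //; rewrite eqxx; left.
Qed.

(** A point has at most four decorations, so the sum defining [push_multiset] is finite. *)
Lemma push_hascard m (y : \bar R * \bar R) :
  hascard (copies m `&` [set x | undecorate_point x.1 = y])
    (push_multiset (@undecorate_point R) m y).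
Proof.
pose s := [seq (p, q) | p <- fiber y.1, q <- fiber y.2].
have uf (z : \bar R) : uniq (fiber z) by case: z.
have us : uniq s by apply: allpairs_uniq => // -[? ?] [? ?].
have sP x : (x \in s) = (undecorate_point x == y).
  case: x y @s us => [p q] [y1 y2] s us; rewrite [RHS]xpair_eqE -!fiberP.
  by apply/allpairsP/andP => [[[p' q'] /= [hp hq [-> ->]]]|[hp hq]] //; exists (p, q).
rewrite /push_multiset (_ : [set x | undecorate_point x = y] = [set` s]); last first.
  by apply/seteqP; split=> x /=; rewrite sP => /eqP.
rewrite -fsbig_seq // (_ : _ `&` _ = copies m `&` [set x | x.1 \in s]); last first.
  by congr (_ `&` _); apply/seteqP; split=> x /=; rewrite sP => /eqP.
elim: s us {sP} => [_|z s IH /= /andP[zs us]].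
  by rewrite big_nil; apply: hascard0 => x [].
rewrite big_cons.
have hz : hascard [set x : point * nat | x.1 = z /\ (x.2 < m z)%N] (m z).
  exists [seq (z, i) | i <- iota 0 (m z)]; split.
  - by rewrite map_inj_uniq ?iota_uniq // => ? ? [].
  - by rewrite size_map size_iota.
  move=> [p j]; split=> [[/= -> lt]|/mapP[j' + [-> ->]]].
    by apply: map_f; rewrite mem_iota.
  by rewrite mem_iota.
rewrite (_ : _ `&` _ = [set x : point * nat | x.1 = z /\ (x.2 < m z)%N] `|`
  (copies m `&` [set x | x.1 \in s])).
  apply: (hascardU _ hz (IH us)); apply/seteqP; split=> // x [[/= -> _] [_ /=]].
  by rewrite (negPf zs).
apply/seteqP; split=> [x [mx /predU1P[e|xs]]|x [[e lt]|[mx xs]]].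
- by left; split=> //; rewrite -e.
- by right.
- by split; [rewrite /copies /= e|rewrite /= e mem_head].
- by split=> //=; rewrite inE xs orbT.
Qed.

Lemma copies_hascard (T : choiceType) (m : multiset T) (y : T) :
  hascard (copies m `&` [set x | x.1 = y]) (m y).
Proof.
exists [seq (y, i) | i <- iota 0 (m y)]; split.
- by rewrite map_inj_uniq ?iota_uniq // => ? ? [].
- by rewrite size_map size_iota.
move=> [p j]; split=> [[+ /= e]|/mapP[j' + [-> ->]]].
  by rewrite /copies /= e => lt; apply: map_f; rewrite mem_iota.
by rewrite mem_iota.
Qed.

Lemma push_bij m : exists E : (\bar R * \bar R) * nat -> point * nat -> Prop,
  [/\ partial_bij E,
      forall x y, E x y -> [/\ copies (push_multiset (@undecorate_point R) m) x,
         copies m y & x.1 = undecorate_point y.1],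
      forall x, copies (push_multiset (@undecorate_point R) m) x -> exists y, E x y
    & forall y, copies m y -> exists x, E x y].
Proof.
have [|E [E1 E2 E3 E4]] := @hascard_fiber_bij _ _ (\bar R * \bar R)%type
  (copies (push_multiset (@undecorate_point R) m)) (copies m) fst
  (@undecorate_point R \o fst) setT.
  move=> c _; exists (push_multiset (@undecorate_point R) m c).
    exact: copies_hascard.
  exact: push_hascard.
by exists E; split=> // [x mx|y my]; [apply: E3|apply: E4].
Qed.

(** Distances ignore decorations, so matchings are carried along the bijections between decorated
    and undecorated copies. *)
Lemma matching_transfer m1 m2 delta : 0 <= delta ->
  (forall x, (0 < m1 x)%N -> (undecorate x.1 < undecorate x.2)%E) ->
  (forall x, (0 < m2 x)%N -> (undecorate x.1 < undecorate x.2)%E) ->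
  (exists N, dec_matching delta m1 m2 N) <->
  (exists M, is_matching delta (push_multiset (@undecorate_point R) m1)
     (push_multiset (@undecorate_point R) m2) M).
Proof.
move=> d0 lt1 lt2.
have lt1' x : copies m1 x -> (undecorate x.1.1 < undecorate x.1.2)%E.
  by move=> mx; apply: lt1; apply: leq_ltn_trans mx.
have lt2' x : copies m2 x -> (undecorate x.1.1 < undecorate x.1.2)%E.
  by move=> mx; apply: lt2; apply: leq_ltn_trans mx.
have [E [E1 E2 E3 E4]] := push_bij m1; have [F [F1 F2 F3 F4]] := push_bij m2.
split=> [[N [N1 N2 N3 N4 N5]]|[M [M1 [M2 M2'] M3 M4 M5]]].
  exists [set xz | exists2 x, E xz.1 x & exists2 z, N x z & F xz.2 z].
  have [B1 B2] : partial_bij (fun x z => exists2 x', E x x' & exists2 z', N x' z' & F z z').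
    exact: (partial_bij_comp E1 (partial_bij_comp N1 (partial_bij_sym F1))).
  split=> //.
  - by move=> [x z] [x' /= /E2[mx _ _] [z' _ /F2[mz _ _]]].
  - move=> x z [x' /= ex [z' nxz fz]].
    have [_ _ ->] := E2 _ _ ex; have [_ _ ->] := F2 _ _ fz.
    have [n1 n2] := N3 _ _ nxz.
    by rewrite /dinfty ge_max; apply/andP; split; apply/coord_dist_near.
  - move=> x mx nx; have [x' ex] := E3 x mx; have [_ mx' ->] := E2 _ _ ex.
    apply/dDelta_short; first exact: lt1'.
    apply: N4 => // z' nxz; have [_ mz'] := N2 _ _ nxz.
    by have [z fz] := F4 z' mz'; apply: (nx z); exists x' => //; exists z'.
  - move=> z mz nz; have [z' fz] := F3 z mz; have [_ mz' ->] := F2 _ _ fz.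
    apply/dDelta_short; first exact: lt2'.
    apply: N5 => // x' nxz; have [mx' _] := N2 _ _ nxz.
    by have [x ex] := E4 x' mx'; apply: (nz x); exists x' => //; exists z'.
exists (fun x' z' => exists2 x, E x x' & exists2 z, M (x, z) & F z z'); split.
- apply: partial_bij_comp (partial_bij_sym E1) _.
  exact: (@partial_bij_comp _ _ _ (fun x z => M (x, z)) F).
- by move=> x' z' [x /E2[_ mx _] [z _ /F2[_ mz _]]].
- move=> x' z' [x /E2[_ _ ex] [z xz /F2[_ _ fz]]].
  have := M3 _ _ xz; rewrite ex fz /dinfty ge_max => /andP[].
  by move=> /coord_dist_near h /coord_dist_near h'; split; [exact: h|exact: h'].
- move=> x' mx nx; have [x exx] := E4 x' mx; have [mx' _ ex] := E2 _ _ exx.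
  apply/dDelta_short; first exact: lt1'.
  rewrite -ex; apply: M4 => // z xz; have [_ mz] := M1 _ xz.
  by have [z' fz] := F3 z mz; apply: (nx z'); exists x => //; exists z.
- move=> z' mz nz; have [z fzz] := F4 z' mz; have [mz' _ fz] := F2 _ _ fzz.
  apply/dDelta_short; first exact: lt2'.
  rewrite -fz; apply: M5 => // x xz; have [mx _] := M1 _ xz.
  by have [x' ex] := E3 x mx; apply: (nz x'); exists x => //; exists z.
Qed.

End Undecorate.

(** * Converse stability *)

Section IntervalFamilies.
Variables (X Y : choiceType) (A : set X) (B : set Y).
Variables (J : X -> set int) (K : Y -> set int).

Definition order_convex (I : set int) : Prop :=
  forall a b c, a <= b -> b <= c -> I a -> I c -> I b.

Hypotheses (Jconv : forall x, A x -> order_convex (J x)).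
Hypotheses (Kconv : forall y, B y -> order_convex (K y)).
Hypothesis count : forall b c, b < c -> exists2 n,
  hascard (A `&` [set x | J x b /\ J x c]) n & hascard (B `&` [set y | K y b /\ K y c]) n.

(** A convex set contains finitely many integers as soon as it contains the least and the greatest
    of them. *)
Lemma convex_hull (b c : int) (pos : seq int) : b < c -> exists b' c' : int, b' < c' /\
  forall I, order_convex I ->
    (I b' /\ I c') <-> (I b /\ I c /\ forall n, n \in pos -> I n).
Proof.
move=> bc; elim: pos => [|p pos [b' [c' [bc' h]]]].
  by exists b, c; split=> // I _; split=> [[? ?]|[? []]] //; split.
exists (Num.min b' p), (Num.max c' p); split; first by lia.
move=> I cI; split=> [[Ib Ic]|[Ib [Ic Ipos]]].
  have in_hull n : Num.min b' p <= n -> n <= Num.max c' p -> I n.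
    by move=> h1 h2; apply: cI h1 h2 Ib Ic.
  have [|Ib1 [Ic1 Ipos]] := (h I cI).1; first by split; apply: in_hull; lia.
  by split=> //; split=> // n /predU1P[->|/Ipos //]; apply: in_hull; lia.
have [|Ib' Ic'] := (h I cI).2.
  by split=> //; split=> // n np; apply: Ipos; rewrite inE np orbT.
have Ip : I p by apply: Ipos; rewrite mem_head.
by split; [case: leP|case: leP].
Qed.

(** Positive tests are absorbed by the hull. A negative test is removed by subtracting the count in
    which it is positive. *)
Lemma count_tests (b c : int) (pos neg : seq int) : b < c -> exists2 n,
  hascard (A `&` [set x | [/\ J x b /\ J x c, forall n, n \in pos -> J x n
    & forall n, n \in neg -> ~ J x n]]) n &
  hascard (B `&` [set x | [/\ K x b /\ K x c, forall n, n \in pos -> K x n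
    & forall n, n \in neg -> ~ K x n]]) n.
Proof.
move=> bc; elim: neg pos => [|q neg IH] pos.
  have [b' [c' [bc' h]]] := convex_hull pos bc.
  have [n hA hB] := count bc'; exists n.
    rewrite (_ : _ `&` _ = A `&` [set x | J x b' /\ J x c']) //.
    apply/seteqP; split=> x [Ax].
      by move=> [[? ?] ? _]; split=> //; apply/(h _ (Jconv Ax)).
    by move=> /(h _ (Jconv Ax))[? [? ?]].
  rewrite (_ : _ `&` _ = B `&` [set x | K x b' /\ K x c']) //.
  apply/seteqP; split=> x [Bx].
    by move=> [[? ?] ? _]; split=> //; apply/(h _ (Kconv Bx)).
  by move=> /(h _ (Kconv Bx))[? [? ?]].
have [n hA hB] := IH pos; have [m hA' hB'] := IH (q :: pos).
have split_neg (T : choiceType) (C : set T) (L : T -> set int) :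
    hascard (C `&` [set x | [/\ L x b /\ L x c, forall n, n \in pos -> L x n
      & forall n, n \in neg -> ~ L x n]]) n ->
    hascard (C `&` [set x | [/\ L x b /\ L x c, forall n, n \in q :: pos -> L x n
      & forall n, n \in neg -> ~ L x n]]) m ->
    hascard (C `&` [set x | [/\ L x b /\ L x c, forall n, n \in pos -> L x n
      & forall n, n \in q :: neg -> ~ L x n]]) (n - m).
  move=> h h'.
  rewrite (_ : C `&` _ = (C `&` [set x | [/\ L x b /\ L x c, forall n, n \in pos -> L x n
      & forall n, n \in neg -> ~ L x n]]) `&` ~` [set x | L x q]).
    apply: hascardD => //; rewrite (_ : _ `&` _ = C `&` [set x | [/\ L x b /\ L x c,
      forall n, n \in q :: pos -> L x n & forall n, n \in neg -> ~ L x n]]) //.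
    apply/seteqP; split=> x.
      by move=> [[Cx [? hp ?]] /= Lq]; split=> //; split=> // l /predU1P[->|/hp].
    move=> [Cx [? hp ?]]; split; last by apply: hp; rewrite mem_head.
    by split=> //; split=> // l lp; apply: hp; rewrite inE lp orbT.
  apply/seteqP; split=> x.
    move=> [Cx [? ? hn]]; split; last by apply: hn; rewrite mem_head.
    by split=> //; split=> // l ln; apply: hn; rewrite inE ln orbT.
  by move=> [[Cx [? ? hn]] /= nLq]; split=> //; split=> // l /predU1P[->|/hn].
by exists (n - m)%N; apply: split_neg.
Qed.

(** One integer for each member of [s] whose set differs from [I]. *)
Lemma distinguishing_tests (T : choiceType) (L : T -> set int) (I : set int) (s : seq T) :
  exists tests : seq int, forall x, x \in s ->
    (forall n, n \in tests -> L x n <-> I n) -> L x = I.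
Proof.
elim: s => [|x s [ts h]]; first by exists [::].
have [e|ne] := pselect (L x = I).
  by exists ts => y /predU1P[->|/h].
have [n hn] : exists n, ~ (L x n <-> I n).
  apply: contrapT => none; apply: ne; apply/seteqP.
  by split=> n; have [] : L x n <-> I n by apply: contrapT => hn; apply: none; exists n.
exists (n :: ts) => y /predU1P[->|ys] hy.
  by case: hn; apply: hy; rewrite mem_head.
by apply: h => // l lt; apply: hy; rewrite inE lt orbT.
Qed.

(* The sets [[set I | I b /\ I c]] form a pi-system, so counts that agree on
   it agree on every fibre. *)
Lemma fiber_count (I : set int) (b c : int) : b < c -> I b -> I c -> exists2 n,
  hascard (A `&` [set x | J x = I]) n & hascard (B `&` [set y | K y = I]) n.
Proof.
move=> bc Ib Ic.
(* Only finitely many members of either family contain [b] and [c], so finitely many tests single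
   out those equal to [I]. *)
have [_ [s [_ _ hs]] [t [_ _ ht]]] := count bc.
have [ts1 h1] := distinguishing_tests J I s.
have [ts2 h2] := distinguishing_tests K I t.
pose ts := ts1 ++ ts2.
pose pos := [seq n <- ts | `[< I n >]]; pose neg := [seq n <- ts | `[< ~ I n >]].
have tsP (L : set int) : (forall n, n \in pos -> L n) -> (forall n, n \in neg -> ~ L n) ->
    forall n, n \in ts -> L n <-> I n.
  move=> hp hn n nt; split=> [Ln|In]; last first.
    by apply: hp; rewrite mem_filter nt andbT; apply/asboolP.
  apply: contrapT => nI; apply: (hn n) => //; rewrite mem_filter nt andbT.
  exact/asboolP.
have posI n : n \in pos -> I n by rewrite mem_filter => /andP[/asboolP].
have negI n : n \in neg -> ~ I n by rewrite mem_filter => /andP[/asboolP].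
have [n hA hB] := count_tests pos neg bc; exists n.
  rewrite (_ : _ `&` _ = A `&` [set x | [/\ J x b /\ J x c,
    forall n, n \in pos -> J x n & forall n, n \in neg -> ~ J x n]]) //.
  apply/seteqP; split=> x [Ax /=]; first by move=> ->.
  move=> [Jbc hp hn]; split=> //; apply: h1; first exact/hs.
  by move=> l lt; apply: tsP; rewrite ?mem_cat ?lt.
rewrite (_ : _ `&` _ = B `&` [set x | [/\ K x b /\ K x c,
  forall n, n \in pos -> K x n & forall n, n \in neg -> ~ K x n]]) //.
apply/seteqP; split=> x [Bx /=]; first by move=> ->.
move=> [Kbc hp hn]; split=> //; apply: h2; first exact/ht.
by move=> l lt; apply: tsP; rewrite ?mem_cat ?lt ?orbT.
Qed.

End IntervalFamilies.

(** * Morphisms induced by matchings of bars *)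

Section BarcodeMorphisms.
Variable k : fieldType.

Lemma eq_on_span (X Y : lmodType k) (I : choiceType) (P : set I) (e : I -> X)
    (f g : {linear X -> Y}) (x : X) :
  (forall i, P i -> f (e i) = g (e i)) -> spanf P e x -> f x = g x.
Proof.
move=> fg [l lP ->]; rewrite /lcomb !linear_sum !big_seq.
by apply: eq_bigr => p /lP /fg; rewrite !linearZ => ->.
Qed.

Section Morphism.
Variables (X Y : pmod k int) (I I' : choiceType) (S : set I) (S' : set I').
Variables (e : I -> forall n, X n) (e' : I' -> forall n, Y n) (N : nat).
Variable G : I -> I' -> Prop.
Hypotheses (bX : barcode S e) (bY : barcode S' e').
Hypothesis G_bij : partial_bij G.
Hypothesis GS : forall s s', G s s' -> S s /\ S' s'.
(** The condition for a natural map between interval modules: the shifted target bar neither starts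
    nor ends later than the source bar. *)
Hypothesis G_compat : forall s s' n m, G s s' -> n <= m -> e s n != 0 ->
  e' s' (m + N%:Z) != 0 -> e s m != 0 /\ e' s' (n + N%:Z) != 0.

Lemma barcode_morphism :
  exists Phi : forall n, {linear X n -> Y (n + N%:Z)},
  [/\ forall n m (h : n <= m) (h' : n + N%:Z <= m + N%:Z) x,
        Phi m (pm_map X h x) = pm_map Y h' (Phi n x),
      forall s s' n, G s s' -> e s n != 0 -> Phi n (e s n) = e' s' (n + N%:Z)
    & forall s n, S s -> (forall s', ~ G s s') -> e s n != 0 -> Phi n (e s n) = 0].
Proof.
have [natX _ indX genX] := bX; have [natY _ _ _] := bY.
have /choice[g hg] s : exists g : forall n, Y n,
    (forall s', G s s' -> g = e' s') /\ ((forall s', ~ G s s') -> g = fun=> 0).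
  have [[s' Gs]|none] := pselect (exists s', G s s').
    exists (e' s'); split=> [s'' Gs'|/(_ s') //].
    by rewrite (G_bij.1 _ _ _ Gs Gs').
  by exists (fun=> 0); split=> // s' Gs; case: none; exists s'.
have ex n : {f : {linear X n -> Y (n + N%:Z)} |
    forall s, (S `&` [set s | e s n != 0]) s -> f (e s n) = g s (n + N%:Z)}.
  by apply: cid; exact: (linear_extension (fun s => g s (n + N%:Z)) (indX n) (genX n)).
exists (fun n => sval (ex n)); split; last 2 first.
- move=> s s' n Gs sn; have [Ss _] := GS Gs.
  by rewrite (svalP (ex n)) // ((hg s).1 s' Gs).
- by move=> s n Ss none sn; rewrite (svalP (ex n)) // (hg s).2.
move=> n m h h' x.
apply: (@eq_on_span _ _ _ _ _ (sval (ex m) \o pm_map X h)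
  (pm_map Y h' \o sval (ex n)) _ _ (genX n x)).
move=> s [Ss sn] /=; rewrite (natX s n m h Ss sn) (svalP (ex n)) //.
have [[s' Gs]|none] := pselect (exists s', G s s'); last first.
  have g0 : g s = fun=> 0 by apply: (hg s).2 => s' Gs; apply: none; exists s'.
  rewrite g0 linear0; have [->|sm] := eqVneq (e s m) 0; first exact: linear0.
  by rewrite (svalP (ex m)) // g0.
have [_ Ss'] := GS Gs; rewrite ((hg s).1 s' Gs).
have -> : sval (ex m) (e s m) = if e s m != 0 then e' s' (m + N%:Z) else 0.
  have [->|sm] := eqVneq (e s m) 0; first exact: linear0.
  by rewrite (svalP (ex m)) // ((hg s).1 s' Gs).
have [s'm|s'm] := eqVneq (e' s' (m + N%:Z)) 0.
  rewrite s'm if_same; have [->|s'n] := eqVneq (e' s' (n + N%:Z)) 0.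
    by rewrite linear0.
  by rewrite natY.
have [-> s'n] := G_compat Gs h sn s'm.
by rewrite natY.
Qed.

End Morphism.

(** On a matched bar the composite can fail only if the partner is dead halfway, and then the bar
    itself is dead at the end; unmatched bars die on the way. *)
Lemma barcode_interleaving (X Y : pmod k int) (I I' : choiceType) (S : set I)
    (S' : set I') (e : I -> forall n, X n) (e' : I' -> forall n, Y n) (N : nat)
    (G : I -> I' -> Prop) (Phi : forall n, {linear X n -> Y (n + N%:Z)})
    (Psi : forall n, {linear Y n -> X (n + N%:Z)}) :
  barcode S e -> barcode S' e' ->
  (forall s s', G s s' -> S s /\ S' s') ->
  (forall s s' n, G s s' -> e s n != 0 -> Phi n (e s n) = e' s' (n + N%:Z)) ->
  (forall s n, S s -> (forall s', ~ G s s') -> e s n != 0 -> Phi n (e s n) = 0) ->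
  (forall s s' n, G s s' -> e' s' n != 0 -> Psi n (e' s' n) = e s (n + N%:Z)) ->
  (forall s s' n, G s s' -> e s n != 0 -> e s (n + N%:Z + N%:Z) != 0 ->
     e' s' (n + N%:Z) != 0) ->
  (forall s n, S s -> (forall s', ~ G s s') -> e s n != 0 ->
     e s (n + N%:Z + N%:Z) = 0) ->
  forall n (h : n <= n + N%:Z + N%:Z) x, Psi (n + N%:Z) (Phi n x) = pm_map X h x.
Proof.
move=> [natX _ _ genX] _ GS PhiG Phi0 PsiG mid unmatched n h x.
apply: (@eq_on_span _ _ _ _ _ (Psi (n + N%:Z) \o Phi n) (pm_map X h) _ _ (genX n x)).
move=> s [Ss sn] /=; rewrite (natX s _ _ h Ss sn).
have [[s' Gs]|none] := pselect (exists s', G s s'); last first.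
  have none' s' : ~ G s s' by move=> Gs; apply: none; exists s'.
  by rewrite Phi0 // unmatched // linear0.
rewrite (PhiG s s') //.
have [s'n|s'n] := eqVneq (e' s' (n + N%:Z)) 0; last exact: PsiG.
rewrite s'n linear0; apply/esym/eqP; apply: contraT => sN.
by have := mid s s' n Gs sn sN; rewrite s'n eqxx.
Qed.

End BarcodeMorphisms.

(** * Restriction to a grid *)

Section Grid.
Variables (k : fieldType) (R : realType) (eps : R).
Hypothesis eps_gt0 : 0 < eps.
Local Notation point := (decorated R * decorated R)%type.
Implicit Types (U V : pmod k R).

Definition grid (n : int) : \bar R := (eps * n%:~R)%:E.

Lemma grid_homo : {homo grid : n m / n <= m >-> (n <= m)%O}.
Proof. by move=> n m nm; rewrite lee_fin ler_wpM2l ?ler_int // ltW. Qed.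

Lemma grid_lt n m : n < m -> (grid n < grid m)%E.
Proof. by move=> nm; rewrite lte_fin ltr_pM2l ?ltr_int. Qed.

Definition restriction V : pmod k int := pullback grid_homo (ext V).

Lemma restriction_finite V n m (h : n <= m) : qtame V -> n < m ->
  finite_rank (pm_map (restriction V) h).
Proof. by move=> qV nm; apply: (ext_finite_rank (grid_homo h) qV (grid_lt nm)). Qed.

(** Images from earlier times are nested; once their dimension is minimal they are equal. *)
Lemma restriction_stable V : qtame V -> images_stabilize (restriction V).
Proof.
move=> qV t; set W := restriction V.
(* Starting one step below [t] keeps the maps strict, hence of finite rank. *)
have lt (n : nat) : t - n.+1%:Z <= t by lia.
pose d (n : nat) := rank (pm_map W (lt n)).
have [N hN] : exists N, forall n, (d N <= d n)%N.
  have ex : exists m, `[< exists n, d n = m >] by exists (d 0%N); apply/asboolP; exists 0%N.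
  case: (ex_minnP ex) => m /asboolP[N dN] min; exists N => n; rewrite dN.
  by apply: min; apply/asboolP; exists n.
exists (t - N.+1%:Z) => // i hi hN' iN.
have [n en] : exists n : nat, i = t - n.+1%:Z.
  by exists `|t - i|%N.-1; lia.
subst i; rewrite (bool_irrelevance hi (lt n)) (bool_irrelevance hN' (lt N)).
have fr (l : nat) : hasdim (range (pm_map W (lt l))) (d l).
  by apply/finite_rankP; apply: restriction_finite => //; lia.
have sub : range (pm_map W (lt n)) `<=` range (pm_map W (lt N)).
  move=> _ [x _ <-]; exists (pm_map W iN x) => //; exact: pm_map_comp.
have e : d n = d N by apply/eqP; rewrite eqn_leq hN (hasdim_le sub (fr n) (fr N)).
have hn := fr n; rewrite e in hn.
by rewrite (hasdim_eq sub hn (fr N)).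
Qed.

Definition grid_support (P : point) : set int :=
  [set n | lt_dec_ereal P.1 (grid n) /\ lt_ereal_dec (grid n) P.2].

Lemma grid_support_convex P : order_convex (grid_support P).
Proof.
move=> a b c ab bc [Pa _] [_ cP]; split.
  exact: lt_dec_ereal_le Pa (grid_homo ab).
exact: lt_ereal_dec_le cP (grid_homo bc).
Qed.

(** Bars alive at [b] and [c] and diagram points in the quadrant at [(b, c)] are both counted by
    [prank V (grid b) (grid c)]. This needs [b < c], so bars that meet the grid only once are not
    covered. *)
Lemma barcode_points V (I : choiceType) (S : set I)
    (e : I -> forall n, restriction V n) : qtame V -> barcode S e ->
  exists E : I -> point * nat -> Prop,
  [/\ partial_bij E,
      forall s P, E s P ->
        [/\ S s, copies (Dgm V) P & [set n | e s n != 0] = grid_support P.1],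
      forall s n m, S s -> n < m -> e s n != 0 -> e s m != 0 -> exists P, E s P
    & forall P n m, copies (Dgm V) P -> n < m -> grid_support P.1 n ->
        grid_support P.1 m -> exists s, E s P].
Proof.
move=> qV bS; have [nat_e _ _ _] := bS.
have [_ dP] := Dgm_diagram qV; have rP := prank_function qV.
have convS s : S s -> order_convex [set n | e s n != 0].
  move=> Ss a b c ab bc /= ea ec; apply: contra_neq ec => eb.
  by rewrite -(nat_e _ _ _ (le_trans ab bc) Ss ea) -(pm_map_comp ab bc)
    (nat_e _ _ _ ab Ss ea) eb linear0.
have cnt b c : b < c -> exists2 n,
    hascard (S `&` [set s | [set n | e s n != 0] b /\ [set n | e s n != 0] c]) n &
    hascard (copies (Dgm V) `&` [set P | grid_support P.1 b /\ grid_support P.1 c]) n.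
  move=> bc; exists (prank V (grid b) (grid c)).
    rewrite (prankE V (grid_homo (ltW bc))).
    exact: (barcode_rank bS (restriction_finite (ltW bc) qV bc)).
  have := dP -oo%E (grid b) (grid c) +oo%E (ltNyr _) (grid_lt bc) (ltry _).
  rewrite box_right //; have [r0 _ _] := rP; rewrite r0 subn0.
  rewrite (_ : _ `&` _ = copies (Dgm V) `&`
    [set P | grid_support P.1 b /\ grid_support P.1 c]) //.
  congr (_ `&` _); apply/seteqP; split=> -[P i] /=.
    move=> /and4P[_ Pb cP _]; split; split=> //.
      exact: lt_ereal_dec_le cP (grid_homo (ltW bc)).
    exact: lt_dec_ereal_le Pb (grid_homo (ltW bc)).
  move=> [[Pb _] [_ cP]]; apply/and4P.
  by rewrite lt_ereal_decNy lt_dec_erealy.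
have [|E [E1 E2 E3 E4]] := @hascard_fiber_bij _ _ (set int) S (copies (Dgm V))
   (fun s => [set n | e s n != 0]) (fun P => grid_support P.1)
   [set D | exists b c, [/\ b < c, D b & D c]].
  move=> D [b [c [bc Db Dc]]].
  apply: (fiber_count convS _ cnt bc Db Dc) => P _; exact: grid_support_convex.
exists E; split=> //.
  by move=> s n m Ss nm en em; apply: E3 => //; exists n, m.
by move=> P n m mP nm Pn Pm; apply: E4 => //; exists n, m.
Qed.

(** Supplies the compatibility condition of [barcode_morphism]: a shift by [N] grid steps exceeds
    [delta], so it overcomes the displacement of matched endpoints. *)
Lemma matched_support delta (N : nat) (P Q : point) (n m : int) :
  delta < eps * N%:R ->
  near_by delta (undecorate P.1) (undecorate Q.1) ->
  near_by delta (undecorate P.2) (undecorate Q.2) ->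
  n <= m -> grid_support P n -> grid_support Q (m + N%:Z) ->
  grid_support P m /\ grid_support Q (n + N%:Z).
Proof.
move=> dN [pq1 qp1] [pq2 qp2] nm [Pn _] [_ mQ]; split; split.
- exact: lt_dec_ereal_le Pn (grid_homo nm).
- apply: undecorate_lt_ereal; rewrite -(lteD2rE _ _ (erefl : delta%:E \is a fin_num)).
  apply: lt_le_trans (le_trans (lt_undecorate_dec mQ) qp2).
  by rewrite -EFinD lte_fin rmorphD mulrDr ltrD2l.
- apply: undecorate_lt_dec; apply: (le_lt_trans qp1).
  apply: (@le_lt_trans _ _ (grid n + delta%:E)%E).
    by rewrite leeD2rE //; exact: lt_dec_undecorate.
  by rewrite -EFinD lte_fin rmorphD mulrDr ltrD2l.
by apply: lt_ereal_dec_le mQ (grid_homo _); lia.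
Qed.

Lemma matched_middle delta (N : nat) (P Q : point) (n : int) :
  delta < eps * N%:R ->
  near_by delta (undecorate P.1) (undecorate Q.1) ->
  near_by delta (undecorate P.2) (undecorate Q.2) ->
  grid_support P n -> grid_support P (n + N%:Z + N%:Z) ->
  grid_support Q (n + N%:Z).
Proof.
move=> dN [pq1 qp1] [pq2 qp2] [Pn _] [_ mP]; split.
  apply: undecorate_lt_dec; apply: (le_lt_trans qp1).
  apply: (@le_lt_trans _ _ (grid n + delta%:E)%E).
    by rewrite leeD2rE //; exact: lt_dec_undecorate.
  by rewrite -EFinD lte_fin rmorphD mulrDr ltrD2l.
apply: undecorate_lt_ereal; rewrite -(lteD2rE _ _ (erefl : delta%:E \is a fin_num)).
apply: lt_le_trans (le_trans (lt_undecorate_dec mP) pq2).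
by rewrite -EFinD lte_fin [X in _ < eps * X](rmorphD _ (n + N%:Z)) mulrDr ltrD2l.
Qed.

Definition bar_match (I I' : Type) (E : I -> point * nat -> Prop)
    (E' : I' -> point * nat -> Prop) (M : point * nat -> point * nat -> Prop) s s' : Prop :=
  exists2 P, E s P & exists2 Q, M P Q & E' s' Q.

Lemma near_by_sym delta (a b : \bar R) : near_by delta a b -> near_by delta b a.
Proof. by case. Qed.

Lemma dec_matching_sym delta (m1 m2 : multiset point) M :
  dec_matching delta m1 m2 M -> dec_matching delta m2 m1 (fun z x => M x z).
Proof.
move=> [M1 M2 M3 M4 M5]; split=> //.
- exact: partial_bij_sym.
- by move=> z x /M2[].
- by move=> z x /M3[/near_by_sym ? /near_by_sym].
Qed.

Section BarMatch.
Variables (U V : pmod k R) (delta : R) (N : nat).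
Variables (I I' : choiceType) (S : set I) (S' : set I').
Variables (e : I -> forall n, restriction U n) (e' : I' -> forall n, restriction V n).
Variables (E : I -> point * nat -> Prop) (E' : I' -> point * nat -> Prop).
Variable M : point * nat -> point * nat -> Prop.
Hypotheses (delta_ge0 : 0 <= delta) (deltaN : delta + eps < eps * N%:R).
Hypotheses (bU : barcode S e) (bV : barcode S' e').
Hypothesis EP : [/\ partial_bij E,
  forall s P, E s P -> [/\ S s, copies (Dgm U) P & [set n | e s n != 0] = grid_support P.1],
  forall s n m, S s -> n < m -> e s n != 0 -> e s m != 0 -> exists P, E s P
  & forall P n m, copies (Dgm U) P -> n < m -> grid_support P.1 n ->
      grid_support P.1 m -> exists s, E s P].
Hypothesis E'P : [/\ partial_bij E',
  forall s P, E' s P -> [/\ S' s, copies (Dgm V) P & [set n | e' s n != 0] = grid_support P.1],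
  forall s n m, S' s -> n < m -> e' s n != 0 -> e' s m != 0 -> exists P, E' s P
  & forall P n m, copies (Dgm V) P -> n < m -> grid_support P.1 n ->
      grid_support P.1 m -> exists s, E' s P].
Hypothesis MP : dec_matching delta (Dgm U) (Dgm V) M.

Let deltaN' : delta < eps * N%:R.
Proof. by apply: lt_trans deltaN; rewrite ltrDl. Qed.

Lemma bar_match_mid s s' n : bar_match E E' M s s' -> e s n != 0 ->
  e s (n + N%:Z + N%:Z) != 0 -> e' s' (n + N%:Z) != 0.
Proof.
move=> [P sP [Q PQ sQ]] en em.
have [_ EP2 _ _] := EP; have [_ EP2' _ _] := E'P; have [_ _ MP3 _ _] := MP.
have [_ _ eP] := EP2 _ _ sP; have [_ _ eQ] := EP2' _ _ sQ.
have [n1 n2] := MP3 _ _ PQ.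
have Pn : grid_support P.1 n by rewrite -eP.
have Pm : grid_support P.1 (n + N%:Z + N%:Z) by rewrite -eP.
by have := matched_middle deltaN' n1 n2 Pn Pm; rewrite -eQ.
Qed.

(** A bar that survives [2 N] steps comes from a diagram point too long to be unmatched; the matched
    point has two grid points in its trace and so comes from a bar. *)
Lemma bar_match_unmatched s n : S s -> (forall s', ~ bar_match E E' M s s') ->
  e s n != 0 -> e s (n + N%:Z + N%:Z) = 0.
Proof.
move=> Ss none en; apply/eqP; apply: contraT => em.
have [_ EP2 EP3 _] := EP; have [_ _ _ EP4'] := E'P; have [_ MP2 MP3 MP4 _] := MP.
have N_gt0 : (0 < N)%N.
  rewrite lt0n; apply/eqP => N0; move: deltaN; rewrite N0 mulr0.
  by apply/negP; rewrite -leNgt addr_ge0 // ltW.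
have nm : n < n + N%:Z + N%:Z by lia.
have [P sP] := EP3 s n _ Ss nm en em.
have [_ mP eP] := EP2 _ _ sP.
have Pn : grid_support P.1 n by rewrite -eP.
have Pm : grid_support P.1 (n + N%:Z + N%:Z) by rewrite -eP.
have [Q PQ] : exists Q, M P Q.
  apply: contrapT => nQ; have : short delta P.1.
    by apply: MP4 => // Q PQ; apply: nQ; exists Q.
  rewrite /short leNgt => /negP; apply.
  apply: lt_le_trans (lt_undecorate_dec Pm.2).
  apply: le_lt_trans (_ : (_ <= grid n + delta%:E + delta%:E)%E) _.
    by rewrite !leeD2rE //; apply: lt_dec_undecorate Pn.1.
  rewrite -!EFinD lte_fin !rmorphD /= !mulrDr; move: deltaN'; lra.
have [_ mQ] := MP2 _ _ PQ; have [n1 n2] := MP3 _ _ PQ.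
have Qn := matched_middle deltaN' n1 n2 Pn Pm.
(* The extra [eps] in [deltaN] provides this second grid point, which places [Q] within the reach of
   the correspondence with bars. *)
have Qn' : grid_support Q.1 (n + N%:Z - 1).
  split; last by apply: lt_ereal_dec_le Qn.2 (grid_homo _); lia.
  apply: undecorate_lt_dec; apply: (le_lt_trans n1.2).
  apply: (@le_lt_trans _ _ (grid n + delta%:E)%E).
    by rewrite leeD2rE //; apply: lt_dec_undecorate Pn.1.
  rewrite -EFinD lte_fin rmorphB rmorphD /= mulrBr mulrDr mulr1; move: deltaN; lra.
have lt1 : n + N%:Z - 1 < n + N%:Z by lia.
have [s' sQ] := EP4' Q _ _ mQ lt1 Qn' Qn.
by case: (none s'); exists P => //; exists Q.
Qed.

Lemma bar_match_morphism :
  exists Phi : forall n, {linear restriction U n -> restriction V (n + N%:Z)},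
  [/\ forall n m (h : n <= m) (h' : n + N%:Z <= m + N%:Z) x,
        Phi m (pm_map (restriction U) h x) = pm_map (restriction V) h' (Phi n x),
      forall s s' n, bar_match E E' M s s' -> e s n != 0 ->
        Phi n (e s n) = e' s' (n + N%:Z)
    & forall s n, S s -> (forall s', ~ bar_match E E' M s s') -> e s n != 0 ->
        Phi n (e s n) = 0].
Proof.
have [EP1 EP2 _ _] := EP; have [EP1' EP2' _ _] := E'P; have [MP1 _ MP3 _ _] := MP.
apply: (barcode_morphism bU bV).
- exact: partial_bij_comp EP1 (partial_bij_comp MP1 (partial_bij_sym EP1')).
- by move=> s s' [P /EP2[Ss _ _] [Q _ /EP2'[Ss' _ _]]].
move=> s s' n m [P sP [Q PQ sQ]] nm en em.
have [_ _ eP] := EP2 _ _ sP; have [_ _ eQ] := EP2' _ _ sQ.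
have [n1 n2] := MP3 _ _ PQ.
have Pn : grid_support P.1 n by rewrite -eP.
have Qm : grid_support Q.1 (m + N%:Z) by rewrite -eQ.
by have [] := matched_support deltaN' n1 n2 nm Pn Qm; rewrite -eP -eQ.
Qed.

End BarMatch.

Lemma grid_interleaving U V delta (N : nat) M : qtame U -> qtame V ->
  0 <= delta -> delta + eps < eps * N%:R -> dec_matching delta (Dgm U) (Dgm V) M ->
  exists (Phi : forall n, {linear restriction U n -> restriction V (n + N%:Z)})
         (Psi : forall n, {linear restriction V n -> restriction U (n + N%:Z)}),
  [/\ forall n m (h : n <= m) (h' : n + N%:Z <= m + N%:Z) x,
        Phi m (pm_map (restriction U) h x) = pm_map (restriction V) h' (Phi n x),
      forall n m (h : n <= m) (h' : n + N%:Z <= m + N%:Z) x,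
        Psi m (pm_map (restriction V) h x) = pm_map (restriction U) h' (Psi n x),
      forall n (h : n <= n + N%:Z + N%:Z) x,
        Psi (n + N%:Z) (Phi n x) = pm_map (restriction U) h x
    & forall n (h : n <= n + N%:Z + N%:Z) x,
        Phi (n + N%:Z) (Psi n x) = pm_map (restriction V) h x].
Proof.
move=> qU qV d0 dN MP.
have [I [S [e bU]]] := barcode_exists (restriction_stable qU).
have [I' [S' [e' bV]]] := barcode_exists (restriction_stable qV).
have [E EP] := barcode_points qU bU; have [E' EP'] := barcode_points qV bV.
have MP' := dec_matching_sym MP.
have [Phi [Phi_nat PhiG Phi0]] := bar_match_morphism dN bU bV EP EP' MP.
have [Psi [Psi_nat PsiG Psi0]] := bar_match_morphism dN bV bU EP' EP MP'.
have flip s s' : bar_match E E' M s s' -> bar_match E' E (fun z x => M x z) s' s.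
  by move=> [P sP [Q PQ sQ]]; exists Q => //; exists P.
have flip' s s' : bar_match E' E (fun z x => M x z) s' s -> bar_match E E' M s s'.
  by move=> [P sP [Q PQ sQ]]; exists Q => //; exists P.
have GS s s' : bar_match E E' M s s' -> S s /\ S' s'.
  have [_ EP2 _ _] := EP; have [_ EP2' _ _] := EP'.
  by move=> [P /EP2[Ss _ _] [Q _ /EP2'[Ss' _ _]]].
exists Phi, Psi; split=> //.
  apply: (barcode_interleaving bU bV GS PhiG Phi0).
  - by move=> s s' n /flip; apply: PsiG.
  - by move=> s s' n; apply: (bar_match_mid dN EP EP' MP).
  - by move=> s n; apply: (bar_match_unmatched d0 dN EP EP' MP).
apply: (barcode_interleaving bV bU _ PsiG Psi0).
- by move=> s' s /flip' /GS[].
- by move=> s' s n /flip'; apply: PhiG.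
- by move=> s s' n; apply: (bar_match_mid dN EP' EP MP').
- by move=> s n; apply: (bar_match_unmatched d0 dN EP' EP MP').
Qed.

(** Each [t] is rounded up to the grid, moved [N] steps there and mapped on to [t + D]. Rounding
    costs less than one step, whence [N.+1]. *)
Lemma interleaved_of_matching U V delta (N : nat) M : qtame U -> qtame V ->
  0 <= delta -> delta + eps < eps * N%:R -> dec_matching delta (Dgm U) (Dgm V) M ->
  interleaved (eps * N.+1%:R) U V.
Proof.
move=> qU qV d0 dN /(grid_interleaving qU qV d0 dN)[Phi [Psi [Phi_nat Psi_nat PhiK PsiK]]].
set D := eps * N.+1%:R.
pose up (t : R) : int := Num.ceil (t / eps).
have le_up t : (t%:E <= grid (up t))%E.
  by rewrite lee_fin mulrC -ler_pdivrMr // ceil_ge.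
have up_le t : (grid (up t + N%:Z) <= (t + D)%:E)%E.
  have := ceilB1_lt (t / eps); rewrite -/(up t) ltr_pdivlMr // rmorphB mulrBl mul1r.
  rewrite lee_fin /D rmorphD -[N.+1%:R]natr1 /= !mulrDr mulr1.
  by rewrite -[N%:~R]/(N%:R : R); lra.
have up_homo s t : s <= t -> up s <= up t.
  by move=> st; apply: le_ceil; rewrite ler_pM2r ?invr_gt0.
have up_shift t : up t + N%:Z <= up (t + D).
  have := le_trans (up_le t) (le_up (t + D)).
  by rewrite lee_fin ler_pM2l // ler_int.
pose lift (X Y : pmod k R)
    (F : forall n, {linear restriction X n -> restriction Y (n + N%:Z)})
    (t : R) : {linear X t -> Y (t + D)} :=
  pm_map (ext Y) (up_le t) \o F (up t) \o pm_map (ext X) (le_up t).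
have lift_nat (X Y : pmod k R)
    (F : forall n, {linear restriction X n -> restriction Y (n + N%:Z)}) :
    (forall n m (h : n <= m) (h' : n + N%:Z <= m + N%:Z) x,
        F m (pm_map (restriction X) h x) = pm_map (restriction Y) h' (F n x)) ->
    shift_morphism (lift X Y F).
  move=> F_nat s t st st' x.
  pose stE : (s%:E <= t%:E)%O := st.
  pose stE' : ((s + D)%:E <= (t + D)%:E)%O := st'.
  have up_st := up_homo s t st.
  have up_st' : up s + N%:Z <= up t + N%:Z by rewrite lerD2r.
  have h1 : (s%:E <= grid (up t))%O := le_trans stE (le_up t).
  have h2 : (grid (up s + N%:Z) <= (t + D)%:E)%O := le_trans (up_le s) stE'.
  transitivity (pm_map (ext Y) (up_le t)
    (F (up t) (pm_map (ext X) (le_up t) (pm_map (ext X) stE x)))).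
    by [].
  rewrite (pm_map_comp (p := ext X) stE (le_up t) h1).
  rewrite -(pm_map_comp (p := ext X) (le_up s) (grid_homo up_st) h1).
  rewrite (F_nat _ _ up_st up_st').
  rewrite (pm_map_comp (p := ext Y) (grid_homo up_st') (up_le t) h2).
  by rewrite -(pm_map_comp (p := ext Y) (up_le s) stE' h2).
have lift_comp (X Y : pmod k R)
    (F : forall n, {linear restriction X n -> restriction Y (n + N%:Z)})
    (F' : forall n, {linear restriction Y n -> restriction X (n + N%:Z)}) :
    (forall n m (h : n <= m) (h' : n + N%:Z <= m + N%:Z) x,
        F' m (pm_map (restriction Y) h x) = pm_map (restriction X) h' (F' n x)) ->
    (forall n (h : n <= n + N%:Z + N%:Z) x,
        F' (n + N%:Z) (F n x) = pm_map (restriction X) h x) ->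
    forall (t : R) (h : t <= t + D + D) (x : X t),
      lift Y X F' (t + D) (lift X Y F t x) = pm_map X h x.
  move=> F'_nat F'K t h x.
  pose hE : (t%:E <= (t + D + D)%:E)%O := h.
  have h1 := up_shift t.
  have h1' : up t + N%:Z + N%:Z <= up (t + D) + N%:Z by rewrite lerD2r.
  have h2 : up t <= up t + N%:Z + N%:Z by lia.
  have h3 := le_trans (le_up t) (grid_homo h2).
  have h4 := le_trans h3 (grid_homo h1').
  transitivity (pm_map (ext X) (up_le (t + D)) (F' (up (t + D))
    (pm_map (ext Y) (le_up (t + D)) (pm_map (ext Y) (up_le t)
      (F (up t) (pm_map (ext X) (le_up t) x)))))); first by [].
  rewrite (pm_map_comp (p := ext Y) (up_le t) (le_up (t + D)) (grid_homo h1)).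
  rewrite (F'_nat _ _ h1 h1') (F'K _ h2).
  rewrite (pm_map_comp (p := ext X) (le_up t) (grid_homo h2) h3).
  rewrite (pm_map_comp (p := ext X) h3 (grid_homo h1') h4).
  by rewrite (pm_map_comp (p := ext X) h4 (up_le (t + D)) hE).
exists (lift U V Phi), (lift V U Psi); split.
- exact: lift_nat.
- exact: lift_nat.
- exact: lift_comp.
- exact: lift_comp.
Qed.

End Grid.

Lemma matching_interleaved (k : fieldType) (R : realType) (U V : pmod k R)
    (delta eta : R) N : qtame U -> qtame V -> 0 <= delta -> 0 < eta ->
  dec_matching delta (Dgm U) (Dgm V) N ->
  exists2 delta', 0 <= delta' <= delta + eta & interleaved delta' U V.
Proof.
(* Three grid steps exceed [delta]: the margin in the condition on [N], rounding up to an integer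
   [N], and rounding times to the grid. *)
move=> qU qV d0 eta0 match_N; pose eps := eta / 3.
have eps0 : 0 < eps by rewrite divr_gt0.
pose K := Num.truncn ((delta + eps) / eps).
have /andP[K1 K2] : K%:R <= (delta + eps) / eps < K.+1%:R.
  by apply/truncn_itv/divr_ge0; [apply: addr_ge0 => //|]; apply: ltW.
have dK : delta + eps < eps * K.+1%:R by rewrite mulrC -ltr_pdivrMr.
exists (eps * K.+2%:R); last exact: (interleaved_of_matching eps0 qU qV d0 dK match_N).
rewrite mulr_ge0 ?(ltW eps0) //=.
move: K1; rewrite ler_pdivlMr // => K1.
have e3 : eps * 3 = eta by rewrite /eps; lra.
by rewrite -addn2 natrD mulrDr [eps * K%:R]mulrC; lra.
Qed.

Theorem theorem4p11 (k : fieldType) (R : realType) (U V : pmod k R)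
    (hU : qtame U) (hV : qtame V) :
  interleaving_distance U V = bottleneck_distance (dgm U) (dgm V).
Proof.
have ltU := (Dgm_diagram hU).1; have ltV := (Dgm_diagram hV).1.
apply/eqP; rewrite eq_le; apply/andP; split.
  apply: le_ereal_inf_tmp => _ [delta [d0 [M isM]] <-].
  have [N match_N] := (matching_transfer d0 ltU ltV).2 (ex_intro _ M isM).
  (* A matching gives interleavings only up to an arbitrary [eta], which the infimum absorbs. *)
  apply/lee_addgt0Pr => eta eta0.
  have [delta' /andP[d0' dd'] il] := matching_interleaved hU hV d0 eta0 match_N.
  apply: (@le_trans _ _ delta'%:E); last by rewrite -EFinD lee_fin.
  by apply: ereal_inf_lbound; exists delta'.
apply: le_ereal_inf_tmp => _ [delta [d0 il] <-].
apply: ereal_inf_lbound; exists delta => //; split=> //.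
apply/(matching_transfer d0 ltU ltV).
exact: interleaved_matching.
Qed.
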